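(* Let $r_1,r_2,r_3>0$ be pairwise different. For all charges $q=(q_1,q_2,q_3)$ with $q_i>0$, all aligned configurations in $T(r_1,r_2,r_3)$ are critical points of the Coulomb energy $E_q=\frac{q_1q_2}{d_3}+\frac{q_2q_3}{d_1}+\frac{q_3q_1}{d_2}$. More precisely: (1) The configuration with $\alpha_1=\alpha_2=\alpha_3=0$ is a non-degenerate maximum of $E_q$, and it is the absolute maximum, for all $(q_1,q_2,q_3)$. (2) For each of the other three aligned configurations $P$, namely $(\alpha_1,\alpha_2,\alpha_3)\in\{(\pi,\pi,0),(0,\pi,0)',(\pi,0,0)'\}$ where $(0,\pi,0)'$ stands for $(0,\pi,\pi)$ and $(\pi,0,0)'$ stands for $(\pi,0,\pi)$, the type of $P$ depends on $(q_1,q_2,q_3)$, and $P$ undergoes a pitchfork bifurcation which transforms a minimum into a saddle point. That is, let $B_P\subset(0,\infty)^3$ be the set of charges $q$ for which $P$ is a degenerate critical point of $E_q$; then $B_P$ is a non-empty hypersurface, $(0,\infty)^3\setminus B_P$ is the disjoint union of two non-empty open sets such that $P$ is a non-degenerate local minimum of $E_q$ for $q$ in one of them and a non-degenerate saddle point of $E_q$ for $q$ in the other, and at every $q^0\in B_P$ the family $E_q$ has a pitchfork bifurcation at $P$.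
   Context: $T(r_1,r_2,r_3)=\{(p_1,p_2,p_3)\mid p_i\in\mathbb{R}^2,\ |p_1|=r_1,\ |p_2|=r_2,\ |p_3|=r_3\}/SO(2)$ is the configuration space of triples of points on three concentric circles centered at the origin $p_0=0$, modulo rotations; it is diffeomorphic to the torus $S^1\times S^1$. Notation: $d_1=|p_2p_3|$, $d_2=|p_3p_1|$, $d_3=|p_1p_2|$; $\alpha_1=\angle(p_2p_0p_3)$, $\alpha_2=\angle(p_3p_0p_1)$, $\alpha_3=\angle(p_1p_0p_2)$ are oriented angles at the center modulo $2\pi$ (from the first-named to the last-named point), so $\alpha_1+\alpha_2+\alpha_3\equiv0\pmod{2\pi}$; any two of them are coordinates on the torus. A configuration is aligned if $p_1,p_2,p_3$ lie on one line through the origin, i.e. all $\alpha_i\equiv0$ modulo $\pi$; there are exactly four aligned configurations. A (supercritical) pitchfork bifurcation of the family $E_q$ at $P$ for $q=q^0$ means: for $q$ near $q^0$ there are smooth local coordinates $(x,y)$ on $T(r_1,r_2,r_3)$ centered at $P$, depending smoothly on $q$, and smooth functions $c(q),\lambda(q)$ with $\lambda(q^0)=0$ and $d\lambda(q^0)\ne0$, such that $E_q=c(q)+\frac{x^4}{4}-\lambda(q)\frac{x^2}{2}+y^2$ near $P$. (Thus $P$ is a minimum for $\lambda<0$, and for $\lambda>0$ it is a saddle accompanied by two nearby minima at $x=\pm\sqrt{\lambda},\ y=0$.) *)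

(* Defs.v *)
From mathcomp Require Import all_boot all_order all_algebra.
From mathcomp Require Import all_classical all_reals all_analysis.
From mathcomp Require Import lra.

Set Implicit Arguments.
Unset Strict Implicit.
Unset Printing Implicit Defensive.

Import Order.TTheory GRing.Theory Num.Theory.
Import numFieldNormedType.Exports.

Local Open Scope classical_set_scope.
Local Open Scope ring_scope.
Local Open Scope quotient_scope.

Section Smooth.
Context {R : realType}.

(* For finite-dimensional V and open U these are the usual classes C^n(U) and
   C^oo(U): all iterated directional derivatives up to order n exist on U and
   are continuous there. *)
Fixpoint Cn_on (n : nat) (V W : normedModType R) (U : set V) (f : V -> W) :
    Prop :=
  if n is n'.+1 then
    forall v : V,
      (forall x, U x -> derivable f x v) /\ Cn_on n' U (fun x => 'D_v f x)
  else forall x, U x -> {for x, continuous f}.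

Definition smooth_on (V W : normedModType R) (U : set V) (f : V -> W) : Prop :=
  forall n, Cn_on n U f.

Definition diffeo_on (V W : normedModType R) (U : set V) (f : V -> W) : Prop :=
  [/\ open U, open (f @` U), smooth_on U f &
      exists g : W -> V, smooth_on (f @` U) g /\ (forall x, U x -> g (f x) = x)].

(* B is locally a regular level set of a smooth function, i.e. an embedded
   submanifold of codimension one. *)
Definition hypersurface (V : normedModType R) (B : set V) : Prop :=
  forall x0, B x0 -> exists (U : set V) (g : V -> R),
    [/\ open_nbhs x0 U, smooth_on U g, (forall x, U x -> (B x <-> g x = 0)) &
        forall x, U x -> B x -> exists v, 'D_v g x != 0].

End Smooth.

Section Plane.
Context {R : realType}.

(* The norm of the library on row vectors is the sup norm. *)
Definition enorm (u : 'rV[R]_2) : R := Num.sqrt (\sum_j u 0 j ^+ 2).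

Definition SO2 (A : 'M[R]_2) : Prop := A *m A^T = 1%:M /\ \det A = 1.

(* Matrices act on row vectors from the right:
   (1, 0) *m rot t = (cos t, sin t). *)
Definition rot (t : R) : 'M[R]_2 :=
  \matrix_(i < 2, j < 2)
    if i == j then cos t else if (i < j)%N then sin t else - sin t.

(* For nonzero u and v this determines a modulo 2 pi. *)
Definition oriented_angle (u v : 'rV[R]_2) (a : R) : Prop :=
  enorm u *: v = enorm v *: (u *m rot a).

Lemma rot_SO2 t : SO2 (rot t).
Proof.
have c2s2 := cos2Dsin2 t; split.
  apply/matrixP => i j; rewrite !mxE !big_ord_recl big_ord0 !mxE /= addr0.
  by case: i => [[|[|i]]//= ?]; case: j => [[|[|j]]//= ?];
    rewrite /= ?mulr1n ?mulr0n; move: c2s2; rewrite !expr2; lra.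
rewrite (expand_det_row _ 0) !big_ord_recl big_ord0 !mxE /= addr0.
rewrite /cofactor !det_mx11 !mxE /= expr0 expr1; move: c2s2; rewrite !expr2; lra.
Qed.

Lemma enorm_SO2 A u : SO2 A -> enorm (u *m A) = enorm u.
Proof.
have E w : enorm w = Num.sqrt ((w *m w^T) 0 0).
  by rewrite /enorm !mxE; congr Num.sqrt; apply: eq_bigr => j _; rewrite mxE.
by move=> [AA _]; rewrite !E trmx_mul mulmxA -[u *m A *m _]mulmxA AA mulmx1.
Qed.

End Plane.

Section ConfigurationSpace.
Context {R : realType} (r : 'I_3 -> R).

(* Triples of points of the plane, the i-th one being the i-th row. The
   indices 0, 1, 2 : 'I_3 stand for 1, 2, 3; arithmetic on 'I_3 is modulo 3. *)
Definition on_circles : pred 'M[R]_(3, 2) :=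
  fun p => [forall i, enorm (row i p) == r i].

Definition triple := {p : 'M[R]_(3, 2) | on_circles p}.

Definition rot_rel : rel triple :=
  fun p p' => `[< exists A, SO2 A /\ val p' = val p *m A >].

Lemma rot_rel_refl : reflexive rot_rel.
Proof.
move=> p; apply/asboolP; exists 1%:M; rewrite mulmx1; split=> //.
by split; rewrite ?det1 // trmx1 mulmx1.
Qed.

Lemma rot_rel_sym : symmetric rot_rel.
Proof.
suff H p p' : rot_rel p p' -> rot_rel p' p by move=> p p'; apply/idP/idP => /H.
move=> /asboolP[A [[AA dA] E]]; apply/asboolP; exists A^T; split.
  by split; rewrite ?det_tr // trmxK (mulmx1C AA).
by rewrite E -mulmxA AA mulmx1.
Qed.

Lemma rot_rel_trans : transitive rot_rel.
Proof.
move=> p2 p1 p3 /asboolP[A [[AA dA] E2]] /asboolP[B [[BB dB] E3]].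
apply/asboolP; exists (A *m B); split; last by rewrite E3 E2 mulmxA.
split; last by rewrite det_mulmx dA dB mulr1.
by rewrite trmx_mul mulmxA -[A *m B *m _]mulmxA BB mulmx1.
Qed.

Canonical rot_equiv : equiv_rel triple :=
  EquivRel rot_rel rot_rel_refl rot_rel_sym rot_rel_trans.

Definition confspace := {eq_quot rot_equiv}.

(* Everything below is invariant under SO(2), so the choice of representative
   is immaterial. *)
Definition points (P : confspace) : 'M[R]_(3, 2) := val (repr P).

(* d_i = |p_(i+1) p_(i+2)| *)
Definition dist (P : confspace) (i : 'I_3) : R :=
  enorm (row (i + 1) (points P) - row (i + 2) (points P)).

Definition energy (q : 'rV[R]_3) (P : confspace) : R :=
  \sum_(i < 3) q 0 (i + 1) * q 0 (i + 2) / dist P i.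

(* a = (alpha_1, alpha_2, alpha_3) up to multiples of 2 pi, alpha_i being the
   oriented angle from p_(i+1) to p_(i+2). *)
Definition has_angles (P : confspace) (a : R * R * R) : Prop :=
  forall i : 'I_3,
    oriented_angle (row (i + 1) (points P)) (row (i + 2) (points P))
      (tnth [tuple a.1.1; a.1.2; a.2] i).

Definition aligned (P : confspace) : Prop :=
  exists2 u : 'rV[R]_2, u != 0 &
    forall i, exists t, row i (points P) = t *: u.

Definition turn (t : 'I_3 -> R) (p : 'M[R]_(3, 2)) : 'M[R]_(3, 2) :=
  \matrix_(i < 3) (row i p *m rot (t i)).

Lemma turn_on_circles t p : on_circles p -> on_circles (turn t p).
Proof.
move=> /forallP pr; apply/forallP => i.
by rewrite rowK enorm_SO2 //; exact: rot_SO2.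
Qed.

(* The coordinates (alpha_1, alpha_2) on the torus, translated so that P has
   coordinates 0: rotating p_1 by a_2 and p_2 by - a_1 with p_3 fixed increases
   alpha_1 by a_1 and alpha_2 by a_2. The map chart P : R^2 -> T is a local
   diffeomorphism, and the local differential notions below are read off at
   the origin of R^2 through it. *)
Definition chart (P : confspace) (a : 'rV[R]_2) : confspace :=
  \pi_confspace
    (Sub (turn (tnth [tuple a 0 1; - a 0 0; 0]) (points P))
         (turn_on_circles _ (valP (repr P))) : triple).

Section Critical.
Variables (f : confspace -> R) (P : confspace).

Definition critical : Prop :=
  differentiable (f \o chart P) (0 : 'rV[R]_2) /\
  forall v : 'rV[R]_2, 'd (f \o chart P) (0 : 'rV[R]_2) v = 0.

Definition hessian : 'M[R]_2 :=
  \matrix_(i < 2, j < 2)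
    'D_(delta_mx 0 i) (fun x => 'D_(delta_mx 0 j) (f \o chart P) x)
      (0 : 'rV[R]_2).

Definition nondegenerate_critical : Prop := critical /\ \det hessian != 0.

Definition degenerate_critical : Prop := critical /\ \det hessian = 0.

Definition local_min : Prop :=
  \forall a \near (0 : 'rV[R]_2), f P <= f (chart P a).

Definition local_max : Prop :=
  \forall a \near (0 : 'rV[R]_2), f (chart P a) <= f P.

Definition nondegenerate_min : Prop := nondegenerate_critical /\ local_min.

Definition nondegenerate_max : Prop := nondegenerate_critical /\ local_max.

Definition nondegenerate_saddle : Prop :=
  [/\ nondegenerate_critical, ~ local_min & ~ local_max].

End Critical.

(* (x, y) = phi (q, _) are the local coordinates, written in terms of the
   fixed coordinates given by chart P. *)
Definition pitchfork (E : 'rV[R]_3 -> confspace -> R) (P : confspace)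
    (q0 : 'rV[R]_3) : Prop :=
  exists (W : set 'rV[R]_3) (N : set 'rV[R]_2) (c lambda : 'rV[R]_3 -> R)
         (phi : 'rV[R]_3 * 'rV[R]_2 -> 'rV[R]_2),
  [/\ open_nbhs q0 W /\ open_nbhs (0 : 'rV[R]_2) N,
      smooth_on W c,
      [/\ smooth_on W lambda, lambda q0 = 0 & exists v, 'D_v lambda q0 != 0],
      smooth_on (W `*` N) phi &
      forall q, W q ->
        [/\ diffeo_on N (fun a => phi (q, a)), phi (q, 0) = 0 &
            forall a, N a ->
              let x := phi (q, a) 0 0 in
              let y := phi (q, a) 0 1 in
              E q (chart P a)
                = c q + x ^+ 4 / 4 - lambda q * (x ^+ 2 / 2) + y ^+ 2]].

End ConfigurationSpace.

Definition positive_charges {R : realType} : set 'rV[R]_3 :=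
  [set q | forall i, 0 < q 0 i].

Definition degenerate_charges {R : realType} (r : 'I_3 -> R) (P : confspace r) :
    set 'rV[R]_3 :=
  [set q | positive_charges q /\ degenerate_critical (energy q) P].

(* Main.v *)
Require Import Defs.
From mathcomp Require Import all_boot all_order all_algebra.
From mathcomp Require Import all_classical all_reals all_analysis.
From mathcomp Require Import ring lra.

(* In the chart at an aligned configuration the energy is a sum of three functions
   c_i g_i, g_i depending only on the angle alpha_i and being even. With half-angle
   tangents t_1, t_2 and X = tan((alpha_1 + alpha_2) / 2), each g_i is an algebraic
   function of the square of a tangent. The Hessian determinant is, up to a positive
   factor, a linear form in q, which gives the hypersurface and the two open sets.
   At a degenerate point where alpha_3 is the angle equal to 0, write t_1 = X w and
   s = X^2: the energy becomes const + s L(q, s, w), where L is smooth also for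
   s < 0 and strictly convex in w. Minimizing over w (implicit function theorem)
   splits off a square y^2 and leaves k(q, s) = s L(q, s, w(q, s)), with
   k_s = 0 and k_ss > 0 at (q0, 0); the sign of k_ss comes from
   w^3 + (1 - w)^3 + 2 w (1 - w) < 1. Completing the square of k in s gives
   S = x^2 and lambda(q) with k = S^2 / 4 - lambda S / 2. *)

Set Implicit Arguments.
Unset Strict Implicit.
Unset Printing Implicit Defensive.

Import Order.TTheory GRing.Theory Num.Theory.
Import numFieldNormedType.Exports.

Local Open Scope classical_set_scope.
Local Open Scope ring_scope.

(** * Difference quotient calculus *)

Section Calculus.
Context {R : realType}.
Implicit Types V W X : normedModType R.

(** The normal form has to be smooth jointly in charges and angles, and its coordinates must be
    diffeomorphisms on one neighbourhood that serves all nearby charges. Difference quotients suit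
    this because composition and implicit functions keep explicit domains; the coordinate change is
    assembled from linear and triangular maps, which can be inverted on a fixed box. Half-angle
    tangents are chosen because their subtraction formula is rational: the blow-up turns the second
    tangent into X (1 - w) / (1 + s w), so that X enters only through s. Evenness of the energy is
    then built in, and x becomes X times a positive smooth function. The price is that the blow-up
    sees only the directions with t_1 / X near the minimizing w; a second Morse argument in the
    variables (X, t_1), with uniqueness of critical points, covers a full neighbourhood. Most
    derivatives are read off without computing limits: an identity is divided by a nonzero parameter
    and extended to zero by continuity. Transversality of lambda is tested along the charge with the
    index of the zero angle, because w does not move in that direction. *)

Definition quot_dom V (U : set V) : set (V * V * R) :=
  [set p | U p.1.1 /\ U (p.1.1 + p.2 *: p.1.2)].

(* C^n in the sense of Bertram, Gloeckner and Neeb: the difference quotient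
   extends to a C^(n-1) function of (x, v, t), including t = 0. Hadamard's lemma is
   thus part of the definition, and no partial derivatives are needed to prove
   closure under composition or the implicit function theorem. *)
Fixpoint bgn (n : nat) V W (U : set V) (f : V -> W) : Prop :=
  (forall x, U x -> {for x, continuous f}) /\
  (if n is n'.+1 then exists f1 : V * V * R -> W,
     (forall x v t, U x -> U (x + t *: v) ->
        f (x + t *: v) - f x = t *: f1 (x, v, t)) /\
     bgn n' (quot_dom U) f1
   else True).

Lemma open_quot_dom V (U : set V) : open U -> open (quot_dom U).
Proof.
move=> oU; apply: openI.
  by apply: open_comp => // p _; apply: cvg_comp; apply: cvg_fst.
apply: open_comp => // p _; apply: cvgD.
  by apply: cvg_comp; apply: cvg_fst.
apply: cvgZ; first exact: cvg_snd.
by apply: cvg_comp; [apply: cvg_fst | apply: cvg_snd].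
Qed.

Lemma bgn_cts n V W (U : set V) (f : V -> W) x :
  bgn n U f -> U x -> {for x, continuous f}.
Proof. by case: n => [|n] [cf _]; exact: cf. Qed.

Lemma bgnW n V W (U : set V) (f : V -> W) : bgn n.+1 U f -> bgn n U f.
Proof.
elim: n V U f => [|n IH] V U f; first by case.
by move=> [cf [f1 [fE /IH bf1]]]; split=> //; exists f1.
Qed.

Lemma bgn_sub n V W (U U' : set V) (f : V -> W) :
  U' `<=` U -> bgn n U f -> bgn n U' f.
Proof.
elim: n V U U' f => [|n IH] V U U' f UU' [cf H].
  by split=> // x /UU'; exact: cf.
split=> [x /UU'|]; first exact: cf.
case: H => f1 [fE bf1]; exists f1; split=> [x v t /UU' Ux /UU' Uxv|].
  exact: fE.
by apply: IH bf1 => p [/UU' ? /UU'].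
Qed.

(** Continuity is taken in the whole space, so openness of [U] is what transfers it from [f] to [g].
    The same [f1] then serves both functions. *)
Lemma bgn_ext n V W (U : set V) (f g : V -> W) :
  open U -> (forall x, U x -> f x = g x) -> bgn n U f -> bgn n U g.
Proof.
move=> oU fg bf.
have cg x : U x -> {for x, continuous g}.
  move=> Ux; have /(_ x Ux) cf := fun x => @bgn_cts n V W U f x bf.
  move: cf; rewrite /prop_for /continuous_at -(fg x Ux).
  apply: cvg_trans; apply: near_eq_cvg.
  by near=> y; rewrite fg//; near: y; exact: open_nbhs_nbhs.
case: n bf => [|n] [cf H]; first by split.
split=> //; case: H => f1 [fE bf1]; exists f1; split=> // x v t Ux Uxv.
by rewrite -!fg// fE.
Unshelve. all: by end_near. Qed.

Lemma bgn_cst n V W (U : set V) (c : W) : bgn n U (fun _ : V => c).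
Proof.
elim: n V U c => [|n IH] V U c; first by split=> // x _; exact: cvg_cst.
split=> [x _|]; first exact: cvg_cst.
by exists (fun=> 0); split=> // x v t _ _; rewrite subrr scaler0.
Qed.

Definition lincont V W (f : V -> W) : Prop :=
  (forall a x y, f (a *: x + y) = a *: f x + f y) /\ continuous f.

Lemma lincont_fst V W : lincont (fst : V * W -> V).
Proof. by split; [move=> a x y|move=> p; exact: cvg_fst]. Qed.

Lemma lincont_snd V W : lincont (snd : V * W -> W).
Proof. by split; [move=> a x y|move=> p; exact: cvg_snd]. Qed.

Lemma lincont_comp V W X (f : V -> W) (g : W -> X) :
  lincont f -> lincont g -> lincont (g \o f).
Proof.
move=> [lf cf] [lg cg]; split=> [a x y|]; first by rewrite /= lf lg.
by move=> x; apply: continuous_comp; [exact: cf|exact: cg].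
Qed.

(** The difference quotient of a linear map depends neither on x nor on t: it is the map applied to
    v, again linear and continuous, so the induction closes. *)
Lemma bgn_lin n V W (U : set V) (f : V -> W) : lincont f -> bgn n U f.
Proof.
elim: n V U f => [|n IH] V U f lf; case: (lf) => lin cf.
  by split=> // x _; exact: cf.
split=> [x _|]; first exact: cf.
exists (f \o (snd \o fst)); split=> [x v t _ _|].
  by rewrite /= [x + _]addrC lin addrK.
apply: IH; apply: lincont_comp lf; apply: lincont_comp; first exact: lincont_fst.
exact: lincont_snd.
Qed.

Lemma bgn_pair n V W X (U : set V) (f : V -> W) (g : V -> X) :
  bgn n U f -> bgn n U g -> bgn n U (fun x => (f x, g x)).
Proof.
elim: n V U f g => [|n IH] V U f g [cf bf] [cg bg].
  by split=> // x Ux; apply: cvg_pair; [exact: cf|exact: cg].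
split=> [x Ux|]; first by apply: cvg_pair; [exact: cf|exact: cg].
case: bf bg => f1 [fE bf1] [g1 [gE bg1]].
exists (fun p => (f1 p, g1 p)); split=> [x v t Ux Uxv|]; last exact: IH.
exact: (congr2 pair (fE _ _ _ Ux Uxv) (gE _ _ _ Ux Uxv)).
Qed.

(** The chain rule is an exact identity here. Since [f (x + t *: v)] equals
    [f x + t *: f1 (x, v, t)], the quotient of the composite is [g1] at base point [f x], direction
    [f1 (x, v, t)] and the same t; no remainder is estimated. *)
Lemma bgn_comp n V W X (U : set V) (U' : set W) (f : V -> W) (g : W -> X) :
  (forall x, U x -> U' (f x)) -> bgn n U f -> bgn n U' g -> bgn n U (g \o f).
Proof.
elim: n V W X U U' f g => [|n IH] V W X U U' f g UU' bf bg.
  split=> // x Ux; apply: continuous_comp; first exact: bgn_cts bf _.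
  exact: bgn_cts bg (UU' _ Ux).
split=> [x Ux|].
  apply: continuous_comp; first exact: bgn_cts bf _.
  exact: bgn_cts bg (UU' _ Ux).
have bf' := bgnW bf; case: bf bg => cf [f1 [fE bf1]] [cg [g1 [gE bg1]]].
exists (g1 \o (fun p => (f p.1.1, f1 p, p.2))); split=> [x v t Ux Uxv|].
  have fxv : f (x + t *: v) = f x + t *: f1 (x, v, t) by rewrite -fE// subrKC.
  by rewrite /= -gE ?fxv//; [exact: UU'|rewrite -fxv; exact: UU'].
apply: (IH _ _ _ _ (quot_dom U')) bg1.
  move=> [[x v] t] [/= Ux Uxv]; split=> /=; first exact: UU'.
  by rewrite -fE// subrKC; exact: UU'.
apply: bgn_pair; last by apply: bgn_lin; exact: lincont_snd.
apply: bgn_pair => //; apply: (IH _ _ _ _ U (fst \o fst) f) bf' => [p []//|].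
by apply: bgn_lin; apply: lincont_comp; exact: lincont_fst.
Qed.

Lemma bgn_id n V (U : set V) : bgn n U (fun x => x).
Proof. by apply: bgn_lin; split=> // x; exact: cvg_id. Qed.

Lemma bgn_fst n V W X (U : set X) (f : X -> V * W) :
  bgn n U f -> bgn n U (fun x => (f x).1).
Proof.
move=> bf; apply: (@bgn_comp _ _ _ _ _ setT f fst) => //.
by apply: bgn_lin; exact: lincont_fst.
Qed.

Lemma bgn_snd n V W X (U : set X) (f : X -> V * W) :
  bgn n U f -> bgn n U (fun x => (f x).2).
Proof.
move=> bf; apply: (@bgn_comp _ _ _ _ _ setT f snd) => //.
by apply: bgn_lin; exact: lincont_snd.
Qed.

Lemma bgnD n V W (U : set V) (f g : V -> W) :
  bgn n U f -> bgn n U g -> bgn n U (fun x => f x + g x).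
Proof.
move=> bf bg; apply: (@bgn_comp _ _ _ _ _ setT (fun x => (f x, g x)) (fun p => p.1 + p.2)) => //.
  exact: bgn_pair.
apply: bgn_lin; split=> [a [x1 x2] [y1 y2]|p] /=.
  by rewrite scalerDr addrACA.
by apply: cvgD; [exact: cvg_fst|exact: cvg_snd].
Qed.

Lemma bgnN n V W (U : set V) (f : V -> W) :
  bgn n U f -> bgn n U (fun x => - f x).
Proof.
move=> bf; apply: (@bgn_comp _ _ _ _ _ setT f -%R) => //.
apply: bgn_lin; split=> [a x y|x] /=; first by rewrite opprD scalerN.
by apply: cvgN; exact: cvg_id.
Qed.

Lemma bgnB n V W (U : set V) (f g : V -> W) :
  bgn n U f -> bgn n U g -> bgn n U (fun x => f x - g x).
Proof. by move=> bf bg; apply: bgnD => //; exact: bgnN. Qed.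

Lemma bgnZ n V W (U : set V) (f : V -> R) (g : V -> W) :
  bgn n U f -> bgn n U g -> bgn n U (fun x => f x *: g x).
Proof.
elim: n V W U f g => [|n IH] V W U f g bf bg.
  by split=> // x Ux; apply: cvgZ; [exact: bgn_cts bf _|exact: bgn_cts bg _].
split=> [x Ux|].
  by apply: cvgZ; [exact: bgn_cts bf _|exact: bgn_cts bg _].
have bf' := bgnW bf; have bg' := bgnW bg.
case: bf bg => cf [f1 [fE bf1]] [cg [g1 [gE bg1]]].
have b11 X (h : V -> X) : bgn n U h -> bgn n (quot_dom U) (fun p => h p.1.1).
  move=> bh; apply: (@bgn_comp _ _ _ _ _ U (fst \o fst) h) bh => [p []//|].
  by apply: bgn_lin; apply: lincont_comp; exact: lincont_fst.
(* This is the product rule with the shifted factor [f (x + t *: v)] rewritten as [f x + t * f1], a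
   form to which the induction hypothesis applies directly. *)
exists (fun p => f1 p *: g p.1.1 + (f p.1.1 + p.2 * f1 p) *: g1 p).
split=> [x v t Ux Uxv /=|].
  have -> : f x + t * f1 (x, v, t) = f (x + t *: v).
    by rewrite -[t * _]/(t *: _) -fE// subrKC.
  rewrite scalerDr !scalerA -[t * f1 _]/(t *: _) -fE// [t * f _]mulrC -scalerA.
  by rewrite -gE// scalerBl scalerBr [RHS]addrC addrA subrK.
apply: bgnD; apply: (IH _ _ _) => //; first exact: b11.
apply: bgnD; first exact: b11.
apply: (IH _ R^o _ (fun p => p.2) f1) => //; apply: bgn_lin; exact: lincont_snd.
Qed.

Lemma bgnM n V (U : set V) (f g : V -> R) :
  bgn n U f -> bgn n U g -> bgn n U (fun x => f x * g x).
Proof. exact: bgnZ. Qed.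

Lemma bgnX n V (U : set V) (f : V -> R) k :
  bgn n U f -> bgn n U (fun x => f x ^+ k).
Proof.
move=> bf; elim: k => [|k IH]; first by under eq_fun do rewrite expr0; exact: bgn_cst.
by under eq_fun do rewrite exprS; exact: bgnM.
Qed.

(** The difference quotient is - v / (x (x + t v)), built from inverses again, so one order of
    smoothness is gained at each step of the induction. *)
Lemma bgn_inv n : bgn n [set x : R | x != 0] (fun x => x^-1).
Proof.
elim: n => [|n IH]; first by split=> // x; exact: inv_continuous.
split=> [x|]; first exact: inv_continuous.
exists (fun p => - p.1.2 * (p.1.1 * (p.1.1 + p.2 * p.1.2))^-1).
split=> [x v t /= x0 xv0|].
  by rewrite /GRing.scale/= in xv0 *; field; rewrite x0 xv0.
apply: bgnM; first by apply: bgnN; apply: bgn_snd; apply: bgn_fst; exact: bgn_id.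
apply: bgn_comp IH => [p [/= p0 p1]|]; first by rewrite mulf_neq0.
do ?[apply: bgnM|apply: bgnD|apply: bgn_snd|apply: bgn_fst]; exact: bgn_id.
Qed.

Lemma bgnV n V (U : set V) (f : V -> R) :
  (forall x, U x -> f x != 0) -> bgn n U f -> bgn n U (fun x => (f x)^-1).
Proof. by move=> f0 bf; apply: (bgn_comp _ bf (@bgn_inv n)). Qed.

(** Rationalizing by the conjugate gives the quotient v / (sqrt x + sqrt (x + t v)), which is
    regular at t = 0 and involves only square roots and inverses of positive quantities. *)
Lemma bgn_sqrt n : bgn n [set x : R | 0 < x] Num.sqrt.
Proof.
elim: n => [|n IH]; first by split=> // x _; exact: sqrt_continuous.
split=> [x _|]; first exact: sqrt_continuous.
exists (fun p => p.1.2 * (Num.sqrt p.1.1 + Num.sqrt (p.1.1 + p.2 * p.1.2))^-1).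
split=> [x v t /= x0 xv0|].
  rewrite /GRing.scale/= in xv0 *.
  have a0 : 0 < Num.sqrt x by rewrite sqrtr_gt0.
  have b0 : 0 < Num.sqrt (x + t * v) by rewrite sqrtr_gt0.
  have := sqr_sqrtr (ltW x0); have := sqr_sqrtr (ltW xv0).
  move: a0 b0; set a := Num.sqrt x; set b := Num.sqrt _ => a0 b0 hb ha.
  have -> : t * (v * (a + b)^-1) = (b ^+ 2 - a ^+ 2) / (a + b).
    by rewrite hb ha; field; rewrite gt_eqF// addr_gt0.
  by field; rewrite gt_eqF// addr_gt0.
apply: bgnM; first by apply: bgn_snd; apply: bgn_fst; exact: bgn_id.
apply: bgnV => [p [/= p0 p1]|].
  by rewrite gt_eqF// addr_gt0// sqrtr_gt0.
apply: bgnD; (apply: bgn_comp IH => [p []//|]).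
  by do 2 apply: bgn_fst; exact: bgn_id.
do ?[apply: bgnM|apply: bgnD|apply: bgn_snd|apply: bgn_fst]; exact: bgn_id.
Qed.

(** For t nonzero [f1] is the difference quotient, so its continuity at t = 0 makes the limit exist
    and identifies it with the directional derivative. *)
Lemma bgn_quotE n V W (U : set V) (f : V -> W) : open U -> bgn n.+1 U f ->
  exists f1 : V * V * R -> W, [/\ bgn n (quot_dom U) f1,
    forall x v t, U x -> U (x + t *: v) ->
        f (x + t *: v) - f x = t *: f1 (x, v, t) &
    forall x v, U x -> derivable f x v /\ 'D_v f x = f1 (x, v, 0)].
Proof.
move=> oU [cf [f1 [fE bf1]]]; exists f1; split=> // x v Ux.
suff H : h^-1 *: ((f \o shift x) (h *: v) - f x) @[h --> 0^'] --> f1 (x, v, 0).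
  by split; [apply/cvg_ex; exists (f1 (x, v, 0))|apply/cvg_lim].
have c1 : {for (x, v, 0 : R), continuous f1}.
  by apply: bgn_cts bf1 _; split; rewrite //= scale0r addr0.
have c2 : f1 (x, v, h) @[h --> (0 : R)] --> f1 (x, v, 0).
  apply: (@cvg_comp _ _ _ (fun h : R => (x, v, h)) f1 _ (nbhs (x, v, 0 : R))) => //.
  apply: (@bgn_cts 0 _ _ setT (fun h : R => (x, v, h))) => //.
  by apply: bgn_pair; [exact: bgn_cst|exact: bgn_id].
have {c2} c2 : f1 (x, v, h) @[h --> (0 : R)^'] --> f1 (x, v, 0).
  by move=> A /c2; exact: nbhs_dnbhs.
move: c2; apply: cvg_trans; apply: near_eq_cvg; near=> h.
have h0 : h != 0 by near: h; exact: nbhs_dnbhs_neq.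
rewrite /= [h *: v + x]addrC fE//; first by rewrite scalerA mulVf ?scale1r.
near: h; apply: nbhs_dnbhs.
have : (x + h *: v) @[h --> (0:R)] --> x + (0 : R) *: v.
  by apply: cvgD; [exact: cvg_cst|apply: cvgZ; [exact: cvg_id|exact: cvg_cst]].
by apply; apply: open_nbhs_nbhs; split; rewrite // scale0r addr0.
Unshelve. all: by end_near. Qed.

Definition bsmooth V W (U : set V) (f : V -> W) := forall n, bgn n U f.

(** This is the bridge to the smoothness used in the statement: the derivative in a fixed direction
    is the slice of [f1] at t = 0, hence of class n. *)
Lemma bgn_Cn n V W (U : set V) (f : V -> W) : open U -> bgn n U f -> Cn_on n U f.
Proof.
move=> oU; elim: n f => [|n IH] f; first by case.
move=> /(bgn_quotE oU) [f1 [bf1 fE fD]] v; split=> [x Ux|]; first by case: (fD x v Ux).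
apply: IH; apply: (@bgn_ext _ _ _ _ (fun x => f1 (x, v, 0))) => //.
  by move=> x Ux; case: (fD x v Ux).
apply: (@bgn_comp _ _ _ _ _ (quot_dom U) (fun x => (x, v, 0 : R)) f1) bf1.
  by move=> x Ux; split; rewrite //= scale0r addr0.
by do ?apply: bgn_pair; [exact: bgn_id|exact: bgn_cst..].
Qed.

Lemma bsmooth_smooth V W (U : set V) (f : V -> W) :
  open U -> bsmooth U f -> smooth_on U f.
Proof. by move=> oU bf n; apply: bgn_Cn. Qed.

(** A choice of [f1] that does not depend on n. The value at t = 0 makes [dquotE] hold for every
    function without hypotheses, so quotients can be manipulated before anything is known about
    smoothness. *)
Definition dquot V W (f : V -> W) (p : V * V * R) : W :=
  if p.2 == 0 then 'D_(p.1.2) f p.1.1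
  else p.2^-1 *: (f (p.1.1 + p.2 *: p.1.2) - f p.1.1).

Lemma dquotE V W (f : V -> W) x v t :
  f (x + t *: v) - f x = t *: dquot f (x, v, t).
Proof.
rewrite /dquot/=; case: eqP => [->|/eqP t0]; first by rewrite !scale0r addr0 subrr.
by rewrite scalerA mulfV ?scale1r.
Qed.

Lemma bsmooth_dquot V W (U : set V) (f : V -> W) :
  open U -> bsmooth U f -> bsmooth (quot_dom U) (dquot f).
Proof.
move=> oU bf n; have [f1 [bf1 fE fD]] := bgn_quotE oU (bf n.+1).
apply: bgn_ext bf1; first exact: open_quot_dom.
move=> [[x v] t] [/= Ux Uxv]; rewrite /dquot/=.
case: eqP => [->|/eqP t0]; first by case: (fD x v Ux).
by rewrite fE// scalerA mulVf ?scale1r.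
Qed.

Lemma bsmooth_derivable V W (U : set V) (f : V -> W) x v :
  open U -> bsmooth U f -> U x -> derivable f x v.
Proof. by move=> oU bf Ux; have [f1 [_ _ /(_ x v Ux)[]]] := bgn_quotE oU (bf 1%N). Qed.

End Calculus.

(** * Parameter integrals and smoothness of sine and cosine *)

Section Integral.
Context {R : realType}.
Implicit Types V W X : normedModType R.
Let mu := @lebesgue_measure R.

Lemma integrable01 (g : R -> R) : continuous g ->
  mu.-integrable `[0, 1]%classic (EFin \o g).
Proof.
move=> cg; apply: continuous_compact_integrable; first exact: segment_compact.
exact: continuous_subspaceT.
Qed.

Let curry_cts V (U : set V) (F : V * R -> R) x :
  bgn 0 [set p | U p.1] F -> U x -> continuous (fun t => F (x, t)).
Proof.
move=> bF Ux t; apply: (@bgn_cts _ 0 _ _ setT (fun t => F (x, t))) => //.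
apply: (@bgn_comp _ _ _ _ _ _ [set p | U p.1] (fun t : R => (x, t)) F) => //.
by apply: bgn_pair; [exact: bgn_cst|exact: bgn_id].
Qed.

Let bgn_0 n V W (U : set V) (f : V -> W) : bgn n U f -> bgn 0 U f.
Proof. by move=> bf; split=> // x; exact: bgn_cts bf. Qed.

(** Compactness of [0, 1] turns joint continuity into uniform closeness of [F (y, t)] to [F (x, t)]
    over all t, which bounds the difference of the integrals. *)
Lemma integral_continuous V (U : set V) (F : V * R -> R) : open U ->
  bgn 0 [set p | U p.1] F ->
  bgn 0 U (fun x => \int[mu]_(t in `[0, 1]) F (x, t))%R.
Proof.
move=> oU bF; split=> // x Ux; apply/cvgrPdist_le => e e0.
have /compact_near_coveringP/(_ _ (nbhs x)
    (fun y t => `|F (x, t) - F (y, t)| <= e)) := @segment_compact R 0 1.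
move=> /(_ (nbhs_filter x)) H.
have {}H : \forall y \near x, forall t, `[0, 1]%classic t -> `|F (x, t) - F (y, t)| <= e.
  apply: H => t _.
  have /cvgrPdist_le/(_ (e / 2)) : {for (x, t), continuous F} by exact: (bgn_cts bF).
  rewrite divr_gt0// => /(_ isT) [[A B]] /= [nA nB] AB.
  exists (B, A) => //= -[s y] /= [Bs Ay].
  have /= h1 := AB (x, s) (conj (nbhs_singleton nA) Bs).
  have /= h2 := AB (y, s) (conj Ay Bs).
  rewrite (splitr e) (le_trans (ler_distD (F (x, t)) _ _))// lerD//.
  by rewrite distrC.
near=> y.
have Uy : U y by near: y; exact: open_nbhs_nbhs.
have Hy : forall t, `[0, 1]%classic t -> `|F (x, t) - F (y, t)| <= e.
  by near: y; exact: H.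
have ix : mu.-integrable `[0, 1]%classic (EFin \o (fun t => F (x, t))).
  by apply: integrable01; exact: curry_cts bF Ux.
have iy : mu.-integrable `[0, 1]%classic (EFin \o (fun t => F (y, t))).
  by apply: integrable01; exact: curry_cts bF Uy.
have cxy : continuous (fun t => F (x, t) - F (y, t)).
  move=> t; apply: cvgB; [exact: (curry_cts bF Ux)|exact: (curry_cts bF Uy)].
rewrite -RintegralB//; apply: le_trans (le_normr_Rintegral _ (integrable01 cxy)) _ => //.
have -> : e = (\int[mu]_(t in `[0, 1]) (fun=> e) t)%R.
  have /= := @lebesgue_measure_itv R `[0, 1]; rewrite lte_fin ltr01 => E.
  rewrite Rintegral_cst// -[LHS]mulr1; congr (_ * _).
  by apply/esym/(etrans (congr1 fine E)); rewrite /= oppr0 addr0.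
apply: le_Rintegral => //.
- by apply: integrable01 => t; apply: cvg_norm; exact: cxy.
- by apply: integrable01 => t; exact: cvg_cst.
Unshelve. all: by end_near. Qed.

(** Differentiation under the integral sign becomes linearity of the integral: the quotient of the
    integral is the integral of the quotient of [F] in the direction [(v, 0)]. *)
Lemma bgn_integral n V (U : set V) (F : V * R -> R) : open U ->
  bgn n [set p | U p.1] F ->
  bgn n U (fun x => \int[mu]_(t in `[0, 1]) F (x, t))%R.
Proof.
elim: n V U F => [|n IH] V U F oU bF; first exact: integral_continuous.
have [c0 _] := integral_continuous oU (bgn_0 bF); split=> //.
have cF x := @curry_cts _ _ _ x (bgn_0 bF).
case: bF => _ [F1 [FE bF1]].
pose G (p : V * V * R * R) := F1 ((p.1.1.1, p.2), (p.1.1.2, 0), p.1.2).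
have bG : bgn n [set p | quot_dom U p.1] G.
  apply: (@bgn_comp _ _ _ _ _ _ (quot_dom [set p : V * R | U p.1])
    (fun p : V * V * R * R => ((p.1.1.1, p.2), (p.1.1.2, 0 : R), p.1.2)) F1) bF1.
    by move=> [[[x v] t] s] [/= Ux Uxv].
  do ![apply: bgn_cst|apply: bgn_pair|apply: bgn_fst|apply: bgn_snd];
    exact: bgn_id.
exists (fun q => \int[mu]_(t in `[0, 1]) G (q, t))%R; split; last first.
  by apply: IH => //; exact: open_quot_dom.
move=> x v t Ux Uxv.
have cG : continuous (fun s => G ((x, v, t), s)) by exact: curry_cts (bgn_0 bG) _.
rewrite -RintegralB//; [|exact/integrable01/cF..].
rewrite -[RHS]/(t * _) -RintegralZl//; last exact: integrable01.
apply: eq_Rintegral => s _.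
rewrite -[t * _]/(t *: F1 ((x, s), (v, 0), t)) -(FE (x, s) (v, 0) t Ux Uxv).
by congr (F _ - _); congr pair; rewrite /= scaler0 addr0.
Qed.

Lemma FTC01 (f f' : R -> R) : (forall x : R, is_derive x 1 f (f' x)) ->
  continuous f' -> (\int[mu]_(t in `[0, 1]) f' t)%R = f 1 - f 0.
Proof.
move=> ff' cf'.
have df x : derivable f x 1 by have [] := ff' x.
have cf : continuous f by move=> x; apply: differentiable_continuous; exact/derivable1_diffP.
rewrite /Rintegral (@continuous_FTC2 _ f' f)//.
- exact: continuous_subspaceT.
- split; first by move=> x _; exact: df.
  + by apply: cvg_at_right_filter; exact: cf.
  + by apply: cvg_at_left_filter; exact: cf.
- by move=> x _; rewrite derive1E derive_val.
Qed.

(** The difference quotient of f is v times the integral of f' (x + s t v) over s in [0, 1]. As f'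
    stays in the family [P], the induction on n runs over all of [P] at once; sine and cosine enter
    through a family of four functions closed under differentiation. *)
Lemma is_derive_bsmooth (P : set (R -> R)) :
  (forall f, P f -> exists2 f', P f' & forall x : R, is_derive x 1 f (f' x)) ->
  forall f, P f -> bsmooth setT f.
Proof.
move=> H f Pf n; elim: n f Pf => [|n IH] f Pf.
  split=> // x _; have [f' _ /(_ x)[df _]] := H f Pf.
  by apply: differentiable_continuous; exact/derivable1_diffP.
have [f' Pf' ff'] := H f Pf.
split=> [x _|].
  by have [df _] := ff' x; apply: differentiable_continuous; exact/derivable1_diffP.
have bf' := IH _ Pf'.
pose G (p : R * R * R * R) := f' (p.1.1.1 + p.2 * (p.1.2 * p.1.1.2)).
exists (fun p => p.1.2 * (\int[mu]_(t in `[0, 1]) G (p, t)))%R; split; last first.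
  apply: bgnM; first by do ![apply: bgn_fst|apply: bgn_snd]; exact: bgn_id.
  rewrite (_ : quot_dom setT = setT); last by apply/seteqP; split=> // p; split.
  apply: bgn_integral; first exact: openT.
  apply: bgn_comp bf' => //.
  do ![apply: bgnD|apply: bgnM|apply: bgn_fst|apply: bgn_snd]; exact: bgn_id.
move=> x v t _ _.
have D (s : R) : is_derive s 1 (fun s => f (x + s * (t * v))) (t * v * G (x, v, t, s)).
  have Dg : is_derive s 1 (fun s : R => x + s * (t * v)) (t * v).
    by apply: is_derive_eq; rewrite /GRing.scale/= mulr0 !add0r mulr1 mul1r.
  rewrite [t * v * _]mulrC; exact: (@is_derive1_comp _ f _ _ _ _ (ff' _) Dg).
have cG : continuous (fun s => G (x, v, t, s)).
  move=> s; apply: (@bgn_cts _ n _ _ setT) => //.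
  apply: (@bgn_comp _ _ _ _ _ _ _ (fun s : R => x + s * (t * v))) bf' => //.
  by apply: bgnD; [exact: bgn_cst|apply: bgnM; [exact: bgn_id|exact: bgn_cst]].
have c2 : continuous (fun s => t * v * G (x, v, t, s)).
  by move=> s; apply: cvgM; [exact: cvg_cst|exact: cG].
have := FTC01 D c2; rewrite mul0r addr0 mul1r => <-.
by rewrite RintegralZl ?[RHS]mulrA//; exact: integrable01.
Qed.

Lemma bsmooth_sincos : bsmooth setT (@sin R) /\ bsmooth setT (@cos R).
Proof.
pose P := [set @sin R; @cos R; (fun x => - sin x); (fun x => - cos x)].
have H : forall f, P f -> bsmooth setT f.
  apply: is_derive_bsmooth => f [[[->|->]|->]|->].
  - by exists cos; [left; left; right|move=> x; exact: is_derive_sin].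
  - by exists (fun x => - sin x); [left; right|move=> x; exact: is_derive_cos].
  - by exists (fun x => - cos x); [right|move=> x; exact: is_deriveN].
  - exists sin; [by do 3 left|move=> x].
    by apply: is_derive_eq; rewrite ?opprK.
by split; apply: H; [do 3 left|left; left; right].
Qed.

End Integral.

(** * Germs and the implicit function theorem *)

Section Germs.
Context {R : realType}.
Implicit Types V W X Q : normedModType R.

Definition smooth_near V W (x : V) (f : V -> W) : Prop :=
  exists U, open_nbhs x U /\ bsmooth U f.

Lemma bsmooth_near V W (U : set V) x (f : V -> W) :
  open U -> U x -> bsmooth U f -> smooth_near x f.
Proof. by move=> oU Ux bf; exists U. Qed.

Lemma smooth_near_cts V W (x : V) (f : V -> W) :
  smooth_near x f -> {for x, continuous f}.
Proof. by move=> [U [[oU Ux] bf]]; exact: bgn_cts (bf 0%N) Ux. Qed.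

Lemma smooth_near_near V W (x : V) (f : V -> W) :
  smooth_near x f -> \forall y \near x, smooth_near y f.
Proof.
move=> [U [[oU Ux] bf]]; near=> y; exists U; split=> //; split=> //.
by near: y; exact: open_nbhs_nbhs.
Unshelve. all: by end_near. Qed.

Lemma smooth_near_ext V W (x : V) (f g : V -> W) :
  (\forall y \near x, f y = g y) -> smooth_near x f -> smooth_near x g.
Proof.
move=> fg [U [[oU Ux] bf]].
have : nbhs x (fun y => f y = g y) by [].
rewrite nbhsE => -[A [oA Ax] Afg].
exists (U `&` A); split; first by split; [exact: openI|].
move=> n; apply: (@bgn_ext _ _ _ _ _ f) => [|y [_ /Afg]//|]; first exact: openI.
by apply: bgn_sub (bf n) => y [].
Qed.

Lemma smooth_near_comp V W X (x : V) (f : V -> W) (g : W -> X) :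
  smooth_near x f -> smooth_near (f x) g -> smooth_near x (fun y => g (f y)).
Proof.
move=> sf [U' [[oU' U'fx] bg]]; have cf := smooth_near_cts sf.
case: sf => [U [[oU Ux] bf]].
have : nbhs x (U `&` f @^-1` U').
  apply: filterI; first exact: open_nbhs_nbhs.
  by apply: cf; exact: open_nbhs_nbhs.
rewrite nbhsE => -[A [oA Ax] AU]; exists A; split=> // n.
by apply: (@bgn_comp _ _ _ _ _ _ U' f g) => [y /AU[]//||//]; apply: bgn_sub (bf n) => y /AU[].
Qed.

Let near2 V W X (Y : normedModType R) (x : V) (f : V -> W) (g : V -> X) (h : V -> Y) :
  (forall n U, bgn n U f -> bgn n U g -> bgn n U h) ->
  smooth_near x f -> smooth_near x g -> smooth_near x h.
Proof.
move=> H [U [[oU Ux] bf]] [U' [[oU' U'x] bg]].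
exists (U `&` U'); split; first by split; [exact: openI|].
by move=> n; apply: H; [apply: bgn_sub (bf n)|apply: bgn_sub (bg n)] => y [].
Qed.

Lemma smooth_near_cst V W (x : V) (c : W) : smooth_near x (fun=> c).
Proof. by exists setT; split; [split=> //; exact: openT|move=> n; exact: bgn_cst]. Qed.

Lemma smooth_near_lin V W (x : V) (f : V -> W) : lincont f -> smooth_near x f.
Proof. by move=> lf; exists setT; split; [split=> //; exact: openT|move=> n; exact: bgn_lin]. Qed.

Lemma smooth_near_id V (x : V) : smooth_near x (fun y => y).
Proof. by exists setT; split; [split=> //; exact: openT|move=> n; exact: bgn_id]. Qed.

Lemma smooth_near_pair V W X (x : V) (f : V -> W) (g : V -> X) :
  smooth_near x f -> smooth_near x g -> smooth_near x (fun y => (f y, g y)).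
Proof. by apply: near2 => n U; exact: bgn_pair. Qed.

Lemma smooth_near_fst V W X (x : V) (f : V -> W * X) :
  smooth_near x f -> smooth_near x (fun y => (f y).1).
Proof. by move=> sf; apply: near2 (sf) (sf) => n U bf _; exact: bgn_fst. Qed.

Lemma smooth_near_snd V W X (x : V) (f : V -> W * X) :
  smooth_near x f -> smooth_near x (fun y => (f y).2).
Proof. by move=> sf; apply: near2 (sf) (sf) => n U bf _; exact: bgn_snd. Qed.

Lemma smooth_nearD V W (x : V) (f g : V -> W) :
  smooth_near x f -> smooth_near x g -> smooth_near x (fun y => f y + g y).
Proof. by apply: near2 => n U; exact: bgnD. Qed.

Lemma smooth_nearN V W (x : V) (f : V -> W) :
  smooth_near x f -> smooth_near x (fun y => - f y).
Proof. by move=> sf; apply: near2 (sf) (sf) => n U bf _; exact: bgnN. Qed.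

Lemma smooth_nearM V (x : V) (f g : V -> R) :
  smooth_near x f -> smooth_near x g -> smooth_near x (fun y => f y * g y).
Proof. by apply: near2 => n U; exact: bgnM. Qed.

Lemma smooth_nearZ V W (x : V) (f : V -> R) (g : V -> W) :
  smooth_near x f -> smooth_near x g -> smooth_near x (fun y => f y *: g y).
Proof. by apply: near2 => n U; exact: bgnZ. Qed.

Lemma smooth_nearX V (x : V) (f : V -> R) k :
  smooth_near x f -> smooth_near x (fun y => f y ^+ k).
Proof. by move=> sf; apply: near2 (sf) (sf) => n U bf _; exact: bgnX. Qed.

Lemma smooth_nearV V (x : V) (f : V -> R) :
  smooth_near x f -> f x != 0 -> smooth_near x (fun y => (f y)^-1).
Proof.
move=> sf f0; apply: (@smooth_near_comp _ R R _ f (fun y : R => y^-1) sf).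
apply: (@bsmooth_near _ _ [set x : R | x != 0]) => //.
by move=> n; exact: bgn_inv.
Qed.

Lemma smooth_near_sqrt V (x : V) (f : V -> R) :
  smooth_near x f -> 0 < f x -> smooth_near x (fun y => Num.sqrt (f y)).
Proof.
move=> sf f0; apply: (@smooth_near_comp _ R R _ f Num.sqrt sf).
apply: (@bsmooth_near _ _ [set x : R | 0 < x]) => //.
by move=> n; exact: bgn_sqrt.
Qed.

(* Divided difference in the last variable, equal to the partial derivative on
   the diagonal. *)
Definition ddiff V (F : V * R -> R) (p : V * R * R) : R :=
  dquot F ((p.1.1, p.1.2), (0, 1), p.2 - p.1.2).

Lemma ddiffE V (F : V * R -> R) x s t :
  F (x, t) - F (x, s) = (t - s) * ddiff F (x, s, t).
Proof.
rewrite /ddiff -[RHS]/(_ *: _) -dquotE; congr (F _ - _).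
by congr pair; rewrite /= ?scaler0 ?addr0// /GRing.scale/= mulr1 subrKC.
Qed.

Lemma bsmooth_ddiff V (U : set (V * R)) (F : V * R -> R) : open U ->
  bsmooth U F ->
  bsmooth [set p | U (p.1.1, p.1.2) /\ U (p.1.1, p.2)] (ddiff F).
Proof.
move=> oU bF n.
apply: (@bgn_comp _ _ _ _ _ _ (quot_dom U)
  (fun p : V * R * R => ((p.1.1, p.1.2), (0, 1), p.2 - p.1.2)) (dquot F)).
- move=> [[x s] t] [/= Uxs Uxt]; split=> //=.
  rewrite (_ : (x, s) + _ = (x, t))//.
  by congr pair; rewrite /= ?scaler0 ?addr0// /GRing.scale/= mulr1 subrKC.
- do ![apply: bgn_cst|apply: bgn_pair|apply: bgnB|apply: bgn_fst|apply: bgn_snd];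
    exact: bgn_id.
- exact: bsmooth_dquot.
Qed.

Lemma smooth_near_ddiff V (F : V * R -> R) x t :
  smooth_near (x, t) F -> smooth_near (x, t, t) (ddiff F).
Proof.
move=> [U [[oU Uxt] bF]]; exists [set p | U (p.1.1, p.1.2) /\ U (p.1.1, p.2)].
split; last exact: bsmooth_ddiff.
split=> //; apply: openI; (apply: open_comp => // p _).
  apply: (@bgn_cts _ 0 _ _ setT (fun p : V * R * R => (p.1.1, p.1.2))) => //.
  do ![apply: bgn_pair|apply: bgn_fst|apply: bgn_snd]; exact: bgn_id.
apply: (@bgn_cts _ 0 _ _ setT (fun p : V * R * R => (p.1.1, p.2))) => //.
do ![apply: bgn_pair|apply: bgn_fst|apply: bgn_snd]; exact: bgn_id.
Qed.

(** Subtracting the equations at x and x + t v expresses the quotient of [h] as minus the quotient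
    of [F] in the direction [(v, 0)], divided by a divided difference of [F] in its last variable.
    The right-hand side only needs [h] of class n, so continuity bootstraps to all orders. The two
    ends x and x + t v can be any points of [U], which is why the divided difference must be nonzero
    for all pairs. *)
Lemma bsmooth_implicit V (U : set V) (D : set (V * R)) (F : V * R -> R)
    (h : V -> R) :
  open D -> bsmooth D F -> bgn 0 U h ->
  (forall x y, U x -> U y -> D (x, h y)) ->
  (forall x, U x -> F (x, h x) = 0) ->
  (forall x y, U x -> U y -> ddiff F (y, h x, h y) != 0) ->
  bsmooth U h.
Proof.
move=> oD bF bh0 hD Fh Q0; elim=> [//|n IH].
split=> [x Ux|]; first exact: bgn_cts bh0 Ux.
exists (fun p => - dquot F ((p.1.1, h p.1.1), (p.1.2, 0), p.2) *
   (ddiff F (p.1.1 + p.2 *: p.1.2, h p.1.1, h (p.1.1 + p.2 *: p.1.2)))^-1).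
split=> [x v t Ux Uxv /=|].
  have Q1 := Q0 _ _ Ux Uxv.
  rewrite -[RHS]/(t * (- dquot F (x, h x, (v, 0), t) / _)) mulrA mulrN.
  rewrite -[t * _]/(t *: _) -dquotE Fh// subr0.
  rewrite (_ : _ + _ = (x + t *: v, h x)); last first.
    by congr pair; rewrite /= scaler0 addr0.
  rewrite (_ : - F _ = F (x + t *: v, h (x + t *: v)) - F (x + t *: v, h x)).
    by rewrite ddiffE mulfK.
  by rewrite Fh// sub0r.
have h1 : bgn n (quot_dom U) (fun p : V * V * R => h p.1.1).
  apply: (@bgn_comp _ _ _ _ _ _ U (fun p : V * V * R => p.1.1) h) => //.
    by move=> p [].
  by do !apply: bgn_fst; exact: bgn_id.
have b2 : bgn n (quot_dom U) (fun p : V * V * R => p.1.1 + p.2 *: p.1.2).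
  by apply: bgnD; [|apply: bgnZ]; do ![apply: bgn_fst|apply: bgn_snd]; exact: bgn_id.
have h2 : bgn n (quot_dom U) (fun p : V * V * R => h (p.1.1 + p.2 *: p.1.2)).
  apply: (@bgn_comp _ _ _ _ _ _ U (fun p : V * V * R => p.1.1 + p.2 *: p.1.2) h) => //.
  by move=> p [].
apply: bgnM.
  apply: bgnN; apply: (@bgn_comp _ _ _ _ _ _ (quot_dom D)
    (fun p : V * V * R => ((p.1.1, h p.1.1), (p.1.2, 0), p.2)) (dquot F)).
  - move=> [[x v] t] [/= Ux Uxv]; split=> /=; first exact: hD.
    rewrite (_ : _ + _ = (x + t *: v, h x)); first exact: hD.
    by congr pair; rewrite /= scaler0 addr0.
  - do ![exact: h1|apply: bgn_cst|apply: bgn_pair|apply: bgn_fst|apply: bgn_snd];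
     exact: bgn_id.
  - exact: bsmooth_dquot.
apply: bgnV => [[[x v] t] [/= Ux Uxv]|]; first exact: Q0.
apply: (@bgn_comp _ _ _ _ _ _ [set p | D (p.1.1, p.1.2) /\ D (p.1.1, p.2)]
    (fun p : V * V * R => (p.1.1 + p.2 *: p.1.2, h p.1.1, h (p.1.1 + p.2 *: p.1.2)))
    (ddiff F)).
- by move=> [[x v] t] [/= Ux Uxv]; split=> /=; exact: hD.
- by apply: bgn_pair => //; exact: bgn_pair.
- exact: bsmooth_ddiff.
Qed.

Lemma open_setX V W (A : set V) (B : set W) : open A -> open B -> open (A `*` B).
Proof.
move=> oA oB; apply: openI.
  by apply: open_comp oA => p _; exact: cvg_fst.
by apply: open_comp oB => p _; exact: cvg_snd.
Qed.

(** A positive divided difference makes [F] strictly increasing in t, so roots in the ball are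
    unique. The domain is the full set of x with a root in the given box, not an unspecified small
    neighbourhood: later this set is the image of a coordinate map. *)
Lemma implicit_box V (A : set V) (t0 d : R) (F : V * R -> R) :
  open A -> bsmooth (A `*` ball t0 d) F ->
  (forall x s t, A x -> ball t0 d s -> ball t0 d t -> 0 < ddiff F (x, s, t)) ->
  let U := [set x | A x /\ exists2 t, ball t0 d t & F (x, t) = 0] in
  open U /\ exists h : V -> R, bsmooth U h /\
    forall x t, A x -> ball t0 d t -> F (x, t) = 0 -> t = h x.
Proof.
move=> oA bF Q0 U.
have oB : open (ball t0 d) by exact: ball_open.
have oD : open (A `*` ball t0 d) by exact: open_setX.
have inj x s t : A x -> ball t0 d s -> ball t0 d t -> F (x, s) = 0 -> F (x, t) = 0 -> s = t.
  move=> Ax Bs Bt Fs Ft; have := ddiffE F x s t; rewrite Fs Ft subrr.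
  by move/esym/eqP; rewrite mulf_eq0 [_ F _ == 0]gt_eqF ?Q0// orbF subr_eq0 => /eqP.
(* The signs of [F] slightly above and below a root persist for nearby x, so the intermediate value
   theorem gives a nearby root. This yields both the openness of [U] and the continuity of the
   root. *)
have loc x1 t1 e : A x1 -> ball t0 d t1 -> F (x1, t1) = 0 -> 0 < e ->
    \forall x \near x1, A x /\ exists2 t, ball t0 d t & `|t - t1| <= e /\ F (x, t) = 0.
  move=> Ax1 Bt1 F1 e0.
  have [e1 e10 e1B] : exists2 e1, 0 < e1 & forall t, `|t - t1| <= e1 -> ball t0 d t.
    have /nbhs_ballP[r /= r0 rB] : nbhs t1 (ball t0 d) by exact: open_nbhs_nbhs.
    exists (r / 2); first by rewrite divr_gt0.
    move=> t ht; apply: rB; rewrite /ball/= distrC (le_lt_trans ht)//.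
    by rewrite ltr_pdivrMr// ltr_pMr// ltr1n.
  pose e2 := Num.min e e1.
  have e20 : 0 < e2 by rewrite lt_min e0.
  have Bp : ball t0 d (t1 + e2).
    by apply: e1B; rewrite addrC addKr gtr0_norm// ge_min lexx orbT.
  have Bm : ball t0 d (t1 - e2).
    by apply: e1B; rewrite addrC addKr normrN gtr0_norm// ge_min lexx orbT.
  have Fp : 0 < F (x1, t1 + e2).
    have := ddiffE F x1 t1 (t1 + e2); rewrite F1 subr0 => ->.
    by rewrite mulr_gt0 ?Q0// addrC addKr.
  have Fm : F (x1, t1 - e2) < 0.
    have := ddiffE F x1 t1 (t1 - e2); rewrite F1 subr0 => ->.
    by rewrite nmulr_rlt0 ?Q0// addrC addKr oppr_lt0.
  have cF t : ball t0 d t -> {for x1, continuous (fun x => F (x, t))}.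
    move=> Bt; apply: (@bgn_cts _ 0 _ _ A (fun x => F (x, t))) => //.
    apply: (@bgn_comp _ _ _ _ _ _ (A `*` ball t0 d) (fun x => (x, t)) F) => //.
    by apply: bgn_pair; [exact: bgn_id|exact: bgn_cst].
  near=> x.
  have Ax : A x by near: x; exact: open_nbhs_nbhs.
  split=> //.
  have Fxp : 0 < F (x, t1 + e2) by near: x; exact: (cvgr_gt _ (cF _ Bp)).
  have Fxm : F (x, t1 - e2) < 0 by near: x; exact: (cvgr_lt _ (cF _ Bm)).
  have in2 t : t \in `[t1 - e2, t1 + e2] -> `|t - t1| <= e2.
    by rewrite in_itv/= ler_distl.
  have [|||c cin Fc] := @IVT _ (fun t => F (x, t)) (t1 - e2) (t1 + e2) 0.
  - by rewrite lerD2l; lra.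
  - apply: continuous_in_subspaceT => t /set_mem /= /in2 ht.
    apply: (@bgn_cts _ 0 _ _ (ball t0 d) (fun t => F (x, t))).
      apply: (@bgn_comp _ _ _ _ _ _ (A `*` ball t0 d) (fun t => (x, t)) F) => //.
      by apply: bgn_pair; [exact: bgn_cst|exact: bgn_id].
    by apply: e1B; rewrite (le_trans ht)// ge_min lexx orbT.
  - by rewrite ge_min le_max (ltW Fxp) (ltW Fxm) orbT.
  exists c; first by apply: e1B; rewrite (le_trans (in2 _ cin))// ge_min lexx orbT.
  by split=> //; rewrite (le_trans (in2 _ cin))// ge_min lexx.
have oU : open U.
  rewrite openE => x1 [Ax1 [t1 Bt1 F1]].
  have := loc x1 t1 1 Ax1 Bt1 F1 ltr01; apply: filterS => x [Ax [t Bt [_ Ft]]].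
  by split=> //; exists t.
have [h hP] : exists h : V -> R, forall x, U x -> ball t0 d (h x) /\ F (x, h x) = 0.
  (* Off [U] there is no root and the value chosen for h is irrelevant. *)
  have H x : exists t, U x -> ball t0 d t /\ F (x, t) = 0; last first.
    have [h hP] := boolp.choice H; exists h; exact: hP.
  have [[Ax [t Bt Ft]]|nU] := pselect (U x); first by exists t.
  by exists 0.
split=> //; exists h; split; last first.
  move=> x t Ax Bt Ft; have [Bh Fh] : ball t0 d (h x) /\ F (x, h x) = 0.
    by apply: hP; split=> //; exists t.
  exact: (inj x).
apply: (@bsmooth_implicit _ _ (A `*` ball t0 d) F) => //.
- split=> // x1 Ux1; apply/cvgrPdist_le => e e0.
  have [Bh1 Fh1] := hP _ Ux1; case: (Ux1) => Ax1 _.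
  have := loc x1 (h x1) e Ax1 Bh1 Fh1 e0; apply: filterS => x [Ax [t Bt [te Ft]]].
  have [Bh Fh] : ball t0 d (h x) /\ F (x, h x) = 0.
    by apply: hP; split=> //; exists t.
  by rewrite (inj x (h x) t)// distrC.
- by move=> x y [Ax _] /hP[].
- by move=> x /hP[].
- by move=> x y /hP[Bx _] Uy; have [By _] := hP _ Uy; case: Uy => Ay _; rewrite gt_eqF// Q0.
Unshelve. all: by end_near. Qed.

Lemma box_near V W (x : V) (y : W) (P : V * W -> Prop) :
  (\forall p \near (x, y), P p) ->
  exists A B, [/\ open_nbhs x A, open_nbhs y B & forall a b, A a -> B b -> P (a, b)].
Proof.
move=> [[A B] /= [nA nB] AB]; move: nA nB; rewrite !nbhsE.
move=> [A' oA' A'A] [B' oB' B'B]; exists A', B'; split=> // a b Aa Bb.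
by apply: AB; split; [exact: A'A|exact: B'B].
Qed.

Lemma ddiff_box V (F : V * R -> R) x0 t0 :
  smooth_near (x0, t0) F -> 0 < ddiff F (x0, t0, t0) ->
  exists (A : set V) (d : R), [/\ open_nbhs x0 A, 0 < d,
    bsmooth (A `*` ball t0 d) F &
    forall x s t, A x -> ball t0 d s -> ball t0 d t -> 0 < ddiff F (x, s, t)].
Proof.
move=> sF Q0; have /smooth_near_cts cQ := smooth_near_ddiff sF.
have /box_near[AB [B [oAB oB ABP]]] : \forall p \near (x0, t0, t0), 0 < ddiff F p.
  exact: (cvgr_gt _ cQ).
have /box_near[A1 [B1 [oA1 oB1 AB1]]] : \forall p \near (x0, t0), AB p.
  exact: open_nbhs_nbhs.
case: sF => D [oD bF].
have /box_near[A2 [B2 [oA2 oB2 AB2]]] : \forall p \near (x0, t0), D p.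
  exact: open_nbhs_nbhs.
have : nbhs t0 (B `&` B1 `&` B2).
  by do 2 (apply: filterI; last exact: open_nbhs_nbhs); exact: open_nbhs_nbhs.
move=> /nbhs_ballP[d /= d0 dB].
exists (A1 `&` A2), d; split=> //.
- by split; [apply: openI; [exact: oA1.1|exact: oA2.1]|split; [exact: oA1.2|exact: oA2.2]].
- move=> n; apply: bgn_sub (bF n) => -[x t] [/= [_ A2x] /dB [_ B2t]].
  exact: AB2.
- move=> x s t [A1x _] /dB[[_ B1s] _] /dB[[Bt _] _].
  by apply: ABP => //; exact: AB1.
Qed.

Lemma smooth_near_implicit V (F : V * R -> R) x0 t0 :
  smooth_near (x0, t0) F -> F (x0, t0) = 0 -> 0 < ddiff F (x0, t0, t0) ->
  exists h : V -> R, [/\ smooth_near x0 h, h x0 = t0,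
    \forall x \near x0, F (x, h x) = 0 &
    \forall p \near (x0, t0), F p = 0 -> p.2 = h p.1].
Proof.
move=> sF F0 Q0; have [A [d [[oA Ax0] d0 bF QP]]] := ddiff_box sF Q0.
have [oU [h [bh hu]]] := implicit_box oA bF QP.
exists h; split.
- by apply: bsmooth_near bh => //; split=> //; exists t0 => //; exact: ballxx.
- by apply/esym; apply: hu => //; exact: ballxx.
- near=> x; have [Ax [t Bt Ft]] : A x /\ exists2 t, ball t0 d t & F (x, t) = 0.
    near: x; apply: open_nbhs_nbhs; split=> //; split=> //; exists t0 => //.
    exact: ballxx.
  by rewrite -(hu x t).
- exists (A, ball t0 d) => /=.
    by split; [exact: open_nbhs_nbhs|exact: nbhsx_ballx].
  by move=> [x t] [/= Ax Bt]; exact: hu.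
Unshelve. all: by end_near. Qed.

End Germs.

(** * Families of diffeomorphisms on a common neighbourhood *)

Section DiffeoFamilies.
Context {R : realType}.
Implicit Types V W X Q : normedModType R.

Definition bdiffeo V W (U : set V) (f : V -> W) : Prop :=
  [/\ open U, open (f @` U), bsmooth U f &
    exists g : W -> V, bsmooth (f @` U) g /\ forall x, U x -> g (f x) = x].

Lemma bdiffeo_diffeo V W (U : set V) (f : V -> W) : bdiffeo U f -> diffeo_on U f.
Proof.
move=> [oU oV bf [g [bg gK]]]; split=> //; first exact: bsmooth_smooth.
by exists g; split=> //; exact: bsmooth_smooth.
Qed.

Lemma open_bgn_preimage V W (U : set V) (B : set W) (f : V -> W) :
  open U -> bgn 0 U f -> open B -> open (U `&` f @^-1` B).
Proof.
move=> oU bf oB; rewrite openE => x [Ux Bfx].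
apply: filterI; first exact: open_nbhs_nbhs.
by apply: (bgn_cts bf Ux); exact: open_nbhs_nbhs.
Qed.

(** The image of the smaller set is the preimage of that set under the smooth inverse, hence
    open. *)
Lemma bdiffeo_sub V W (U U' : set V) (f : V -> W) :
  open U' -> U' `<=` U -> bdiffeo U f -> bdiffeo U' f.
Proof.
move=> oU' UU' [oU oV bf [g [bg gK]]]; split=> //.
- rewrite (_ : f @` U' = (f @` U) `&` g @^-1` U').
    exact: open_bgn_preimage (bg 0%N) _.
  apply/seteqP; split=> [_ [x Ux <-]|_ [[x Ux <-]]] /=.
    by split; [exists x => //; exact: UU'|rewrite /= gK//; exact: UU'].
  by rewrite gK// => U'x; exists x.
- by move=> n; apply: bgn_sub (bf n).
- exists g; split=> [n|x /UU']; last exact: gK.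
  by apply: bgn_sub (bg n) => _ [x Ux <-]; exists x => //; exact: UU'.
Qed.

Lemma bdiffeo_comp V W X (U : set V) (U' : set W) (f : V -> W) (f' : W -> X) :
  bdiffeo U f -> bdiffeo U' f' -> f @` U `<=` U' -> bdiffeo U (f' \o f).
Proof.
move=> [oU oV bf [g [bg gK]]] d' UU'.
have [_ oV' bf' [g' [bg' gK']]] := bdiffeo_sub oV UU' d'.
have im : (f' \o f) @` U = f' @` (f @` U) by rewrite image_comp.
have UfU x : U x -> (f @` U) (f x) by move=> Ux; exists x.
split=> //; first by rewrite im.
- by move=> n; apply: bgn_comp (bf n) (bf' n) => x Ux; exists x.
- exists (g \o g'); split=> [n|x Ux /=]; last by rewrite gK' ?gK//; exact: UfU.
  rewrite im; apply: bgn_comp (bg' n) (bg n) => _ [_ [x Ux <-] <-].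
  by rewrite gK'; exact: UfU.
Qed.

(* The point is that the neighbourhood N of 0 does not depend on q. *)
Definition diffeo_family Q V W (q0 : Q) (f : Q * V -> W) : Prop :=
  exists (A : set Q) (N : set V), [/\ open_nbhs q0 A, open_nbhs 0 N,
    bsmooth (A `*` N) f &
    forall q, A q -> f (q, 0) = 0 /\ bdiffeo N (fun v => f (q, v))].

Lemma diffeo_family_comp Q V W X (q0 : Q) (f : Q * V -> W) (g : Q * W -> X) :
  diffeo_family q0 f -> diffeo_family q0 g ->
  diffeo_family q0 (fun p => g (p.1, f p)).
Proof.
move=> [A [N [oA oN bf fP]]] [A' [N' [oA' oN' bg gP]]].
have f00 : f (q0, 0) = 0 by have [] := fP _ oA.2.
have cf : {for (q0, 0), continuous f}.
  by apply: bgn_cts (bf 0%N) _; split; [exact: oA.2|exact: oN.2].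
have /box_near[A1 [N1 [oA1 oN1 H]]] : \forall p \near (q0, 0 : V), N' (f p).
  by apply: cf; rewrite f00; exact: open_nbhs_nbhs.
pose A2 := A `&` A' `&` A1; pose N2 := N `&` N1.
have oA2 : open_nbhs q0 A2 by do 2 apply: open_nbhsI => //.
have oN2 : open_nbhs (0 : V) N2 by apply: open_nbhsI.
exists A2, N2; split=> // [n|q [[Aq A'q] A1q]].
  apply: (@bgn_comp _ _ _ _ _ _ (A' `*` N') (fun p => (p.1, f p)) g) => //.
    by move=> [q v] [/= [[_ ?] ?] [_ ?]]; split=> //; exact: H.
  apply: bgn_pair; first by apply: bgn_fst; exact: bgn_id.
  by apply: bgn_sub (bf n) => -[q v] [/= [[? _] _] [? _]].
have [fq0 df] := fP q Aq; have [gq0 dg] := gP q A'q.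
split; first by rewrite /= fq0.
apply: (@bdiffeo_comp _ _ _ _ N' (fun v => f (q, v)) (fun w => g (q, w))) => //.
  by apply: bdiffeo_sub df; [exact: oN2.1|move=> v []].
by move=> _ [v [_ N1v] <-]; exact: H.
Qed.

Lemma diffeo_family_lin Q V W (q0 : Q) (f : V -> W) (g : W -> V) :
  lincont f -> lincont g -> cancel f g -> cancel g f ->
  diffeo_family q0 (fun p : Q * V => f p.2).
Proof.
move=> lf lg fK gK; exists setT, setT.
have oT (Y : normedModType R) (y : Y) : open_nbhs y (setT : set Y) by split=> //; exact: openT.
split; [exact: oT|exact: oT|move=> n|move=> q _].
  apply: bgn_lin; apply: lincont_comp lf; exact: lincont_snd.
have f0 : f 0 = 0 by have := lf.1 (-1) 0 0; rewrite scaler0 add0r scaleN1r addNr.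
have im : f @` setT = setT by apply/seteqP; split=> // w _; exists (g w).
split=> //; split; rewrite ?im; [exact: openT|exact: openT|by move=> n; exact: bgn_lin|].
by exists g; split=> [n|x _ /=]; [exact: bgn_lin|rewrite fK].
Qed.

(** Inverting the triangular map (x, t) to (x, F (q, x, t)) means solving [F (q, x, t) = y] for t,
    with (x, y) as parameters. The box on which [F] is increasing is chosen before q, so the domain
    is the same for all q near [q0]. *)
Lemma diffeo_family_graph Q V (q0 : Q) (F : Q * V * R -> R) :
  smooth_near (q0, 0, 0) F -> (\forall q \near q0, F (q, 0, 0) = 0) ->
  0 < ddiff F (q0, 0, 0, 0) ->
  diffeo_family q0 (fun p : Q * (V * R) => (p.2.1, F (p.1, p.2.1, p.2.2))).
Proof.
move=> sF F0 Q0; have [AB [d [oAB d0 bF QP]]] := ddiff_box sF Q0.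
have /box_near[A [B [oA oB HAB]]] : \forall p \near (q0, 0 : V), AB p.
  exact: open_nbhs_nbhs.
have : nbhs q0 (fun q => F (q, 0, 0) = 0) by [].
rewrite nbhsE => -[A' oA' A'F].
have oI : open_nbhs (0 : R) (ball 0 d) by split; [exact: ball_open|exact: ballxx].
have oBI : open (B `*` ball (0 : R) d) by apply: open_setX; [exact: oB.1|exact: oI.1].
have bG (q : Q) : A q -> bsmooth (B `*` ball (0 : R) d) (fun p : V * R => F (q, p.1, p.2)).
  move=> Aq n.
  apply: (@bgn_comp _ _ _ _ _ _ (AB `*` ball (0 : R) d) (fun p => (q, p.1, p.2)) F) => //.
    by move=> [x t] [/= Bx It]; split=> //; exact: HAB.
  do ![apply: bgn_pair|apply: bgn_fst|apply: bgn_snd|exact: bgn_cst]; exact: bgn_id.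
exists (A `&` A'), (B `*` ball 0 d); split.
- exact: open_nbhsI.
- by split=> //; split; [exact: oB.2|exact: oI.2].
- move=> n; apply: bgn_pair; first by apply: bgn_fst; apply: bgn_snd; exact: bgn_id.
  apply: (@bgn_comp _ _ _ _ _ _ (AB `*` ball (0 : R) d)
    (fun p : Q * (V * R) => (p.1, p.2.1, p.2.2)) F) => //.
    by move=> [q [x t]] [/= [Aq _] [Bx It]]; split=> //; exact: HAB.
  do ![apply: bgn_pair|apply: bgn_fst|apply: bgn_snd]; exact: bgn_id.
move=> q [Aq A'q]; split; first by rewrite /= A'F.
pose G (p : (V * R) * R) := F (q, p.1.1, p.2) - p.1.2.
have dG x y s t : ddiff G (x, y, s, t) = ddiff F (q, x, s, t).
  have shiftE (Y : normedModType R) (y1 : Y) (t1 h : R) :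
      (y1, t1) + h *: (0, 1) = (y1, t1 + h).
    by congr pair; rewrite /= ?scaler0 ?addr0// /GRing.scale/= mulr1.
  rewrite /ddiff /dquot !shiftE /G/=; case: eqP => _; last first.
    by rewrite opprB addrA subrK.
  have E : (fun h : R => h^-1 *: ((G \o shift (x, y, s)) (h *: (0, 1)) - G (x, y, s)))
      = (fun h : R => h^-1 *: ((F \o shift (q, x, s)) (h *: (0, 1)) - F (q, x, s))).
    apply/funext => h; rewrite /= ![h *: (0, 1) + _]addrC !shiftE /G /=.
    by rewrite opprB addrA subrK.
  exact: (congr1 (fun k : R -> R => lim (k @ 0^')) E).
have bGG : bsmooth ((B `*` setT) `*` ball (0 : R) d) G.
  move=> n; apply: bgnB; last by apply: bgn_snd; apply: bgn_fst; exact: bgn_id.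
  apply: (@bgn_comp _ _ _ _ _ _ (B `*` ball (0 : R) d) (fun p : V * R * R => (p.1.1, p.2))
    (fun p : V * R => F (q, p.1, p.2))).
  - by move=> [[x y] t] [/= [Bx _] It].
  - do ![apply: bgn_pair|apply: bgn_fst|apply: bgn_snd]; exact: bgn_id.
  - exact: bG.
have oBT : open (B `*` [set: R]) by apply: open_setX; [exact: oB.1|exact: openT].
have QG p s t : (B `*` setT) p -> ball 0 d s -> ball 0 d t -> 0 < ddiff G (p, s, t).
  by case: p => x y [/= Bx _] Is It; rewrite dG; apply: QP => //; exact: HAB.
have [oU [h [bh hu]]] := implicit_box oBT bGG QG.
have im : (fun v : V * R => (v.1, F (q, v.1, v.2))) @` (B `*` ball (0 : R) d) =
    [set x | (B `*` setT) x /\ exists2 t, ball 0 d t & G (x, t) = 0].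
  apply/seteqP; split=> [_ [[x t] [/= Bx It] <-]|[x y] [/= [Bx _]] [t It]].
    by split=> //; exists t; rewrite // /G/= subrr.
  by move=> /eqP; rewrite subr_eq0 => /eqP /= Ft; exists (x, t); rewrite //= Ft.
split=> //.
- by rewrite im.
- by move=> n; apply: bgn_pair; [apply: bgn_fst; exact: bgn_id|exact: bG].
- exists (fun p => (p.1, h p)); split.
    by move=> n; rewrite im; apply: bgn_pair; [apply: bgn_fst; exact: bgn_id|exact: bh].
  by move=> [x t] [/= Bx It]; congr pair; apply/esym/hu => //; rewrite /G/= subrr.
Qed.

End DiffeoFamilies.

Ltac smooth := repeat first
  [ assumption
  | apply: smooth_near_cst | apply: smooth_near_id
  | apply: smooth_near_pair | apply: smooth_nearX | apply: smooth_nearM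
  | apply: smooth_nearN | apply: smooth_nearD
  | apply: smooth_nearZ | apply: smooth_near_fst | apply: smooth_near_snd ].

(** * Normal form of the energy *)

Section Morse.
Context {R : realType}.
Implicit Types V W X Q : normedModType R.

Lemma near_pull V W (x : V) (f : V -> W) (P : W -> Prop) : smooth_near x f ->
  (\forall y \near f x, P y) -> \forall y \near x, P (f y).
Proof. by move=> /smooth_near_cts cf; exact: cf. Qed.

Lemma near_near (T : topologicalType) (x : T) (P : T -> Prop) :
  (\forall y \near x, P y) -> \forall z \near x, \forall y \near z, P y.
Proof. by move=> /nbhs_interior. Qed.

(** The recurring device for values at a removable singularity: an identity obtained by cancelling s
    - t extends to s = t. *)
Lemma cts_eq (f g : R -> R) t : {for t, continuous f} -> {for t, continuous g} ->
  (\forall s \near t, s != t -> f s = g s) -> f t = g t.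
Proof.
move=> cf cg fg.
have cf' : f s @[s --> t^'] --> f t by move=> A /cf; exact: nbhs_dnbhs.
have cg' : g s @[s --> t^'] --> g t by move=> A /cg; exact: nbhs_dnbhs.
suff H : f s @[s --> t^'] --> g t by exact: (cvg_unique _ cf' H).
move: cg'; apply: cvg_trans; apply: near_eq_cvg.
have : nbhs t (fun s => s != t -> f s = g s) by [].
rewrite nbhsE => -[A [oA At] Afg].
near=> s; apply/esym/Afg; last by near: s; exact: nbhs_dnbhs_neq.
by near: s; apply: nbhs_dnbhs; exact: open_nbhs_nbhs.
Unshelve. all: by end_near. Qed.

(** Criticality in the last variable, stated as a second-order expansion. In the applications such
    an expansion comes from algebra, without taking a derivative. *)
Definition stationary V (F : V * R -> R) (p : V * R) : Prop :=
  exists C : R -> R, {for p.2, continuous C} /\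
    \forall t \near p.2, F (p.1, t) = F p + (t - p.2) ^+ 2 * C t.

Lemma stationary_ddiff V (F : V * R -> R) x t :
  smooth_near (x, t) F -> stationary F (x, t) -> ddiff F (x, t, t) = 0.
Proof.
move=> /smooth_near_ddiff sF [C [/= cC FC]].
have cQ : {for t, continuous (fun s => ddiff F (x, t, s))}.
  apply: smooth_near_cts.
  by apply: (smooth_near_comp (f := fun s => (x, t, s))) => //; smooth.
have := @cts_eq _ (fun s => (s - t) * C s) t cQ; rewrite subrr mul0r; apply.
  by apply: cvgM => //; apply: cvgB; [exact: cvg_id|exact: cvg_cst].
apply: filterS FC => s Fs st; have := ddiffE F x t s.
rewrite Fs addrAC subrr add0r expr2 -mulrA => /mulfI E; rewrite E//.
by rewrite subr_eq0.
Qed.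

Lemma ddiff_sym V (F : V * R -> R) x s t : ddiff F (x, s, t) = ddiff F (x, t, s).
Proof.
have [->//|st] := eqVneq s t.
have /mulfI : t - s != 0 by rewrite subr_eq0 eq_sym.
by apply; rewrite -ddiffE -[in RHS]opprB mulNr -ddiffE opprB.
Qed.

(** The familiar relation between the second derivative and twice the second divided difference. By
    symmetry F[t,t] - F[t0,t0] splits as (F[t,t] - F[t,t0]) + (F[t0,t] - F[t0,t0]). *)
Lemma ddiff_diag V (F : V * R -> R) x0 t0 : smooth_near (x0, t0) F ->
  ddiff (fun p => ddiff F (p.1, p.2, p.2)) (x0, t0, t0) =
    ddiff (ddiff F) (x0, t0, t0, t0) *+ 2.
Proof.
move=> sF; have sQ := smooth_near_ddiff sF.
set dF := fun p => _.
have sdF : smooth_near (x0, t0) dF.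
  by apply: (smooth_near_comp (f := fun p => (p.1, p.2, p.2))) => //; smooth.
have sddF := smooth_near_ddiff sdF.
have sQ2 := smooth_near_ddiff sQ.
apply: (@cts_eq (fun t => ddiff dF (x0, t0, t))
  (fun t => ddiff (ddiff F) (x0, t, t0, t) + ddiff (ddiff F) (x0, t0, t0, t))).
- apply: smooth_near_cts.
  by apply: (smooth_near_comp (f := fun t => (x0, t0, t))) => //; smooth.
- apply: smooth_near_cts; apply: smooth_nearD.
    by apply: (smooth_near_comp (f := fun t => (x0, t, t0, t))) => //; smooth.
  by apply: (smooth_near_comp (f := fun t => (x0, t0, t0, t))) => //; smooth.
near=> t => t_neq; have /mulfI : t - t0 != 0 by rewrite subr_eq0.
apply; rewrite -ddiffE mulrDr -!ddiffE /dF/= [ddiff F (x0, t, t0)]ddiff_sym.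
by rewrite addrA subrK.
Unshelve. all: by end_near. Qed.

(** The expansion at [x0] says that t0 is critical with second derivative 2 m > 0, so the implicit
    function theorem follows the critical point as [h x]. There the first-order term vanishes, and
    the second divided difference F[h x, h x, t] is the smooth factor [M]. The last clause,
    uniqueness of nearby stationary points, is used to identify critical points found in different
    ways. *)
Lemma parametric_morse V (F : V * R -> R) x0 t0 m (B : R -> R) :
  smooth_near (x0, t0) F -> 0 < m -> B t0 = m -> {for t0, continuous B} ->
  (\forall t \near t0, F (x0, t) = F (x0, t0) + (t - t0) ^+ 2 * B t) ->
  exists (h : V -> R) (M : V * R -> R),
    [/\ smooth_near x0 h /\ h x0 = t0, smooth_near (x0, t0) M /\ M (x0, t0) = m,
     \forall p \near (x0, t0), F p = F (p.1, h p.1) + (p.2 - h p.1) ^+ 2 * M p &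
     \forall p \near (x0, t0), stationary F p -> p.2 = h p.1].
Proof.
move=> sF m0 Bt0 cB FB; have sQ := smooth_near_ddiff sF.
have sQ2 := smooth_near_ddiff sQ.
pose dF p := ddiff F (p.1, p.2, p.2).
have sdF : smooth_near (x0, t0) dF.
  by apply: (smooth_near_comp (f := fun p => (p.1, p.2, p.2))) => //; smooth.
have dF0 : dF (x0, t0) = 0 by apply: stationary_ddiff => //; exists B.
have Q2m : ddiff (ddiff F) (x0, t0, t0, t0) = m.
  rewrite -Bt0; apply: (@cts_eq (fun t => ddiff (ddiff F) (x0, t0, t0, t))) => //.
    apply: smooth_near_cts.
    by apply: (smooth_near_comp (f := fun t => (x0, t0, t0, t))) => //; smooth.
  apply: filterS FB => t Ft t_neq; have tt0 : t - t0 != 0 by rewrite subr_eq0.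
  apply: (mulfI tt0); rewrite -ddiffE [ddiff F (x0, t0, t0)]dF0 subr0.
  by apply: (mulfI tt0); rewrite -ddiffE Ft addrAC subrr add0r mulrA expr2.
have [|h [sh h0 hP hu]] := smooth_near_implicit sdF dF0.
  by rewrite ddiff_diag// Q2m pmulrn_lgt0.
exists h, (fun p => ddiff (ddiff F) (p.1, h p.1, h p.1, p.2)); split => //=.
- split; last by rewrite h0.
  apply: (smooth_near_comp (f := fun p => (p.1, h p.1, h p.1, p.2))); last by rewrite /= h0.
  have sh1 : smooth_near (x0, t0) (fun p : V * R => h p.1).
    by apply: (smooth_near_comp (f := fst)) => //; smooth.
  by smooth.
- have H : \forall p \near (x0, t0), dF (p.1, h p.1) = 0.
    by apply: (near_pull (x := (x0, t0)) (f := fst) (P := fun x => dF (x, h x) = 0)) => //;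
      exact: smooth_near_lin (lincont_fst _ _).
  apply: filterS H => -[x t] /= H.
  by rewrite expr2 -mulrA -ddiffE [ddiff F (x, h x, h x)]H subr0 -ddiffE subrKC.
- apply: filterS2 (smooth_near_near sF) hu => -[x t] /= sFx hu st.
  exact/hu/stationary_ddiff.
Unshelve. all: by end_near. Qed.

End Morse.

(** * One-variable unfolding of the pitchfork *)

Section Unfolding.
Context {R : realType}.
Implicit Types V W X Q : normedModType R.

Lemma smooth_near_dquot V W (f : V -> W) x v : smooth_near x f ->
  smooth_near (x, v, 0 : R) (dquot f).
Proof.
move=> [U [[oU Ux] bf]]; exists (quot_dom U); split; last exact: bsmooth_dquot.
by split; [exact: open_quot_dom|split; rewrite //= scale0r addr0].
Qed.

(** In the application s is the square of a coordinate, and [p.2 * psi p] becomes x^2. It must be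
    divisible by s with positive quotient, so that x itself, and not just x^2, is smooth. The
    hypothesis along v measures the first-order motion of [L (q, 0)] and yields transversality of
    [l]. *)
Lemma pitchfork_unfolding Q (q0 : Q) (L : Q * R -> R) (C : R -> R) v (K : R) :
  smooth_near (q0, 0) L -> {for 0, continuous C} -> 0 < C 0 ->
  (\forall s \near (0 : R), L (q0, s) = s * C s) ->
  K != 0 -> (\forall t \near (0 : R), L (q0 + t *: v, 0) = t * K) ->
  exists (l : Q -> R) (psi : Q * R -> R),
  [/\ smooth_near q0 l, l q0 = 0 /\ 'D_v l q0 != 0,
      smooth_near (q0, 0) psi, 0 < psi (q0, 0) &
      \forall p \near (q0, 0 : R),
        p.2 * L p = (p.2 * psi p) ^+ 2 / 4 - l p.1 * (p.2 * psi p) / 2].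
Proof.
move=> sL cC C0 LC K0 LK; pose k (p : Q * R) := p.2 * L p.
have sk : smooth_near (q0, 0) k by rewrite /k; smooth.
have kC : \forall s \near (0 : R), k (q0, s) = k (q0, 0) + (s - 0) ^+ 2 * C s.
  by apply: filterS LC => s Ls; rewrite /k/= Ls mul0r add0r subr0 expr2 mulrA.
have [h [m [[sh h0] [sm m0] kE _]]] := parametric_morse sk C0 erefl cC kC.
have sh1 : smooth_near (q0, 0 : R) (fun p => h p.1).
  by apply: (smooth_near_comp (f := fst)) => //; smooth; exact: smooth_near_lin (lincont_fst _ _).
have sq0 : smooth_near q0 (fun q : Q => (q, 0 : R)) by smooth.
have sr : smooth_near (q0, 0) (fun p => Num.sqrt (m p)).
  by apply: smooth_near_sqrt => //; rewrite m0.
(* From k = k(h) + (s - h)^2 m, the function sg = l + 2 (s - h) sqrt m satisfies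
   (sg - l)^2 / 4 = k - k(h), and l is chosen such that sg vanishes at s = 0. *)
pose l q := 2 * h q * Num.sqrt (m (q, 0)).
have sl : smooth_near q0 l.
  by rewrite /l; smooth; apply: (smooth_near_comp (g := fun p => Num.sqrt (m p)) sq0).
have sl1 : smooth_near (q0, 0 : R) (fun p => l p.1).
  by apply: (smooth_near_comp (f := fst)) => //; smooth; exact: smooth_near_lin (lincont_fst _ _).
have l0 : l q0 = 0 by rewrite /l h0 mulr0 mul0r.
pose sg (p : Q * R) := l p.1 + 2 * (p.2 - h p.1) * Num.sqrt (m p).
have ssg : smooth_near (q0, 0) sg by rewrite /sg; smooth.
pose psi (p : Q * R) := ddiff sg (p.1, 0, p.2).
have spsi : smooth_near (q0, 0) psi.
  apply: (smooth_near_comp (f := fun p => (p.1, 0, p.2))); first by smooth.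
  exact: smooth_near_ddiff.
have sgE p : sg p = p.2 * psi p.
  case: p => q s; have := ddiffE sg q 0 s; rewrite /psi /= subr0 => <-.
  have -> : sg (q, 0) = 0 by rewrite /sg /l/= sub0r mulrN mulNr subrr.
  by rewrite subr0.
(* At [q0] both [l] and [h] vanish, so [sg] is 2 s times the square root of [m], and division by s
   gives the value. *)
have psi0 : psi (q0, 0) = 2 * Num.sqrt (C 0).
  rewrite -m0.
  apply: (@cts_eq _ (fun s => psi (q0, s)) (fun s => 2 * Num.sqrt (m (q0, s)))).
  - by apply: smooth_near_cts; apply: (smooth_near_comp (f := fun s => (q0, s))) => //; smooth.
  - apply: smooth_near_cts; apply: smooth_nearM; first by smooth.
    by apply: (smooth_near_comp (f := fun s => (q0, s)) (g := fun p => Num.sqrt (m p))) => //; smooth.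
  near=> s => s0; apply: (mulfI s0); rewrite -[LHS](sgE (q0, s)) /sg /= l0 h0.
  by rewrite add0r subr0 mulrAC mulrC mulrA.
have psi_gt0 : 0 < psi (q0, 0) by rewrite psi0 mulr_gt0// sqrtr_gt0.
have kE0 : \forall p \near (q0, 0 : R), k (p.1, 0) = k (p.1, h p.1) + (0 - h p.1) ^+ 2 * m (p.1, 0).
  by apply: (near_pull (f := fun p : Q * R => (p.1, 0 : R)) _ kE); smooth.
have m_ge0 : \forall p \near (q0, 0 : R), 0 < m p.
  by have /smooth_near_cts cm := sm; apply: (cvgr_gt _ cm); rewrite m0.
have m_ge00 : \forall p \near (q0, 0 : R), 0 < m (p.1, 0).
  by apply: (near_pull (f := fun p : Q * R => (p.1, 0 : R)) _ m_ge0); smooth.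
have main : \forall p \near (q0, 0 : R),
    p.2 * L p = (p.2 * psi p) ^+ 2 / 4 - l p.1 * (p.2 * psi p) / 2.
  near=> p.
  have E1 : k p = k (p.1, h p.1) + (p.2 - h p.1) ^+ 2 * m p by near: p.
  have E2 : k (p.1, 0) = k (p.1, h p.1) + (0 - h p.1) ^+ 2 * m (p.1, 0) by near: p.
  have r1 : Num.sqrt (m p) ^+ 2 = m p by rewrite sqr_sqrtr// ltW//; near: p.
  have r2 : Num.sqrt (m (p.1, 0)) ^+ 2 = m (p.1, 0) by rewrite sqr_sqrtr// ltW//; near: p.
  rewrite -[LHS]/(k p) -sgE E1.
  have -> : k (p.1, h p.1) = - (h p.1 ^+ 2 * m (p.1, 0)).
    by move: E2; rewrite {1}/k/= mul0r sub0r sqrrN => /esym/eqP; rewrite addr_eq0 => /eqP.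
  move: r1 r2; rewrite /sg /l; move: (Num.sqrt (m p)) (Num.sqrt (m (p.1, 0))) => a b <- <-.
  by field.
exists l, psi; split=> //; split=> //.
(* Dividing the normal form by s and letting s tend to 0 relates [l] to the linear coefficient of k
   at s = 0. *)
have L0 : \forall q \near q0, L (q, 0) = - (l q * psi (q, 0)) / 2.
  have m1 := near_pull sq0 (near_near main).
  have m2 := near_pull sq0 (smooth_near_near sL).
  have m3 := near_pull sq0 (smooth_near_near spsi).
  near=> q.
  have sLq : smooth_near (q, 0) L by near: q.
  have spq : smooth_near (q, 0) psi by near: q.
  have sqs : smooth_near 0 (fun s : R => (q, s)) by smooth.
  have := @cts_eq _ (fun s => L (q, s)) (fun s => s * psi (q, s) ^+ 2 / 4 - l q * psi (q, s) / 2) 0.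
  rewrite !mul0r sub0r mulNr; apply.
  - exact: smooth_near_cts (smooth_near_comp sqs sLq).
  - apply: smooth_near_cts; have sp1 := smooth_near_comp sqs spq; smooth.
  have mq : \forall p \near (q, 0 : R), p.2 * L p = (p.2 * psi p) ^+ 2 / 4 - l p.1 * (p.2 * psi p) / 2.
    by near: q.
  apply: filterS (near_pull sqs mq) => s /= E s0.
  by apply: (mulfI s0); rewrite E; field.
have sqt : smooth_near (0 : R) (fun t => q0 + t *: v).
  by smooth.
have dlK : 'D_v l q0 = - 2 * K / psi (q0, 0).
  have <- : dquot l (q0, v, 0) = 'D_v l q0 by rewrite /dquot/= eqxx.
  have {2}-> : q0 = q0 + 0 *: v by rewrite scale0r addr0.
  apply: (@cts_eq _ (fun t => dquot l (q0, v, t)) (fun t => - 2 * K / psi (q0 + t *: v, 0))).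
  - apply: smooth_near_cts.
    apply: (smooth_near_comp (f := fun t => (q0, v, t))); first by smooth.
    exact: smooth_near_dquot.
  - apply: smooth_near_cts; apply: smooth_nearM; first by smooth.
    apply: smooth_nearV; last by rewrite scale0r addr0 gt_eqF.
    apply: (smooth_near_comp (f := fun t : R => (q0 + t *: v, 0 : R)) (g := psi)); first by smooth.
    by rewrite scale0r addr0.
  have L0' : \forall t \near (0 : R), L (q0 + t *: v, 0) = - (l (q0 + t *: v) * psi (q0 + t *: v, 0)) / 2.
    have := near_pull (P := fun q => L (q, 0) = - (l q * psi (q, 0)) / 2) sqt.
    by rewrite scale0r addr0; apply.
  have psi_pos : \forall t \near (0 : R), 0 < psi (q0 + t *: v, 0).
    have sp : smooth_near (0 : R) (fun t => psi (q0 + t *: v, 0)).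
      apply: (smooth_near_comp (f := fun t : R => (q0 + t *: v, 0 : R)) (g := psi)); first by smooth.
      by rewrite scale0r addr0.
    by apply: (cvgr_gt _ (smooth_near_cts sp)); rewrite scale0r addr0.
  near=> t => t0; apply: (mulfI t0).
  have pt : psi (q0 + t *: v, 0) != 0 by rewrite gt_eqF//; near: t.
  rewrite -[t * dquot _ _]/(t *: _) -dquotE l0 subr0.
  have E1 : L (q0 + t *: v, 0) = t * K by near: t.
  have E2 : L (q0 + t *: v, 0) = - (l (q0 + t *: v) * psi (q0 + t *: v, 0)) / 2.
    by near: t.
  have -> : t * (- 2 * K / psi (q0 + t *: v, 0)) = - 2 * (t * K) / psi (q0 + t *: v, 0) by field.
  by rewrite -E1 E2; field.
by rewrite dlK !mulf_neq0// ?invr_eq0 ?oppr_eq0 ?pnatr_eq0// gt_eqF.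
Unshelve. all: by end_near. Qed.

End Unfolding.

(** * Blow-up and splitting off a square *)

Section Splitting.
Context {R : realType}.
Implicit Types Q : normedModType R.

Definition taylor2 (F e d : R -> R) : Prop :=
  [/\ smooth_near 0 e, smooth_near 0 d,
      \forall u \near (0 : R), F u = F 0 + u * e u &
      \forall u \near (0 : R), e u = e 0 + u * d u].

Lemma taylor2_smooth F e d : taylor2 F e d -> smooth_near 0 F.
Proof.
move=> [se _ FE _]; apply: (@smooth_near_ext R R R 0 (fun u => F 0 + u * e u)).
  by apply: filterS FE => u ->.
by smooth.
Qed.

(** The variable t is the first tangent and X the tangent of the half sum. [w] minimizes H1 x^2 + H2
    (1 - x)^2, with minimum H1 H2 / (H1 + H2); the equation on the [H]s says that H3 cancels this
    minimum, which is degeneracy of the quadratic part. The long inequality is positivity of [C 0],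
    the coefficient of s^2. *)
Lemma even_splitting Q (q0 v : Q) (a : R) (c1 c2 c3 : Q -> R)
    (F1 F2 F3 e1 e2 e3 d1 d2 d3 : R -> R) :
  smooth_near q0 c1 -> smooth_near q0 c2 -> smooth_near q0 c3 ->
  taylor2 F1 e1 d1 -> taylor2 F2 e2 d2 -> taylor2 F3 e3 d3 ->
  let H1 := c1 q0 * e1 0 in let H2 := c2 q0 * e2 0 in let H3 := c3 q0 * e3 0 in
  let w := H2 / (H1 + H2) in
  0 < H1 -> 0 < H2 -> H1 * H2 + H3 * (H1 + H2) = 0 ->
  0 < c1 q0 * w ^+ 4 * d1 0
      + c2 q0 * ((1 - w) ^+ 4 * d2 0 - 2 * (1 - w) ^+ 2 * w * e2 0)
      + c3 q0 * d3 0 ->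
  a != 0 ->
  (\forall t \near (0 : R), [/\ c1 (q0 + t *: v) = (1 + a * t) * c1 q0,
     c2 (q0 + t *: v) = (1 + a * t) * c2 q0 & c3 (q0 + t *: v) = c3 q0]) ->
  exists (L : Q * R -> R) (C : R -> R) (K : R) (T : Q * R -> R) (M : Q * R * R -> R),
  [/\ [/\ smooth_near (q0, 0) L, {for 0, continuous C}, 0 < C 0 &
          \forall s \near (0 : R), L (q0, s) = s * C s],
      K != 0 /\ (\forall t \near (0 : R), L (q0 + t *: v, 0) = t * K),
      smooth_near (q0, 0) T /\ (\forall q \near q0, T (q, 0) = 0),
      smooth_near (q0, 0, 0) M /\ 0 < M (q0, 0, 0) &
      \forall p \near (q0, 0 : R, 0 : R),
        let q := p.1.1 in let X := p.1.2 in let t := p.2 in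
        c1 q * F1 (t ^+ 2) + c2 q * F2 (((X - t) / (1 + X * t)) ^+ 2)
          + c3 q * F3 (X ^+ 2)
        = c1 q * F1 0 + c2 q * F2 0 + c3 q * F3 0
          + X ^+ 2 * L (q, X ^+ 2) + (t - T (q, X)) ^+ 2 * M p].
Proof.
move=> sc1 sc2 sc3 tF1 tF2 tF3 H1 H2 H3 w H10 H20 HH kap0 a0 cv.
have [sF1 sF2 sF3] : [/\ smooth_near 0 F1, smooth_near 0 F2 & smooth_near 0 F3].
  by split; apply: taylor2_smooth; [exact: tF1|exact: tF2|exact: tF3].
have [[se1 sd1 FE1 eE1] [se2 sd2 FE2 eE2] [se3 sd3 FE3 eE3]] := And3 tF1 tF2 tF3.
have H12 : H1 + H2 != 0 by rewrite gt_eqF// addr_gt0.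
pose r (p : Q * R * R) := (1 - p.2) / (1 + p.1.2 * p.2).
pose L (p : Q * R * R) := c1 p.1.1 * p.2 ^+ 2 * e1 (p.1.2 * p.2 ^+ 2)
  + c2 p.1.1 * r p ^+ 2 * e2 (p.1.2 * r p ^+ 2) + c3 p.1.1 * e3 p.1.2.
have sq (x s : R) : smooth_near (q0, x, s) (fun p : Q * R * R => p.1.1).
  by smooth.
have sr : smooth_near (q0, 0, w) r.
  rewrite /r; smooth; apply: smooth_nearV; first by smooth.
  by rewrite /= mul0r addr0 oner_neq0.
have su1 : smooth_near (q0, 0, w) (fun p : Q * R * R => p.1.2 * p.2 ^+ 2) by smooth.
have su2 : smooth_near (q0, 0, w) (fun p : Q * R * R => p.1.2 * r p ^+ 2) by smooth.
have su3 : smooth_near (q0, 0 : R, w) (fun p : Q * R * R => p.1.2) by smooth.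
have scomp (Y : normedModType R) (y : Y) (f : Y -> R) (g : R -> R) : smooth_near y f -> f y = 0 -> smooth_near 0 g ->
    smooth_near y (fun x => g (f x)).
  by move=> sf f0 sg; apply: smooth_near_comp sf _; rewrite f0.
have scq (x s : R) (c : Q -> R) : smooth_near q0 c -> smooth_near (q0, x, s) (fun p : Q * R * R => c p.1.1).
  by move=> sc; exact: smooth_near_comp (sq x s) _.
have sL : smooth_near (q0, 0, w) L.
  have h1 := scomp _ _ _ _ su1 (mul0r _) se1.
  have h2 := scomp _ _ _ _ su2 (mul0r _) se2.
  have h3 := scomp _ _ _ _ su3 erefl se3.
  have k1 := scq 0 w _ sc1; have k2 := scq 0 w _ sc2; have k3 := scq 0 w _ sc3.
  by rewrite /L; smooth.
have L0E q x : L (q, 0, x) = c1 q * e1 0 * x ^+ 2 + c2 q * e2 0 * (1 - x) ^+ 2 + c3 q * e3 0.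
  by rewrite /L /r/= !mul0r addr0 divr1; ring.
have LB : \forall x \near w, L (q0, 0, x) = L (q0, 0, w) + (x - w) ^+ 2 * (H1 + H2).
  by near=> x; rewrite !L0E -/H1 -/H2 -/H3 /w; field.
have cB : {for w, continuous (fun _ : R => H1 + H2)} by exact: cvg_cst.
have [h [N [[sh h0] [sN N0] LE Lu]]] :=
  parametric_morse sL (addr_gt0 H10 H20) erefl cB LB.
have w1 : 1 - w = H1 / (H1 + H2) by rewrite /w; field.
(* This is [L (q0, 0, w) = 0]: the term of order s of the reduced energy vanishes at [q0]. *)
have Z : H1 * w ^+ 2 + H2 * (1 - w) ^+ 2 + H3 = 0.
  have -> : H3 = - (H1 * H2) / (H1 + H2) by apply: (mulIf H12); rewrite divfK//; lra.
  by rewrite w1 /w; field.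
have H30 : H3 != 0.
  by apply: contra_eq_neq HH => ->; rewrite mul0r addr0 mulf_neq0// gt_eqF.
pose Ls p := L (p, h p).
have sLs : smooth_near (q0, 0) Ls.
  apply: (smooth_near_comp (f := fun p => (p, h p)) (g := L)); first by smooth.
  by rewrite h0.
pose dh s := ddiff h (q0, 0, s).
pose r1 s := r (q0, s, w).
(* The term with [e2 0] is the change of [r1 s ^+ 2] from its value (1 - w)^2 at s = 0, divided by
   s. The last term corrects for evaluating [L] at [w] instead of at the minimizer [h (q0, s)],
   which differs from [w] by [s * dh s]. *)
pose C s := c1 q0 * w ^+ 4 * d1 (s * w ^+ 2)
  + c2 q0 * (r1 s ^+ 4 * d2 (s * r1 s ^+ 2)
             - e2 0 * (1 - w) ^+ 2 * w * (2 + s * w) / (1 + s * w) ^+ 2)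
  + c3 q0 * d3 s - s * dh s ^+ 2 * N (q0, s, w).
have ss : smooth_near (0 : R) (fun s : R => s) by smooth.
have sr1 : smooth_near 0 r1.
  by apply: (smooth_near_comp (f := fun s : R => (q0, s, w)) (g := r)) => //; smooth.
have sw : smooth_near (0 : R) (fun s : R => ((1 + s * w) ^+ 2)^-1).
  by apply: smooth_nearV; [smooth|rewrite mul0r addr0 expr1n oner_neq0].
have sC : smooth_near 0 C.
  have k1 : smooth_near (0 : R) (fun s : R => s * w ^+ 2) by smooth.
  have k2 : smooth_near (0 : R) (fun s : R => s * r1 s ^+ 2) by smooth.
  have h1 := scomp _ _ _ _ k1 (mul0r _) sd1.
  have h2 := scomp _ _ _ _ k2 (mul0r _) sd2.
  have h3 : smooth_near 0 dh.
    apply: (smooth_near_comp (f := fun s : R => (q0, 0 : R, s)) (g := ddiff h)); first by smooth.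
    exact: smooth_near_ddiff.
  have h4 : smooth_near 0 (fun s => N (q0, s, w)).
    by apply: (smooth_near_comp (f := fun s : R => (q0, s, w)) (g := N)) => //; smooth.
  by rewrite /C; smooth.
have C0 : C 0 = c1 q0 * w ^+ 4 * d1 0
      + c2 q0 * ((1 - w) ^+ 4 * d2 0 - 2 * (1 - w) ^+ 2 * w * e2 0)
      + c3 q0 * d3 0.
  by rewrite /C /r1 /r/= !mul0r !addr0 expr1n !divr1; ring.
(* Freezing the last argument of L at w changes Ls only to second order in s,
   because w is critical for L (q0, 0, _). *)
have LsC : \forall s \near (0 : R), Ls (q0, s) = s * C s.
  have ps : smooth_near (0 : R) (fun s : R => ((q0, s), w)) by smooth.
  have n0 := near_pull ps LE.
  have k1 : smooth_near (0 : R) (fun s : R => s * w ^+ 2) by smooth.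
  have k2 : smooth_near (0 : R) (fun s : R => s * r1 s ^+ 2) by smooth.
  have n1 := near_pull (P := fun u => e1 u = e1 0 + u * d1 u) k1.
  have n2 := near_pull (P := fun u => e2 u = e2 0 + u * d2 u) k2.
  move: n1 n2; rewrite !mul0r => /(_ eE1) n1 /(_ eE2) n2.
  have n3 : \forall s \near (0 : R), 0 < 1 + s * w.
    have sk : smooth_near (0 : R) (fun s : R => 1 + s * w) by smooth.
    by apply: (cvgr_gt _ (smooth_near_cts sk)); rewrite mul0r addr0.
  near=> s.
  have E0 : L (q0, s, w) = Ls (q0, s) + (w - h (q0, s)) ^+ 2 * N (q0, s, w).
    by near: s.
  have hE : h (q0, s) = w + s * dh s.
    by have := ddiffE h q0 0 s; rewrite subr0 h0 => /eqP; rewrite subr_eq addrC => /eqP.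
  have -> : Ls (q0, s) = L (q0, s, w) - s ^+ 2 * dh s ^+ 2 * N (q0, s, w).
    by rewrite E0 hE; ring.
  have E1 : e1 (s * w ^+ 2) = e1 0 + (s * w ^+ 2) * d1 (s * w ^+ 2) by near: s.
  have E2 : e2 (s * r1 s ^+ 2) = e2 0 + (s * r1 s ^+ 2) * d2 (s * r1 s ^+ 2) by near: s.
  have E3 : e3 s = e3 0 + s * d3 s by near: s.
  have sw0 : 1 + s * w != 0 by rewrite gt_eqF//; near: s.
  rewrite /C {1}/L/= -/(r1 s) E1 E2 E3.
  move: (d1 _) (d2 _) => D1 D2.
  have r1E : r1 s = (1 - w) / (1 + s * w) by [].
  have Z' : c3 q0 * e3 0 = - (H1 * w ^+ 2 + H2 * (1 - w) ^+ 2).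
    by rewrite -/H3; apply/eqP; rewrite -addr_eq0 addrC Z.
  rewrite [c3 q0 * (e3 0 + _)]mulrDr Z' /H1 /H2 r1E; move: (w) sw0 => W sw0; field.
  exact: sw0.
(* Along v the first two coefficients are scaled by the same factor, so [w] remains the minimizer at
   s = 0. By [Z] the minimum there is (1 + a t)(- H3) + H3. *)
pose K := - (a * H3).
have K0 : K != 0 by rewrite oppr_eq0 mulf_neq0.
have LK : \forall t \near (0 : R), Ls (q0 + t *: v, 0) = t * K.
  have pt : smooth_near (0 : R) (fun t : R => ((q0 + t *: v, 0 : R), w)) by smooth.
  have := near_pull (P := fun p : Q * R * R => stationary L p -> p.2 = h p.1) pt.
  rewrite scale0r addr0 => /(_ Lu) n1.
  near=> t.
  have [C1 C2 C3] : [/\ c1 (q0 + t *: v) = (1 + a * t) * c1 q0,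
     c2 (q0 + t *: v) = (1 + a * t) * c2 q0 & c3 (q0 + t *: v) = c3 q0] by near: t.
  have U : stationary L (q0 + t *: v, 0, w) -> w = h (q0 + t *: v, 0) by near: t.
  have LE' x : L (q0 + t *: v, 0, x) =
      (1 + a * t) * (H1 * x ^+ 2 + H2 * (1 - x) ^+ 2) + H3.
    by rewrite L0E C1 C2 C3 /H1 /H2 /H3; ring.
  rewrite /Ls -U; last first.
    exists (fun=> (1 + a * t) * (H1 + H2)); split; first exact: cvg_cst.
    by near=> x; rewrite /= !LE' w1 /w; field.
  have Z' : H1 * w ^+ 2 + H2 * (1 - w) ^+ 2 = - H3 by apply/eqP; rewrite -addr_eq0 Z.
  by rewrite LE' Z' /K; ring.
(* T is the critical point of G in t: it is the one of L, blown down. *)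
pose T (p : Q * R) := p.2 * h (p.1, p.2 ^+ 2).
have p2 : smooth_near (q0, 0 : R) (fun p : Q * R => (p.1, p.2 ^+ 2)) by smooth.
have h02 : h (q0, 0 ^+ 2) = w by rewrite expr0n.
have sh2 : smooth_near (q0, 0 : R) (fun p : Q * R => h (p.1, p.2 ^+ 2)).
  by apply: (smooth_near_comp (g := h) p2); rewrite /= expr0n.
have sT : smooth_near (q0, 0) T by rewrite /T; smooth.
have T0 : T (q0, 0) = 0 by rewrite /T mul0r.
pose cc q := c1 q * F1 0 + c2 q * F2 0 + c3 q * F3 0.
pose G (p : Q * R * R) := c1 p.1.1 * F1 (p.2 ^+ 2)
  + c2 p.1.1 * F2 (((p.1.2 - p.2) / (1 + p.1.2 * p.2)) ^+ 2) + c3 p.1.1 * F3 (p.1.2 ^+ 2).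
have sG : smooth_near (q0, 0, 0) G.
  have g1 : smooth_near (q0, 0 : R, 0 : R) (fun p : Q * R * R => p.2 ^+ 2) by smooth.
  have g3 : smooth_near (q0, 0 : R, 0 : R) (fun p : Q * R * R => p.1.2 ^+ 2) by smooth.
  have g2 : smooth_near (q0, 0 : R, 0 : R)
      (fun p : Q * R * R => ((p.1.2 - p.2) / (1 + p.1.2 * p.2)) ^+ 2).
    smooth; apply: smooth_nearV; first by smooth.
    by rewrite /= mul0r addr0 oner_neq0.
  have h1 := scomp _ _ _ _ g1 (expr0n _ 2) sF1.
  have h3 := scomp _ _ _ _ g3 (expr0n _ 2) sF3.
  have h2 : smooth_near (q0, 0 : R, 0 : R)
      (fun p : Q * R * R => F2 (((p.1.2 - p.2) / (1 + p.1.2 * p.2)) ^+ 2)).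
    by apply: (scomp _ _ _ _ g2 _ sF2); rewrite /= subr0 mul0r expr0n.
  have k1 := scq 0 0 _ sc1; have k2 := scq 0 0 _ sc2; have k3 := scq 0 0 _ sc3.
  by rewrite /G; smooth.
pose BG (q : Q) (t : R) := c1 q * e1 (t ^+ 2) + c2 q * e2 (t ^+ 2).
have st2 : smooth_near (0 : R) (fun t : R => t ^+ 2) by smooth.
have sBG q : {for 0, continuous (BG q)}.
  have h1 := scomp _ _ _ _ st2 (expr0n _ 2) se1.
  have h2 := scomp _ _ _ _ st2 (expr0n _ 2) se2.
  by apply: smooth_near_cts; rewrite /BG; smooth.
have GB q : \forall t \near (0 : R), G (q, 0, t) = G (q, 0, 0) + (t - 0) ^+ 2 * BG q t.
  have n1 := near_pull (P := fun u => F1 u = F1 0 + u * e1 u) st2.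
  have n2 := near_pull (P := fun u => F2 u = F2 0 + u * e2 u) st2.
  move: n1 n2; rewrite !expr0n/= => /(_ FE1) n1 /(_ FE2) n2.
  near=> t.
  have E1 : F1 (t ^+ 2) = F1 0 + t ^+ 2 * e1 (t ^+ 2) by near: t.
  have E2 : F2 (t ^+ 2) = F2 0 + t ^+ 2 * e2 (t ^+ 2) by near: t.
  rewrite /G /BG/= !mul0r !addr0 !divr1 !sub0r sqrrN expr0n/= E1 E2 oppr0 expr0n/=.
  by ring.
have BG0 : BG q0 0 = H1 + H2 by rewrite /BG expr0n.
(* The Morse form of [L] is available only where t / X is close to [w]. Applying the lemma to [G]
   itself gives a splitting on a full neighbourhood of the origin; it remains to see that its
   critical point [g] is [T]. *)
have [g [M [[sg g0] [sM M0] GE Gu]]] :=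
  parametric_morse sG (addr_gt0 H10 H20) BG0 (sBG q0) (GB q0).
have GL : \forall p \near (q0, 0 : R, w),
    G (p.1, p.1.2 * p.2) = cc p.1.1 + p.1.2 ^+ 2 * L (p.1.1, p.1.2 ^+ 2, p.2).
  pose rX (p : Q * R * R) := r (p.1.1, p.1.2 ^+ 2, p.2).
  have s1 : smooth_near (q0, 0 : R, w) (fun p : Q * R * R => (p.1.2 * p.2) ^+ 2) by smooth.
  have srX : smooth_near (q0, 0 : R, w) rX.
    apply: (smooth_near_comp (f := fun p : Q * R * R => (p.1.1, p.1.2 ^+ 2, p.2)) (g := r)).
      by smooth.
    by rewrite /= expr0n.
  have s2 : smooth_near (q0, 0 : R, w) (fun p : Q * R * R => (p.1.2 * rX p) ^+ 2) by smooth.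
  have s3 : smooth_near (q0, 0 : R, w) (fun p : Q * R * R => p.1.2 ^+ 2) by smooth.
  have n1 := near_pull (P := fun u => F1 u = F1 0 + u * e1 u) s1.
  have n2 := near_pull (P := fun u => F2 u = F2 0 + u * e2 u) s2.
  have n3 := near_pull (P := fun u => F3 u = F3 0 + u * e3 u) s3.
  move: n1 n2 n3; rewrite /= !mul0r !expr0n/= => /(_ FE1) n1 /(_ FE2) n2 /(_ FE3) n3.
  have n4 : \forall p \near (q0, 0 : R, w), 0 < 1 + p.1.2 ^+ 2 * p.2.
    have sk : smooth_near (q0, 0 : R, w) (fun p : Q * R * R => 1 + p.1.2 ^+ 2 * p.2) by smooth.
    by apply: (cvgr_gt _ (smooth_near_cts sk)); rewrite /= expr0n mul0r addr0.
  near=> p.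
  have E1 : F1 ((p.1.2 * p.2) ^+ 2) = F1 0 + (p.1.2 * p.2) ^+ 2 * e1 ((p.1.2 * p.2) ^+ 2).
    by near: p.
  have E2 : F2 ((p.1.2 * rX p) ^+ 2) = F2 0 + (p.1.2 * rX p) ^+ 2 * e2 ((p.1.2 * rX p) ^+ 2).
    by near: p.
  have E3 : F3 (p.1.2 ^+ 2) = F3 0 + p.1.2 ^+ 2 * e3 (p.1.2 ^+ 2) by near: p.
  have p0 : 1 + p.1.2 ^+ 2 * p.2 != 0 by rewrite gt_eqF//; near: p.
  rewrite /G /L/= -/(rX p).
  have -> : (p.1.2 - p.1.2 * p.2) / (1 + p.1.2 * (p.1.2 * p.2)) = p.1.2 * rX p.
    by rewrite /rX /r/= [RHS]mulrA; congr (_ / _); ring.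
  by rewrite E1 E2 E3 /cc !exprMn; ring.
have pT : smooth_near (q0, 0 : R) (fun p : Q * R => (p, T p)) by smooth.
have pL : smooth_near (q0, 0 : R)
    (fun p : Q * R => ((p.1, p.2 ^+ 2), h (p.1, p.2 ^+ 2))) by smooth.
have pG : smooth_near (q0, 0 : R) (fun p : Q * R => (p, h (p.1, p.2 ^+ 2))) by smooth.
(* Stationarity of [T] concerns all t near [T p], so the blow-up identities are needed on
   neighbourhoods of the points over p and not only at these points. *)
have nGL : \forall p \near (q0, 0 : R), \forall y \near (p, h (p.1, p.2 ^+ 2)),
    G (y.1, y.1.2 * y.2) = cc y.1.1 + y.1.2 ^+ 2 * L (y.1.1, y.1.2 ^+ 2, y.2).
  have := near_pull (P := fun p => \forall y \near p, G (y.1, y.1.2 * y.2)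
    = cc y.1.1 + y.1.2 ^+ 2 * L (y.1.1, y.1.2 ^+ 2, y.2)) pG.
  by rewrite /= h02; apply; exact: near_near.
have nLE : \forall p \near (q0, 0 : R), \forall y \near ((p.1, p.2 ^+ 2), h (p.1, p.2 ^+ 2)),
    L y = L (y.1, h y.1) + (y.2 - h y.1) ^+ 2 * N y.
  have := near_pull (P := fun p => \forall y \near p,
    L y = L (y.1, h y.1) + (y.2 - h y.1) ^+ 2 * N y) pL.
  by rewrite /= h02 expr0n; apply; exact: near_near.
have nN : \forall p \near (q0, 0 : R), smooth_near ((p.1, p.2 ^+ 2), h (p.1, p.2 ^+ 2)) N.
  have := near_pull (P := fun p => smooth_near p N) pL.
  by rewrite /= h02 expr0n; apply; exact: smooth_near_near.
(* For X nonzero the rescaling t = X w carries the expansion of [L] at its minimizer to one of [G].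
   For X = 0 the point [T] is 0, where [G] is even in t. *)
have stT q X :
    (\forall y \near ((q, X), h (q, X ^+ 2)),
       G (y.1, y.1.2 * y.2) = cc y.1.1 + y.1.2 ^+ 2 * L (y.1.1, y.1.2 ^+ 2, y.2)) ->
    (\forall y \near ((q, X ^+ 2), h (q, X ^+ 2)),
       L y = L (y.1, h y.1) + (y.2 - h y.1) ^+ 2 * N y) ->
    smooth_near ((q, X ^+ 2), h (q, X ^+ 2)) N -> stationary G (q, X, T (q, X)).
  move=> NGL NLE NN; have [->|X0] := eqVneq X 0.
    by rewrite /T/= mul0r; exists (BG q); split; [exact: sBG|exact: GB].
  have TX : T (q, X) / X = h (q, X ^+ 2) by rewrite /T/= mulrC mulKf.
  have st1 : smooth_near (T (q, X)) (fun t : R => ((q, X), t / X)) by smooth.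
  have st3 : smooth_near (T (q, X)) (fun t : R => ((q, X ^+ 2), t / X)) by smooth.
  have m1 := near_pull (P := fun y : Q * R * R => G (y.1, y.1.2 * y.2)
    = cc y.1.1 + y.1.2 ^+ 2 * L (y.1.1, y.1.2 ^+ 2, y.2)) st1.
  have m2 := near_pull (P := fun y : Q * R * R => L y = L (y.1, h y.1) + (y.2 - h y.1) ^+ 2 * N y) st3.
  move: m1 m2; rewrite TX => /(_ NGL) m1 /(_ NLE) m2.
  exists (fun t => N ((q, X ^+ 2), t / X)); split.
    by apply: smooth_near_cts; apply: (smooth_near_comp (g := N) st3); rewrite TX.
  have GT : G (q, X, T (q, X)) = cc q + X ^+ 2 * L (q, X ^+ 2, h (q, X ^+ 2)).
    exact: (nbhs_singleton NGL).
  near=> t.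
  have G1 : G (q, X, X * (t / X)) = cc q + X ^+ 2 * L (q, X ^+ 2, t / X) by near: t.
  have L1 : L (q, X ^+ 2, t / X) = L (q, X ^+ 2, h (q, X ^+ 2))
      + (t / X - h (q, X ^+ 2)) ^+ 2 * N (q, X ^+ 2, t / X) by near: t.
  rewrite /= GT; have {1}-> : t = X * (t / X) by rewrite mulrC divfK.
  by rewrite G1 L1 /T/=; field.
have gT : \forall p \near (q0, 0 : R), T p = g p.
  have := near_pull (P := fun p : Q * R * R => stationary G p -> p.2 = g p.1) pT.
  rewrite T0 => /(_ Gu) n1.
  near=> p; have : stationary G (p, T p).
    rewrite [p]surjective_pairing; apply: stT; last by near: p.
      by rewrite -surjective_pairing; near: p.
    by near: p.
  by near: p.
exists Ls, C, K, T, M; split=> //.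
- by split=> //; [exact: smooth_near_cts|rewrite C0].
- by split=> //; near=> q; rewrite /T mul0r.
- by split=> //; rewrite M0 addr_gt0.
have p1 : smooth_near (q0, 0 : R, 0 : R) (fun p : Q * R * R => p.1) by smooth.
have m1 := near_pull (P := fun p => T p = g p) p1 gT.
have m2 := near_pull p1 nGL.
near=> p.
have E1 : T p.1 = g p.1 by near: p.
have NGL : \forall y \near (p.1, h (p.1.1, p.1.2 ^+ 2)),
      G (y.1, y.1.2 * y.2) = cc y.1.1 + y.1.2 ^+ 2 * L (y.1.1, y.1.2 ^+ 2, y.2).
  by near: p.
have E2 : G p = G (p.1, g p.1) + (p.2 - g p.1) ^+ 2 * M p by near: p.
rewrite -[LHS]/(G p) E2 -E1 (nbhs_singleton NGL : G (p.1, T p.1) = _).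
by rewrite /T /Ls /cc -surjective_pairing.
Unshelve. all: by end_near. Qed.

End Splitting.

(** * Inverse distances and positivity of the quartic coefficient *)

Section Model.
Context {R : realType}.
Implicit Types Q : normedModType R.

(* With u = tan(t/2)^2 one has root_quot D D' u = inv_dist D D' t. *)
Definition root_quot (D D' u : R) : R := Num.sqrt ((1 + u) / (D + D' * u)).

(** Both coefficients come from rationalizing. The squares of [F u] and [F 0] differ by an explicit
    multiple of u, so dividing by [F u + F 0] gives [e]; treating [e u - e 0] in the same way gives
    [d]. *)
Lemma root_quot_taylor (D D' : R) : 0 < D ->
  exists e d, [/\ taylor2 (root_quot D D') e d,
    e 0 = (D - D') / (2 * D * Num.sqrt D) &
    d 0 = - e 0 * (D + 3 * D') / (4 * D)].
Proof.
move=> D0; have D_neq0 : D != 0 by rewrite gt_eqF.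
pose F := root_quot D D'.
have F0 : F 0 = (Num.sqrt D)^-1 by rewrite /F /root_quot mulr0 !addr0 mul1r sqrtrV// ltW.
have sD : 0 < Num.sqrt D by rewrite sqrtr_gt0.
have F0_gt0 : 0 < F 0 by rewrite F0 invr_gt0.
have sid : smooth_near (0 : R) (fun u : R => u) by smooth.
have sden : smooth_near (0 : R) (fun u => (D + D' * u)^-1).
  by apply: smooth_nearV; [smooth|rewrite mulr0 addr0].
have sF : smooth_near 0 F.
  rewrite /F /root_quot; apply: smooth_near_sqrt; first by smooth.
  by rewrite mulr0 !addr0 mul1r invr_gt0.
have sw : smooth_near (0 : R) (fun u => ((D + D' * u) * (F u + F 0))^-1).
  apply: smooth_nearV; first by smooth.
  by rewrite mulr0 addr0 mulf_neq0// gt_eqF// addr_gt0.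
pose K := (D - D') / D.
pose e u := K * ((D + D' * u) * (F u + F 0))^-1.
pose d u := - K * (D' * (F u + F 0) + D * e u) * ((D + D' * u) * (F u + F 0))^-1
   * (D * (F 0 + F 0))^-1.
have se : smooth_near 0 e by rewrite /e; smooth.
have e0 : e 0 = (D - D') / (2 * D * Num.sqrt D).
  have : Num.sqrt D ^+ 2 = D by rewrite sqr_sqrtr// ltW.
  rewrite /e /K mulr0 addr0 F0; move: (Num.sqrt D) sD => x x0 xD.
  have x_neq0 : x != 0 by rewrite gt_eqF.
  by rewrite -xD; field.
have den_gt0 : \forall u \near (0 : R), 0 < D + D' * u.
  have s1 : smooth_near (0 : R) (fun u => D + D' * u) by smooth.
  by apply: (cvgr_gt _ (smooth_near_cts s1)); rewrite mulr0 addr0.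
have num_gt0 : \forall u \near (0 : R), 0 < 1 + u.
  have s1 : smooth_near (0 : R) (fun u : R => 1 + u) by smooth.
  by apply: (cvgr_gt _ (smooth_near_cts s1)); rewrite addr0.
have FE : \forall u \near (0 : R), F u = F 0 + u * e u.
  near=> u.
  have d0 : 0 < D + D' * u by near: u.
  have n0 : 0 < 1 + u by near: u.
  have Fu2 : F u ^+ 2 = (1 + u) / (D + D' * u).
    by rewrite sqr_sqrtr// divr_ge0// ltW.
  have F02 : F 0 ^+ 2 = D^-1 by rewrite F0 exprVn sqr_sqrtr// ltW.
  have Fu0 : 0 <= F u by exact: sqrtr_ge0.
  have S0 : F u + F 0 != 0 by rewrite gt_eqF// ltr_wpDl.
  apply/eqP; rewrite addrC -subr_eq; apply/eqP; apply: (mulIf S0).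
  rewrite -subr_sqr Fu2 F02 /e /K; move: (F u + F 0) S0 => S S0.
  by field; rewrite S0 D_neq0 gt_eqF.
exists e, d; split=> //; last first.
  have : F 0 ^+ 2 = D^-1 by rewrite F0 exprVn sqr_sqrtr// ltW.
  rewrite /d /e /K mulr0 addr0; move: F0_gt0; move: (F 0) => x x0 xD.
  have -> : D = (x ^+ 2)^-1 by rewrite xD invrK.
  have x_neq0 : x != 0 by rewrite gt_eqF.
  by field; rewrite x_neq0/= gt_eqF// addr_gt0.
split=> //; first by rewrite /d; smooth.
near=> u.
have d0 : 0 < D + D' * u by near: u.
have Fu0 : 0 <= F u by exact: sqrtr_ge0.
have S0 : F u + F 0 != 0 by rewrite gt_eqF// ltr_wpDl.
have FuE : F u = F 0 + u * e u by near: u.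
have d_neq0 : D + D' * u != 0 by rewrite gt_eqF.
have x_neq0 : F 0 != 0 by rewrite gt_eqF.
have uE : u * e u = F u - F 0 by rewrite FuE addrC addKr.
have -> : u * d u = - K * (D' * u * (F u + F 0) + D * (u * e u))
    * ((D + D' * u) * (F u + F 0))^-1 * (D * (F 0 + F 0))^-1 by rewrite /d; ring.
rewrite uE /e mulr0 addr0; have xx : F 0 + F 0 != 0 by rewrite gt_eqF// addr_gt0.
move: S0 xx; move: (F u) (F 0) => y x S0 xx; field.
by rewrite xx D_neq0 S0.
Unshelve. all: by end_near. Qed.

(** The law of cosines: [D] is the squared distance at t = 0, and [D'] is the one at t = pi. *)
Definition inv_dist (D D' t : R) : R :=
  (Num.sqrt ((D + D' - (D' - D) * cos t) / 2))^-1.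

(** In half angles the squared distance is D cos^2 + D' sin^2; dividing by cos^2 leaves an
    expression in the squared tangent. *)
Lemma inv_dist_tan D D' t : 0 < D -> 0 < D' -> cos (t / 2) != 0 ->
  inv_dist D D' t = root_quot D D' (tan (t / 2) ^+ 2).
Proof.
move=> D0 D'0 c0.
have tE : t = t / 2 + t / 2 by field.
have c2s2 := cos2Dsin2 (t / 2).
have csq : 0 < cos (t / 2) ^+ 2 by rewrite exprn_even_gt0.
have ssq : 0 <= sin (t / 2) ^+ 2 by exact: sqr_ge0.
have den0 : 0 < D * cos (t / 2) ^+ 2 + D' * sin (t / 2) ^+ 2.
  by apply: ltr_pwDl; [exact: mulr_gt0|rewrite mulr_ge0// ltW].
rewrite /inv_dist /root_quot /tan {1}tE cosD.
move: c0 c2s2 csq ssq den0; move: (cos _) (sin _) => c s c0 c2s2 csq ssq den0.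
have -> : (D + D' - (D' - D) * (c * c - s * s)) / 2 = D * c ^+ 2 + D' * s ^+ 2.
  by have -> : D + D' = (D + D') * (c ^+ 2 + s ^+ 2); [rewrite c2s2 mulr1|field].
rewrite -sqrtrV ?ltW//; congr Num.sqrt.
have -> : 1 + (s / c) ^+ 2 = (c ^+ 2)^-1.
    by have -> : (c ^+ 2)^-1 = (c ^+ 2 + s ^+ 2) / c ^+ 2; [rewrite c2s2 mul1r|field].
by field; rewrite c0 gt_eqF.
Qed.

(* The right-hand side is the coefficient of s^2 in the reduced energy; positivity
   amounts to w^3 + (1 - w)^3 + 2 w (1 - w) = 1 - w (1 - w) < 1. *)
Lemma quartic_gt0 (H1 H2 H3 g1 g2 g3 w : R) : w = H2 / (H1 + H2) -> 0 < H1 -> 0 < H2 ->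
  H1 * H2 + H3 * (H1 + H2) = 0 -> g1 < 1 -> g2 < 1 -> 1 < g3 ->
  0 < - (H1 * w ^+ 4 * g1) - H2 * (1 - w) ^+ 4 * g2 - 2 * H2 * (1 - w) ^+ 2 * w
      - H3 * g3.
Proof.
move=> wE H10 H20 HH g11 g21 g31.
have H0 : 0 < H1 + H2 by exact: addr_gt0.
have H_neq0 : H1 + H2 != 0 by rewrite gt_eqF.
(* At the minimizer H1 w and H2 (1 - w) agree, and degeneracy makes the common value equal to - H3.
   All terms therefore share the positive factor [h]. *)
pose h := H1 * w.
have w0 : 0 < w by rewrite wE divr_gt0.
have w1E : 1 - w = H1 / (H1 + H2) by rewrite wE; field.
have w1 : 0 < 1 - w by rewrite w1E divr_gt0.
have h0 : 0 < h by rewrite mulr_gt0.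
have h2 : H2 * (1 - w) = h by rewrite w1E /h wE; field.
have h3 : H3 = - h.
  by apply: (mulIf H_neq0); rewrite /h wE mulrA mulNr divfK//; lra.
have -> : - (H1 * w ^+ 4 * g1) - H2 * (1 - w) ^+ 4 * g2 - 2 * H2 * (1 - w) ^+ 2 * w
      - H3 * g3
  = h * (w ^+ 3 * (1 - g1) + (1 - w) ^+ 3 * (1 - g2) + (g3 - 1) + w * (1 - w)).
  have -> : H2 * (1 - w) ^+ 4 * g2 = (H2 * (1 - w)) * (1 - w) ^+ 3 * g2 by ring.
  have -> : 2 * H2 * (1 - w) ^+ 2 * w = 2 * (H2 * (1 - w)) * (1 - w) * w by ring.
  by rewrite h2 h3 /h; ring.
have p1 : 0 < w ^+ 3 * (1 - g1) by rewrite mulr_gt0 ?exprn_gt0// subr_gt0.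
have p2 : 0 < (1 - w) ^+ 3 * (1 - g2) by rewrite mulr_gt0 ?exprn_gt0// subr_gt0.
have p3 : 0 < w * (1 - w) by rewrite mulr_gt0.
by rewrite mulr_gt0//; lra.
Qed.

End Model.

(** * Normal form for a sum of three inverse distances *)

Section PitchforkModel.
Context {R : realType}.
Implicit Types Q : normedModType R.

Lemma smooth_near_trig (t : R) : smooth_near t (@sin R) /\ smooth_near t (@cos R).
Proof.
have [bs bc] := @bsmooth_sincos R.
by split; [apply: bsmooth_near bs|apply: bsmooth_near bc] => //; exact: openT.
Qed.

Definition htan (t : R) : R := tan (t / 2).

Lemma htan0 : htan 0 = 0. Proof. by rewrite /htan mul0r tan0. Qed.

Lemma smooth_near_htan : smooth_near 0 htan.
Proof.
rewrite /htan /tan; have sh : smooth_near (0 : R) (fun t : R => t / 2) by smooth.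
have [ss sc] := smooth_near_trig (0 / 2).
have ss2 := smooth_near_comp sh ss; have sc2 := smooth_near_comp sh sc.
apply: smooth_nearM => //; apply: smooth_nearV => //.
by rewrite mul0r cos0 oner_neq0.
Qed.

Lemma htan_quot : exists2 k : R -> R, smooth_near 0 k &
  0 < k 0 /\ forall t, htan t = t * k t.
Proof.
exists (fun t => dquot htan (0, 1, t)).
  apply: (smooth_near_comp (f := fun t : R => (0 : R, 1 : R, t))); first by smooth.
  exact: smooth_near_dquot smooth_near_htan.
split=> [|t]; last first.
  rewrite -[RHS]/(t *: _) -dquotE htan0 subr0 add0r; congr htan.
  by rewrite /GRing.scale/= mulr1.
rewrite /dquot/= eqxx.
have D2 : is_derive (0 : R) 1 (fun t : R => t / 2) (1 / 2).
  by apply: is_derive_eq; rewrite /GRing.scale/=; ring.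
have c0 : cos ((0 : R) / 2) != 0 by rewrite mul0r cos0 oner_neq0.
have := @is_derive1_comp _ tan (fun t : R => t / 2) 0 _ _ (is_derive_tan c0) D2.
move=> D; have -> : 'D_1 htan 0 = (cos (0 / 2) ^- 2 * (1 / 2)) by exact: derive_val.
by rewrite mul0r cos0 expr1n invr1 mul1r.
Qed.

Lemma htan_sub (s t : R) : cos (s / 2) != 0 -> cos (t / 2) != 0 ->
  cos ((s - t) / 2) != 0 ->
  htan (s - t) = (htan s - htan t) / (1 + htan s * htan t).
Proof.
move=> cs ct; rewrite /htan mulrBl /tan sinB cosB.
move: cs ct; move: (cos _) (sin _) (cos _) (sin _) => a b c d a0 c0 e0.
by field; rewrite a0 c0.
Qed.

Lemma ddiff_origin (V : normedModType R) (F : V * R -> R) (x : V) (B : R -> R) :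
  smooth_near (x, 0) F -> smooth_near 0 B -> (forall t, F (x, t) = t * B t) ->
  ddiff F (x, 0, 0) = B 0.
Proof.
move=> /smooth_near_ddiff sF /smooth_near_cts cB FB.
apply: (@cts_eq _ (fun t => ddiff F (x, 0, t))) => //.
  apply: smooth_near_cts.
  by apply: (smooth_near_comp (f := fun t : R => (x, 0 : R, t))) => //; smooth.
near=> t => t0; apply: (mulfI t0).
by have := ddiffE F x 0 t; rewrite !FB mul0r !subr0 => <-.
Unshelve. all: by end_near. Qed.

(* Twice the second derivative of inv_dist D D' at 0. *)
Definition stiffness (D D' : R) : R := (D - D') / (2 * D * Num.sqrt D).

(** The conditions on [D] and [D'] say that the first two pairs lie on opposite rays and the third
    pair on one ray, the third angle varying by the sum of the other two increments. Only these
    numbers and the smooth coefficients are left of the geometry. *)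
Lemma pitchfork_model Q (q0 v : Q) (a : R) (c1 c2 c3 : Q -> R)
    (D1 D1' D2 D2' D3 D3' : R) :
  0 < D1' < D1 -> 0 < D2' < D2 -> 0 < D3 < D3' ->
  smooth_near q0 c1 -> smooth_near q0 c2 -> smooth_near q0 c3 ->
  0 < c1 q0 -> 0 < c2 q0 ->
  let H1 := c1 q0 * stiffness D1 D1' in let H2 := c2 q0 * stiffness D2 D2' in
  let H3 := c3 q0 * stiffness D3 D3' in
  H1 * H2 + H3 * (H1 + H2) = 0 ->
  a != 0 ->
  (\forall t \near (0 : R), [/\ c1 (q0 + t *: v) = (1 + a * t) * c1 q0,
     c2 (q0 + t *: v) = (1 + a * t) * c2 q0 & c3 (q0 + t *: v) = c3 q0]) ->
  exists (c l : Q -> R) (phi : Q * (R * R) -> R * R),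
  [/\ smooth_near q0 c, smooth_near q0 l, l q0 = 0 /\ 'D_v l q0 != 0,
      diffeo_family q0 phi &
      \forall p \near (q0, 0 : R * R),
        c1 p.1 * inv_dist D1 D1' p.2.1 + c2 p.1 * inv_dist D2 D2' p.2.2
          + c3 p.1 * inv_dist D3 D3' (p.2.1 + p.2.2)
        = c p.1 + (phi p).1 ^+ 4 / 4 - l p.1 * ((phi p).1 ^+ 2 / 2)
          + (phi p).2 ^+ 2].
Proof.
move=> /andP[D1'0 D11] /andP[D2'0 D22] /andP[D30 D33] sc1 sc2 sc3 c10 c20 H1 H2 H3 HH a0 cv.
have D10 := lt_trans D1'0 D11; have D20 := lt_trans D2'0 D22.
have D3'0 := lt_trans D30 D33.
have [e1 [d1 [tF1 e10 d10]]] := root_quot_taylor D1' D10.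
have [e2 [d2 [tF2 e20 d20]]] := root_quot_taylor D2' D20.
have [e3 [d3 [tF3 e30 d30]]] := root_quot_taylor D3' D30.
have st D D' : 0 < D -> D' < D -> 0 < stiffness D D'.
  move=> D0 DD; rewrite /stiffness divr_gt0 ?subr_gt0// !mulr_gt0//.
  by rewrite sqrtr_gt0.
have H10 : 0 < H1 by rewrite mulr_gt0// st.
have H20 : 0 < H2 by rewrite mulr_gt0// st.
have kap : 0 < c1 q0 * (H2 / (H1 + H2)) ^+ 4 * d1 0
      + c2 q0 * ((1 - H2 / (H1 + H2)) ^+ 4 * d2 0
                 - 2 * (1 - H2 / (H1 + H2)) ^+ 2 * (H2 / (H1 + H2)) * e2 0)
      + c3 q0 * d3 0.
  (* The three ratios are the values of - d 0 / e 0. Such a ratio is below 1 exactly when D' < D,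
     hence for the opposite pairs, and above 1 for the pair on one ray. *)
  have := @quartic_gt0 _ H1 H2 H3 ((D1 + 3 * D1') / (4 * D1))
    ((D2 + 3 * D2') / (4 * D2)) ((D3 + 3 * D3') / (4 * D3)) _ erefl H10 H20 HH.
  rewrite !ltr_pdivrMr ?ltr_pdivlMr ?mulr_gt0//.
  have -> : D1 + 3 * D1' < 1 * (4 * D1) by lra.
  have -> : D2 + 3 * D2' < 1 * (4 * D2) by lra.
  have -> : 1 * (4 * D3) < D3 + 3 * D3' by lra.
  move=> /(_ isT isT isT); rewrite d10 d20 d30 e10 e20 e30.
  rewrite -!/(stiffness _ _) /H1 /H2 /H3.
  by congr (0 < _); ring.
have := @even_splitting _ _ q0 v a _ _ _ _ _ _ _ _ _ _ _ _ sc1 sc2 sc3 tF1 tF2 tF3.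
have He1 : c1 q0 * e1 0 = H1 by rewrite e10.
have He2 : c2 q0 * e2 0 = H2 by rewrite e20.
have He3 : c3 q0 * e3 0 = H3 by rewrite e30.
cbv zeta; rewrite He1 He2 He3 => /(_ H10 H20 HH kap a0 cv).
move=> [L [C [K [T [M [[sL cC C0 LC] [K0 LK] [sT T0] [sM M0] main]]]]]].
have [l [psi [sl [l0 dl] spsi psi0 unf]]] := pitchfork_unfolding sL cC C0 LC K0 LK.
have T00 : T (q0, 0) = 0 by exact: nbhs_singleton T0.
have sth := smooth_near_htan.
have [k sk [k0 kE]] := htan_quot.
(* The square of [yF] is the term split off from the energy, and the square of [xF] is s times [psi]
   with s the squared tangent of the half sum. *)
pose yF (p : Q * R * R) := (htan p.2 - T (p.1.1, htan p.1.2))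
  * Num.sqrt (M (p.1.1, htan p.1.2, htan p.2)).
pose xF (p : Q * R * R) := htan p.2 * Num.sqrt (psi (p.1.1, htan p.2 ^+ 2)).
have sh1 : smooth_near (q0, 0 : R, 0 : R) (fun p : Q * R * R => htan p.1.2).
  by apply: (smooth_near_comp (f := fun p : Q * R * R => p.1.2) (g := htan)); first by smooth.
have sh2 : smooth_near (q0, 0 : R, 0 : R) (fun p : Q * R * R => htan p.2).
  by apply: (smooth_near_comp (f := fun p : Q * R * R => p.2) (g := htan)); first by smooth.
have syF : smooth_near (q0, 0, 0) yF.
  have s1 : smooth_near (q0, 0 : R, 0 : R) (fun p : Q * R * R => T (p.1.1, htan p.1.2)).
    apply: (smooth_near_comp (f := fun p : Q * R * R => (p.1.1, htan p.1.2)) (g := T)); first by smooth.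
    by rewrite /= htan0.
  have s2 : smooth_near (q0, 0 : R, 0 : R)
      (fun p : Q * R * R => M (p.1.1, htan p.1.2, htan p.2)).
    apply: (smooth_near_comp (f := fun p : Q * R * R => (p.1.1, htan p.1.2, htan p.2)) (g := M)).
      by smooth.
    by rewrite /= htan0.
  apply: smooth_nearM; first by smooth.
  by apply: smooth_near_sqrt => //; rewrite /= htan0.
have sxF : smooth_near (q0, 0, 0) xF.
  have s2 : smooth_near (q0, 0 : R, 0 : R)
      (fun p : Q * R * R => psi (p.1.1, htan p.2 ^+ 2)).
    apply: (smooth_near_comp (f := fun p : Q * R * R => (p.1.1, htan p.2 ^+ 2)) (g := psi)).
      by smooth.
    by rewrite /= htan0 expr0n.
  apply: smooth_nearM; first by smooth.
  by apply: smooth_near_sqrt => //; rewrite /= htan0 expr0n.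
have dyF : 0 < ddiff yF (q0, 0, 0, 0).
  rewrite (@ddiff_origin _ _ _ (fun t => k t * Num.sqrt (M (q0, 0, htan t)))) => //.
  - by rewrite htan0 mulr_gt0// sqrtr_gt0.
  - apply: smooth_nearM => //; apply: smooth_near_sqrt; last by rewrite htan0.
    apply: (smooth_near_comp (f := fun t : R => (q0, 0 : R, htan t)) (g := M)); first by smooth.
    by rewrite htan0.
  - by move=> t; rewrite /yF/= htan0 T00 subr0 kE mulrA.
have dxF : 0 < ddiff xF (q0, 0, 0, 0).
  rewrite (@ddiff_origin _ _ _ (fun t => k t * Num.sqrt (psi (q0, htan t ^+ 2)))) => //.
  - by rewrite htan0 expr0n mulr_gt0// sqrtr_gt0.
  - apply: smooth_nearM => //; apply: smooth_near_sqrt; last by rewrite htan0 expr0n.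
    apply: (smooth_near_comp (f := fun t : R => (q0, htan t ^+ 2)) (g := psi)); first by smooth.
    by rewrite htan0 expr0n.
  - by move=> t; rewrite /xF/= {1}kE mulrA.
have lin_lc : lincont (fun b : R * R => (b.1 + b.2, b.1)).
  split=> [t [x1 x2] [y1 y2]|]; first by congr pair; rewrite /= scalerDr addrACA.
  by move=> p; apply: (@bgn_cts _ 0 _ _ setT) => //; do ![apply: bgn_pair|apply: bgnD|apply: bgn_fst|apply: bgn_snd]; exact: bgn_id.
have lin_lc' : lincont (fun b : R * R => (b.2, b.1 - b.2)).
  split=> [t [x1 x2] [y1 y2]|]; first by congr pair; rewrite /= scalerBr opprD addrACA.
  by move=> p; apply: (@bgn_cts _ 0 _ _ setT) => //; do ![apply: bgn_pair|apply: bgnB|apply: bgn_fst|apply: bgn_snd]; exact: bgn_id.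
have sw_lc : lincont (fun b : R * R => (b.2, b.1)).
  split=> [t [x1 x2] [y1 y2]//|].
  by move=> p; apply: (@bgn_cts _ 0 _ _ setT) => //; do ![apply: bgn_pair|apply: bgn_fst|apply: bgn_snd]; exact: bgn_id.
have Dlin : diffeo_family q0 (fun p : Q * (R * R) => (p.2.1 + p.2.2, p.2.1)).
  apply: (diffeo_family_lin q0 lin_lc lin_lc') => -[x y] /=.
    by rewrite addrC addKr.
  by rewrite subrKC.
have Dsw : diffeo_family q0 (fun p : Q * (R * R) => (p.2.2, p.2.1)).
  by apply: (diffeo_family_lin q0 sw_lc sw_lc) => -[x y].
have Dy : diffeo_family q0 (fun p : Q * (R * R) => (p.2.1, yF (p.1, p.2.1, p.2.2))).
  apply: diffeo_family_graph => //; apply: filterS T0 => q Tq.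
  by rewrite /yF/= htan0 Tq subrr mul0r.
have Dx : diffeo_family q0 (fun p : Q * (R * R) => (p.2.1, xF (p.1, p.2.1, p.2.2))).
  apply: diffeo_family_graph => //; near=> q.
  by rewrite /xF/= htan0 mul0r.
(* The factors, in order: pass to (sum, first angle); replace the first angle by y; swap; replace
   the sum by x; swap again to obtain (x, y). Each replacement acts on the last variable, as the
   graph lemma requires. *)
have Dphi := diffeo_family_comp (diffeo_family_comp (diffeo_family_comp
  (diffeo_family_comp Dlin Dy) Dsw) Dx) Dsw.
pose phi (p : Q * (R * R)) := (xF (p.1, yF (p.1, p.2.1 + p.2.2, p.2.1), p.2.1 + p.2.2),
  yF (p.1, p.2.1 + p.2.2, p.2.1)).
exists (fun q => c1 q * root_quot D1 D1' 0 + c2 q * root_quot D2 D2' 0 + c3 q * root_quot D3 D3' 0), l, phi.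
split; [by smooth|exact: sl|by split|exact: Dphi|].
have sB : smooth_near (q0, 0 : R * R) (fun p : Q * (R * R) => htan p.2.1).
  by apply: (smooth_near_comp (f := fun p : Q * (R * R) => p.2.1) (g := htan)); first by smooth.
have sA : smooth_near (q0, 0 : R * R) (fun p : Q * (R * R) => htan (p.2.1 + p.2.2)).
  apply: (smooth_near_comp (f := fun p : Q * (R * R) => p.2.1 + p.2.2) (g := htan)); first by smooth.
  by rewrite /= addr0.
have pm : smooth_near (q0, 0 : R * R) (fun p : Q * (R * R) =>
  (p.1, htan (p.2.1 + p.2.2), htan p.2.1)) by smooth.
have pu : smooth_near (q0, 0 : R * R) (fun p : Q * (R * R) =>
  (p.1, htan (p.2.1 + p.2.2) ^+ 2)) by smooth.
have m1 := near_pull (P := fun p : Q * R * R =>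
        c1 p.1.1 * root_quot D1 D1' (p.2 ^+ 2)
          + c2 p.1.1 * root_quot D2 D2' (((p.1.2 - p.2) / (1 + p.1.2 * p.2)) ^+ 2)
          + c3 p.1.1 * root_quot D3 D3' (p.1.2 ^+ 2)
        = c1 p.1.1 * root_quot D1 D1' 0 + c2 p.1.1 * root_quot D2 D2' 0
          + c3 p.1.1 * root_quot D3 D3' 0
          + p.1.2 ^+ 2 * L (p.1.1, p.1.2 ^+ 2) + (p.2 - T (p.1.1, p.1.2)) ^+ 2 * M p) pm.
have m2 := near_pull (P := fun p : Q * R =>
   p.2 * L p = (p.2 * psi p) ^+ 2 / 4 - l p.1 * (p.2 * psi p) / 2) pu.
have Mpos : \forall p \near (q0, 0 : R, 0 : R), 0 < M p by exact: (cvgr_gt _ (smooth_near_cts sM)).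
have ppos : \forall p \near (q0, 0 : R), 0 < psi p by exact: (cvgr_gt _ (smooth_near_cts spsi)).
have m3 := near_pull (P := fun p => 0 < M p) pm.
have m4 := near_pull (P := fun p => 0 < psi p) pu.
move: m1 m2 m3 m4; rewrite /= addr0 htan0 expr0n/=.
move=> /(_ main) m1 /(_ unf) m2 /(_ Mpos) m3 /(_ ppos) m4.
have cosn (f : Q * (R * R) -> R) : smooth_near (q0, 0 : R * R) f -> f (q0, 0) = 0 ->
    \forall p \near (q0, 0 : R * R), 0 < cos (f p / 2).
  move=> sf f0; have sf2 : smooth_near (q0, 0 : R * R) (fun p => f p / 2) by smooth.
  have sc := smooth_near_comp sf2 (smooth_near_trig _).2.
  by apply: (cvgr_gt _ (smooth_near_cts sc)); rewrite f0 mul0r cos0 ltr01.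
have n1 : \forall p \near (q0, 0 : R * R), 0 < cos ((p.2.1 + p.2.2) / 2).
  by apply: (cosn (fun p => p.2.1 + p.2.2)); [smooth|rewrite /= addr0].
have n2 : \forall p \near (q0, 0 : R * R), 0 < cos (p.2.1 / 2).
  by apply: (cosn (fun p => p.2.1)); [smooth|].
have n3 : \forall p \near (q0, 0 : R * R), 0 < cos (p.2.2 / 2).
  by apply: (cosn (fun p => p.2.2)); [smooth|].
near=> p.
have k1 : cos ((p.2.1 + p.2.2) / 2) != 0 by rewrite gt_eqF//; near: p.
have k2 : cos (p.2.1 / 2) != 0 by rewrite gt_eqF//; near: p.
have k3 : cos (p.2.2 / 2) != 0 by rewrite gt_eqF//; near: p.
rewrite !inv_dist_tan// -!/(htan _).
have {1}-> : p.2.2 = (p.2.1 + p.2.2) - p.2.1 by rewrite addrC addKr.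
rewrite htan_sub//; last by rewrite addrC addKr.
have Mp : 0 < M (p.1, htan (p.2.1 + p.2.2), htan p.2.1) by near: p.
have Pp : 0 < psi (p.1, htan (p.2.1 + p.2.2) ^+ 2) by near: p.
have u2 : htan (p.2.1 + p.2.2) ^+ 2 * L (p.1, htan (p.2.1 + p.2.2) ^+ 2) = (htan (p.2.1 + p.2.2) ^+ 2 * psi (p.1, htan (p.2.1 + p.2.2) ^+ 2)) ^+ 2 / 4
    - l p.1 * (htan (p.2.1 + p.2.2) ^+ 2 * psi (p.1, htan (p.2.1 + p.2.2) ^+ 2)) / 2 by near: p.
have u1 : c1 p.1 * root_quot D1 D1' (htan p.2.1 ^+ 2)
          + c2 p.1 * root_quot D2 D2' (((htan (p.2.1 + p.2.2) - htan p.2.1) / (1 + (htan (p.2.1 + p.2.2)) * htan p.2.1)) ^+ 2)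
          + c3 p.1 * root_quot D3 D3' (htan (p.2.1 + p.2.2) ^+ 2)
        = c1 p.1 * root_quot D1 D1' 0 + c2 p.1 * root_quot D2 D2' 0
          + c3 p.1 * root_quot D3 D3' 0
          + htan (p.2.1 + p.2.2) ^+ 2 * L (p.1, htan (p.2.1 + p.2.2) ^+ 2) + (htan p.2.1 - T (p.1, htan (p.2.1 + p.2.2))) ^+ 2 * M (p.1, htan (p.2.1 + p.2.2), htan p.2.1) by near: p.
set X := htan (p.2.1 + p.2.2) in u1 u2 Mp Pp *; set t := htan p.2.1 in u1 u2 Mp Pp *.
have x2 : (phi p).1 ^+ 2 = X ^+ 2 * psi (p.1, X ^+ 2).
  by rewrite /phi /xF/= exprMn sqr_sqrtr// ltW.
have y2 : (phi p).2 ^+ 2 = (t - T (p.1, X)) ^+ 2 * M (p.1, X, t).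
  by rewrite /phi /yF/= exprMn sqr_sqrtr// ltW.
have x4 : (phi p).1 ^+ 4 = (X ^+ 2 * psi (p.1, X ^+ 2)) ^+ 2 by rewrite -x2; ring.
by rewrite u1 u2 x2 x4 y2; ring.
Unshelve. all: by end_near. Qed.

End PitchforkModel.

(** * Configurations *)

Section Geometry.
Local Notation rot := Defs.rot.
Context {R : realType}.
Implicit Types (u v : 'rV[R]_2) (A B : 'M[R]_2) (s t : R).

Lemma enorm_ge0 u : 0 <= enorm u.
Proof. exact: sqrtr_ge0. Qed.

Lemma enorm_sqr u : enorm u ^+ 2 = u 0 0 ^+ 2 + u 0 1 ^+ 2.
Proof.
rewrite /enorm sqr_sqrtr ?sumr_ge0// => [|i _]; last exact: sqr_ge0.
by rewrite !big_ord_recl big_ord0 addr0; congr (_ + u 0 _ ^+ 2); exact/val_inj.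
Qed.

Lemma enormZ t u : enorm (t *: u) = `|t| * enorm u.
Proof.
apply/eqP; rewrite -(@eqrXn2 _ 2) ?mulr_ge0 ?enorm_ge0//.
by rewrite exprMn !enorm_sqr !mxE real_normK ?num_real//; apply/eqP; ring.
Qed.

Lemma enorm_eq0 u : (enorm u == 0) = (u == 0).
Proof.
apply/eqP/eqP => [u0|->]; last first.
  by apply/eqP; rewrite -sqrf_eq0 enorm_sqr !mxE expr0n addr0.
have := enorm_sqr u; rewrite u0 expr0n/= => /esym/eqP.
rewrite paddr_eq0 ?sqr_ge0// !sqrf_eq0 => /andP[/eqP u00 /eqP u01].
apply/rowP => i; rewrite mxE; case: i => [[|[|i]]//= ?].
  by rewrite -[RHS]u00; congr (u 0 _); exact/val_inj.
by rewrite -[RHS]u01; congr (u 0 _); exact/val_inj.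
Qed.

Lemma rv2P u v : u 0 0 = v 0 0 -> u 0 1 = v 0 1 -> u = v.
Proof.
move=> h0 h1; apply/rowP => -[[|[|i]]//= Hi].
  by rewrite (_ : Ordinal Hi = 0)//; exact/val_inj.
by rewrite (_ : Ordinal Hi = 1)//; exact/val_inj.
Qed.

Lemma mulmx2E u A j : (u *m A) 0 j = u 0 0 * A 0 j + u 0 1 * A 1 j.
Proof.
rewrite mxE !big_ord_recl big_ord0 addr0; congr (_ + u 0 _ * A _ _); exact/val_inj.
Qed.

Lemma mul_rotE u t :
  prod ((u *m rot t) 0 0 = u 0 0 * cos t - u 0 1 * sin t)
       ((u *m rot t) 0 1 = u 0 0 * sin t + u 0 1 * cos t).
Proof. by split; rewrite mulmx2E !mxE/= ?mulrN. Qed.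

Lemma mul_rotD u s t : u *m rot s *m rot t = u *m rot (s + t).
Proof. by apply: rv2P; rewrite !mul_rotE cosD sinD; ring. Qed.

Lemma mul_rot0 u : u *m rot 0 = u.
Proof. by apply: rv2P; rewrite !mul_rotE cos0 sin0; ring. Qed.

Lemma det2E A : \det A = A 0 0 * A 1 1 - A 0 1 * A 1 0.
Proof.
rewrite (expand_det_row _ 0) !big_ord_recl big_ord0 addr0 /cofactor !det_mx11 !mxE/=.
rewrite expr0 expr1 mul1r mulN1r mulrN.
by congr (_ * A _ _ - A _ _ * A _ _); exact/val_inj.
Qed.

Lemma SO2_entries A : SO2 A -> A 1 0 = - A 0 1 /\ A 1 1 = A 0 0.
Proof.
move=> [AA dA].
have d : A 0 0 * A 1 1 - A 0 1 * A 1 0 = 1 by rewrite -dA det2E.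
have AAij i j : A i 0 * A j 0 + A i 1 * A j 1 = (i == j)%:R.
  have := congr1 (fun M : 'M[R]_2 => M i j) AA; rewrite !mxE => <-.
  rewrite !big_ord_recl big_ord0 addr0 !mxE.
  by congr (_ + A _ _ * A _ _); exact/val_inj.
have := AAij 0 0; have := AAij 1 1; rewrite !eqxx => n1 n0.
(* For rows of unit length and determinant 1 this sum of squares is 1 + 1 - 2, which forces both
   entry relations at once. *)
have S : (A 1 0 + A 0 1) ^+ 2 + (A 1 1 - A 0 0) ^+ 2 = 0.
  transitivity ((A 0 0 * A 0 0 + A 0 1 * A 0 1) + (A 1 0 * A 1 0 + A 1 1 * A 1 1)
    - 2 * (A 0 0 * A 1 1 - A 0 1 * A 1 0)); first by ring.
  by rewrite n0 n1 d /= !mulr1n; ring.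
move/eqP: S; rewrite paddr_eq0 ?sqr_ge0// !sqrf_eq0 addr_eq0 subr_eq0.
by move=> /andP[/eqP -> /eqP ->].
Qed.

Lemma SO2_rotC u A t : SO2 A -> u *m A *m rot t = u *m rot t *m A.
Proof.
move=> /SO2_entries[h1 h2]; apply: rv2P;
  by rewrite !mulmx2E h1 h2 ![Defs.rot _ _ _]mxE /=; ring.
Qed.

Lemma oriented_angle_SO2 u v A t : SO2 A ->
  oriented_angle (u *m A) (v *m A) t <-> oriented_angle u v t.
Proof.
move=> sA; rewrite /oriented_angle !enorm_SO2// SO2_rotC// !scalemxAl.
split=> [E|->//]; case: sA => AA _.
by have := congr1 (mulmx^~ A^T) E; rewrite /= -!mulmxA AA !mulmx1.
Qed.

Lemma SO2_transitive u v : enorm u = enorm v -> u != 0 ->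
  exists A, SO2 A /\ v = u *m A.
Proof.
move=> uv u0; set n := enorm u; have n0 : n != 0 by rewrite enorm_eq0.
(* In complex notation c + i d is conj(u) v / |u|^2, the unit number that multiplies u to v. *)
pose c := (u 0 0 * v 0 0 + u 0 1 * v 0 1) / n ^+ 2.
pose d := (u 0 0 * v 0 1 - u 0 1 * v 0 0) / n ^+ 2.
pose A : 'M[R]_2 := \matrix_(i < 2, j < 2)
    if i == j then c else if (i < j)%N then d else - d.
have nu : n ^+ 2 = u 0 0 ^+ 2 + u 0 1 ^+ 2 by exact: enorm_sqr.
have nv : n ^+ 2 = v 0 0 ^+ 2 + v 0 1 ^+ 2 by rewrite /n uv; exact: enorm_sqr.
have n20 : n ^+ 2 != 0 by rewrite sqrf_eq0.
have cd : c ^+ 2 + d ^+ 2 = 1.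
  rewrite /c /d; transitivity ((u 0 0 ^+ 2 + u 0 1 ^+ 2) * (v 0 0 ^+ 2 + v 0 1 ^+ 2) / (n ^+ 2) ^+ 2).
    by field.
  by rewrite -nu -nv; field.
exists A; split; last first.
  apply: rv2P; rewrite mulmx2E !mxE/= /c /d.
    transitivity ((u 0 0 ^+ 2 + u 0 1 ^+ 2) * v 0 0 / n ^+ 2); last by field.
    by rewrite -nu mulrAC mulfV// mul1r.
  transitivity ((u 0 0 ^+ 2 + u 0 1 ^+ 2) * v 0 1 / n ^+ 2); last by field.
  by rewrite -nu mulrAC mulfV// mul1r.
split; last by rewrite det2E !mxE/= -cd; ring.
apply/matrixP => i j; rewrite !mxE !big_ord_recl big_ord0 !mxE /= addr0.
by case: i => [[|[|i]]//= ?]; case: j => [[|[|j]]//= ?];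
  rewrite /= ?mulr1n ?mulr0n; move: cd; rewrite !expr2; lra.
Qed.

Lemma enorm_law_of_cosines u t s k :
  enorm (u *m rot t - k *: (u *m rot s)) ^+ 2
    = enorm u ^+ 2 * (1 + k ^+ 2 - 2 * k * cos (s - t)).
Proof.
have Ht := cos2Dsin2 t; have Hs := cos2Dsin2 s.
have E (w z : 'rV[R]_2) j : (w - k *: z) 0 j = w 0 j - k * z 0 j by rewrite !mxE.
rewrite !enorm_sqr !E !mul_rotE cosB.
have -> : 1 + k ^+ 2 = (cos t ^+ 2 + sin t ^+ 2) + k ^+ 2 * (cos s ^+ 2 + sin s ^+ 2).
  by rewrite Ht Hs mulr1.
by ring.
Qed.

Lemma oriented_angle_dist u v a t s : u != 0 -> oriented_angle u v a ->
  enorm (u *m rot t - v *m rot s) ^+ 2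
    = enorm u ^+ 2 + enorm v ^+ 2 - 2 * enorm u * enorm v * cos (a + s - t).
Proof.
move=> u0 uv; have n0 : enorm u != 0 by rewrite enorm_eq0.
have vE : v = (enorm v / enorm u) *: (u *m rot a).
  apply: (scalerI n0); rewrite scalerA mulrC divfK//.
have -> : v *m rot s = (enorm v / enorm u) *: (u *m rot (a + s)).
  by rewrite {1}vE -scalemxAl mul_rotD.
by rewrite enorm_law_of_cosines; field.
Qed.

End Geometry.

(** * Configurations modulo rotation *)

Section Configurations.
Local Open Scope quotient_scope.
Local Notation rot := Defs.rot.
Context {R : realType} (r : 'I_3 -> R) (r_gt0 : forall i, 0 < r i).
Implicit Types (P : confspace r) (i : 'I_3).

Lemma ord3P (S : 'I_3 -> Prop) : S 0 -> S 1 -> S 2 -> forall i, S i.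
Proof.
move=> S0 S1 S2 [[|[|[|i]]]//= Hi].
- by rewrite (_ : Ordinal Hi = 0)//; exact/val_inj.
- by rewrite (_ : Ordinal Hi = 1)//; exact/val_inj.
- by rewrite (_ : Ordinal Hi = 2)//; exact/val_inj.
Qed.

Lemma ord3E : [/\ (0 : 'I_3) + 1 = 1, (0 : 'I_3) + 2 = 2 & (1 : 'I_3) + 1 = 2] /\
  [/\ (1 : 'I_3) + 2 = 0, (2 : 'I_3) + 1 = 0 & (2 : 'I_3) + 2 = 1].
Proof. by split; split; exact/val_inj. Qed.

Lemma sum3 (F : 'I_3 -> R) : \sum_(i < 3) F i = F 0 + F 1 + F 2.
Proof.
rewrite !big_ord_recl big_ord0 addr0 addrA.
by congr (F _ + F _ + F _); exact/val_inj.
Qed.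

Lemma enorm_points P i : enorm (row i (points P)) = r i.
Proof. by have /forallP/(_ i)/eqP := valP (repr P). Qed.

Lemma row_points_neq0 P i : row i (points P) != 0.
Proof. by rewrite -enorm_eq0 enorm_points gt_eqF. Qed.

Lemma points_pi (z : triple r) :
  exists A, SO2 A /\ points (\pi_(confspace r) z) = val z *m A.
Proof.
have : rot_equiv r z (repr (\pi_(confspace r) z)) by apply/eqmodP; rewrite reprK.
by move=> /asboolP[A [sA E]]; exists A.
Qed.

Lemma confspace_eq P P' A : SO2 A -> points P' = points P *m A -> P = P'.
Proof.
move=> sA E; rewrite -[P]reprK -[P']reprK; apply/eqmodP.
by apply/asboolP; exists A.
Qed.

(** [points] picks some representative of a class, so the rotated triple is recovered only up to a
    common rotation [A]; it drops out of all distances. *)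
Lemma chart_rows P (a : 'rV[R]_2) : exists A, SO2 A /\
  forall i, row i (points (chart P a)) =
    row i (points P) *m rot (tnth [tuple a 0 1; - a 0 0; 0] i) *m A.
Proof.
have [A [sA E]] := points_pi
  (Sub (turn (tnth [tuple a 0 1; - a 0 0; 0]) (points P))
         (turn_on_circles _ (valP (repr P))) : triple r).
by exists A; split=> // i; rewrite E row_mul rowK.
Qed.

Lemma chart0 P : chart P 0 = P.
Proof.
have [A [sA E]] := chart_rows P 0.
apply/esym/(confspace_eq sA); apply/row_matrixP => i.
rewrite E row_mul; congr (_ *m _); move: i.
by apply: ord3P; rewrite (tnth_nth 0)/= ?mxE ?oppr0 mul_rot0.
Qed.

Lemma dist_chart P (a : 'rV[R]_2) i al :
  oriented_angle (row (i + 1) (points P)) (row (i + 2) (points P)) al ->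
  let t := tnth [tuple a 0 1; - a 0 0; 0] in
  dist (chart P a) i = Num.sqrt (r (i + 1) ^+ 2 + r (i + 2) ^+ 2
    - 2 * r (i + 1) * r (i + 2) * cos (al + t (i + 2) - t (i + 1))).
Proof.
move=> oa t; have [A [sA E]] := chart_rows P a.
rewrite /dist !E -mulmxBl enorm_SO2//.
rewrite -[LHS](ger0_norm (enorm_ge0 _)) -sqrtr_sqr.
by rewrite (oriented_angle_dist _ _ (row_points_neq0 _ _) oa) !enorm_points.
Qed.

(* Squared distance of p_(i+1) and p_(i+2) when they lie on the same ray (s = 1)
   or on opposite rays (s = -1). *)
Definition collinear_sq (s : R) i := (r (i + 1) - s * r (i + 2)) ^+ 2.

(** With vanishing sine, cos (alpha_i + x) is [s i] times cos x: the increment 0 gives the squared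
    distance with sign [s i], and pi the one with the opposite sign. The third angle changes by
    minus the sum, which cosine does not see. *)
Lemma energy_chart P (al : R * R * R) q (a : 'rV[R]_2) (s : 'I_3 -> R) :
  has_angles P al ->
  (forall i, sin (tnth [tuple al.1.1; al.1.2; al.2] i) = 0) ->
  (forall i, cos (tnth [tuple al.1.1; al.1.2; al.2] i) = s i) ->
  energy q (chart P a) =
    q 0 1 * q 0 2 * inv_dist (collinear_sq (s 0) 0) (collinear_sq (- s 0) 0) (a 0 0)
    + q 0 2 * q 0 0 * inv_dist (collinear_sq (s 1) 1) (collinear_sq (- s 1) 1) (a 0 1)
    + q 0 0 * q 0 1 * inv_dist (collinear_sq (s 2) 2) (collinear_sq (- s 2) 2) (a 0 0 + a 0 1).
Proof.
move=> ha sin0 coss; rewrite /energy sum3.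
have [[e1 e2 e3] [e4 e5 e6]] := ord3E.
have s2 i : s i ^+ 2 = 1 by rewrite -coss -(cos2Dsin2 (tnth [tuple al.1.1; al.1.2; al.2] i)) sin0 expr0n addr0.
have H i x y : cos (tnth [tuple al.1.1; al.1.2; al.2] i + x - y) = s i * cos (x - y).
  by rewrite -addrA [LHS]cosD coss sin0 mul0r subr0.
have E i t : (Num.sqrt (r (i + 1) ^+ 2 + r (i + 2) ^+ 2
    - 2 * r (i + 1) * r (i + 2) * (s i * cos t)))^-1 = inv_dist (collinear_sq (s i) i) (collinear_sq (- s i) i) t.
  rewrite /inv_dist /collinear_sq; congr (Num.sqrt _)^-1.
  transitivity (r (i + 1) ^+ 2 + s i ^+ 2 * r (i + 2) ^+ 2 - 2 * r (i + 1) * r (i + 2) * (s i * cos t)); last by field.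
  by rewrite s2 mul1r.
rewrite !(dist_chart _ (ha _)) !H !E.
rewrite e1 e2 e3 e4 e5 e6 !(tnth_nth 0)/=.
congr (_ * _ * inv_dist _ _ _ + _ * _ * inv_dist _ _ _ + _).
- by rewrite sub0r opprK.
- by rewrite subr0.
- by rewrite /inv_dist -opprD cosN.
Qed.

Lemma has_angles_pi (z : triple r) (al : R * R * R) :
  (forall i, oriented_angle (row (i + 1) (val z)) (row (i + 2) (val z))
     (tnth [tuple al.1.1; al.1.2; al.2] i)) ->
  has_angles (\pi_(confspace r) z) al.
Proof.
move=> h i; have [A [sA ->]] := points_pi z.
by rewrite !row_mul; apply/oriented_angle_SO2.
Qed.

(** The hypothesis expresses, through rotations, that the three angles sum to 0 modulo 2 pi. *)
Lemma has_angles_exists (al : R * R * R) :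
  (forall u : 'rV[R]_2, u *m rot (- al.1.1) = u *m rot (al.1.2 + al.2)) ->
  exists P : confspace r, has_angles P al.
Proof.
move=> hal; pose e : 'rV[R]_2 := \row_j (j == 0)%:R.
have e1 : enorm e = 1.
  by rewrite -[LHS](ger0_norm (enorm_ge0 _)) -sqrtr_sqr enorm_sqr !mxE/= expr1n expr0n addr0 sqrtr1.
(* The third point has polar angle 0; alpha_2 leads from it to the first point and alpha_1 from the
   second point to it. *)
pose th : 'I_3 -> R := tnth [tuple al.1.2; - al.1.1; 0].
pose p : 'M[R]_(3, 2) := \matrix_i (r i *: (e *m rot (th i))).
have enp i : enorm (row i p) = r i.
  by rewrite rowK enormZ enorm_SO2 ?e1 ?mulr1 ?gtr0_norm//; exact: rot_SO2.
have pc : on_circles r p by apply/forallP => i; rewrite enp.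
exists (\pi_(confspace r) (Sub p pc)); apply: has_angles_pi.
have [[E1 E2 E3] [E4 E5 E6]] := ord3E.
have H i j al' : e *m rot (th j) = e *m rot (th i + al') ->
    oriented_angle (row i p) (row j p) al'.
  move=> E; rewrite /oriented_angle !enp !rowK -scalemxAl mul_rotD -E !scalerA.
  by rewrite mulrC.
rewrite SubK; apply: ord3P; rewrite ?E1 ?E2 ?E3 ?E4 ?E5 ?E6; apply: H;
  rewrite /th !(tnth_nth 0)/=.
- by rewrite addNr.
- by rewrite add0r.
- exact: hal.
Qed.

Lemma oriented_angle_inj (u v u' v' : 'rV[R]_2) al A : SO2 A -> u != 0 ->
  oriented_angle u v al -> oriented_angle u' v' al -> enorm v' = enorm v ->
  u' = u *m A -> v' = v *m A.
Proof.
move=> sA u0 oa oa' nv uu'; have n0 : enorm u != 0 by rewrite enorm_eq0.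
apply: (scalerI n0); move: oa'; rewrite /oriented_angle uu' enorm_SO2// nv => ->.
by rewrite SO2_rotC// scalemxAl -oa -scalemxAl.
Qed.

(** A rotation matching the third points exists since the radii agree. The angle alpha_2 then
    determines the first point, and alpha_3 the second. *)
Lemma has_angles_inj P P' al : has_angles P al -> has_angles P' al -> P = P'.
Proof.
move=> h h'; have [[E1 E2 E3] [E4 E5 E6]] := ord3E.
have [A [sA E]] := @SO2_transitive _ (row 2 (points P)) (row 2 (points P'))
  (etrans (enorm_points _ _) (esym (enorm_points _ _))) (row_points_neq0 _ _).
have h1 := h 1; have h2 := h 2; have h1' := h' 1; have h2' := h' 2.
rewrite E3 E4 in h1 h1'; rewrite E5 E6 in h2 h2'.
have R0 : row 0 (points P') = row 0 (points P) *m A.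
  by apply: oriented_angle_inj h1 h1' _ E; rewrite ?enorm_points// row_points_neq0.
have R1 : row 1 (points P') = row 1 (points P) *m A.
  by apply: oriented_angle_inj h2 h2' _ R0; rewrite ?enorm_points// row_points_neq0.
apply: (confspace_eq sA); apply/row_matrixP; rewrite -/(points P').
by apply: ord3P; rewrite row_mul.
Qed.

Lemma mul_rot_sin0 (u : 'rV[R]_2) t : sin t = 0 -> u *m rot t = cos t *: u.
Proof.
move=> s0; apply: rv2P; rewrite !mul_rotE s0 !mulr0 ?subr0 ?add0r !mxE mulrC //.
Qed.

Lemma has_angles_aligned P (al : R * R * R) :
  (forall i, sin (tnth [tuple al.1.1; al.1.2; al.2] i) = 0) ->
  has_angles P al -> aligned P.
Proof.
move=> s0 h; have [[E1 E2 E3] [E4 E5 E6]] := ord3E.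
exists (row 2 (points P)); first exact: row_points_neq0.
have H i : exists t, row (i + 2) (points P) = t *: row (i + 1) (points P).
  have := h i; rewrite /oriented_angle mul_rot_sin0// scalerA !enorm_points => E.
  exists (r (i + 2) * cos (tnth [tuple al.1.1; al.1.2; al.2] i) / r (i + 1)).
  have r0 : r (i + 1) != 0 by rewrite gt_eqF.
  by apply: (scalerI r0); rewrite E scalerA [r (i + 1) * _]mulrC divfK.
have [t0 H0] := H 1; have [t1 H1] := H 2; rewrite E3 E4 in H0; rewrite E5 E6 in H1.
apply: ord3P; first by exists t0.
- by exists (t1 * t0); rewrite H1 H0 scalerA.
- by exists 1; rewrite scale1r.
Qed.

(** The bits record on which of the two rays spanned by u a point lies; an angle is pi when the two
    bits differ. *)
Lemma aligned_angles P : aligned P -> exists s : 'I_3 -> bool,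
  has_angles P (if s 1 (+) s 2 then pi else 0, if s 2 (+) s 0 then pi else 0,
    if s 0 (+) s 1 then pi else 0).
Proof.
move=> [u u0 H]; pose t i := xget 0 [set t | row i (points P) = t *: u].
have tE i : row i (points P) = t i *: u.
  by have [x Hx] := H i; rewrite /t; case: xgetP => [y _ //|/(_ x)].
have t0 i : t i != 0.
  by apply: contra_neq (row_points_neq0 P i) => ti; rewrite tE ti scale0r.
have [[E1 E2 E3] [E4 E5 E6]] := ord3E.
exists (fun i => t i < 0).
have H' i j : oriented_angle (row i (points P)) (row j (points P))
    (if (t i < 0) (+) (t j < 0) then pi else 0).
  rewrite /oriented_angle !tE !enormZ mul_rot_sin0; last first.
    by case: ifP; rewrite ?sinpi ?sin0.
  rewrite !scalerA; congr (_ *: _).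
  have := t0 j; have := t0 i; rewrite !neq_lt.
  case: (ltgtP (t i) 0) => // ti _; case: (ltgtP (t j) 0) => // tj _ /=;
    rewrite ?cospi ?cos0.
  - by rewrite (ltr0_norm ti) (ltr0_norm tj); ring.
  - by rewrite (ltr0_norm ti) (gtr0_norm tj); ring.
  - by rewrite (gtr0_norm ti) (ltr0_norm tj); ring.
  - by rewrite (gtr0_norm ti) (gtr0_norm tj); ring.
by apply: ord3P; rewrite ?E1 ?E2 ?E3 ?E4 ?E5 ?E6 (tnth_nth 0)/=; exact: H'.
Qed.

(** The second term vanishes only for vectors of the same direction. It thus measures the excess of
    a distance over its minimum on two circles and controls the equality case. *)
Lemma enorm_gap (u v : 'rV[R]_2) : u != 0 -> v != 0 ->
  enorm (u - v) ^+ 2 = (enorm u - enorm v) ^+ 2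
    + enorm (enorm u *: v - enorm v *: u) ^+ 2 / (enorm u * enorm v).
Proof.
rewrite -!enorm_eq0 => u0 v0.
have := enorm_sqr u; have := enorm_sqr v; move: u0 v0.
rewrite ![enorm (_ - _) ^+ 2]enorm_sqr !mxE.
move: (enorm u) (enorm v) (u 0 0) (u 0 1) (v 0 0) (v 0 1) => m n a b c d m0 n0 Hv Hu.
transitivity ((a ^+ 2 + b ^+ 2) + (c ^+ 2 + d ^+ 2) - 2 * (a * c + b * d)); first by ring.
transitivity ((m - n) ^+ 2 + (m ^+ 2 * (c ^+ 2 + d ^+ 2) + n ^+ 2 * (a ^+ 2 + b ^+ 2)
   - 2 * m * n * (a * c + b * d)) / (m * n)); last by congr (_ + _ / _); ring.
by rewrite -Hv -Hu; field; rewrite m0 n0.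
Qed.

(** At angles 0 all three distances attain their lower bounds | r_i - r_j | simultaneously. If
    another configuration attained all of them, every gap would vanish, all its angles would be 0,
    and it would be [P]. *)
Lemma collinear_energy_max (r_inj : injective r) P P' (q : 'rV[R]_3) :
  has_angles P (0, 0, 0) -> (forall i, 0 < q 0 i) -> P' <> P ->
  energy q P' < energy q P.
Proof.
move=> h q0 P'P.
pose gap i := enorm (r (i + 1) *: row (i + 2) (points P') - r (i + 2) *: row (i + 1) (points P')).
have dP' i : dist P' i ^+ 2 = (r (i + 1) - r (i + 2)) ^+ 2 + gap i ^+ 2 / (r (i + 1) * r (i + 2)).
  by rewrite /dist enorm_gap ?row_points_neq0// !enorm_points.
have dP i : dist P i = `|r (i + 1) - r (i + 2)|.
  rewrite -[LHS](ger0_norm (enorm_ge0 _)) -!sqrtr_sqr; congr Num.sqrt.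
  rewrite /dist enorm_gap ?row_points_neq0// !enorm_points.
  have := h i; rewrite /oriented_angle !enorm_points.
  have -> : tnth [tuple (0 : R, 0 : R, 0 : R).1.1; (0 : R, 0 : R, 0 : R).1.2; (0 : R, 0 : R, 0 : R).2] i = 0.
    by move: i; apply: ord3P; rewrite (tnth_nth 0).
  rewrite mul_rot0 => ->; rewrite subrr.
  have -> : enorm (0 : 'rV[R]_2) = 0 by apply/eqP; rewrite enorm_eq0.
  by rewrite expr0n mul0r addr0.
have d0 i : 0 < dist P i.
  rewrite dP normr_gt0 subr_eq0; apply/eqP => /r_inj; move: i.
  by have [[E1 E2 E3] [E4 E5 E6]] := ord3E; apply: ord3P; rewrite ?E1 ?E2 ?E3 ?E4 ?E5 ?E6.
have dd i : dist P i <= dist P' i.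
  rewrite -(@ler_pXn2r _ 2) ?nnegrE ?enorm_ge0 ?(ltW (d0 i))// dP' dP real_normK ?num_real//.
  by rewrite lerDl divr_ge0 ?sqr_ge0// mulr_ge0// ltW.
have qq i : 0 < q 0 (i + 1) * q 0 (i + 2) by rewrite mulr_gt0.
have [i di] : exists i, dist P i < dist P' i.
  apply/not_existsP => nd; apply: P'P; apply: has_angles_inj h => i.
  have -> : tnth [tuple (0 : R, 0 : R, 0 : R).1.1; (0 : R, 0 : R, 0 : R).1.2; (0 : R, 0 : R, 0 : R).2] i = 0.
    by move: i; apply: ord3P; rewrite (tnth_nth 0).
  rewrite /oriented_angle mul_rot0 !enorm_points; apply/eqP.
  rewrite -subr_eq0 -enorm_eq0 -/(gap i) -sqrf_eq0; apply/eqP.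
  have dE : dist P' i = dist P i.
    by apply/eqP; rewrite eq_le dd andbT leNgt; apply/negP; exact: nd.
  have := dP' i; rewrite dE dP real_normK ?num_real// => /eqP.
  rewrite -subr_eq0 opprD addrA subrr sub0r oppr_eq0 mulf_eq0 invr_eq0 mulf_eq0.
  by rewrite [r _ * _ == 0]mulf_eq0 !(gt_eqF (r_gt0 _)) !orbF orbb => /eqP ->; rewrite expr0n.
have inv_le j : (dist P' j)^-1 <= (dist P j)^-1.
  by rewrite lef_pV2 ?posrE ?d0// (lt_le_trans (d0 j)).
rewrite /energy (bigD1 i)//= [X in _ < X](bigD1 i)//= ltr_leD//.
  by rewrite ltr_pM2l// ltf_pV2 ?posrE ?d0// (lt_trans (d0 i)).
by apply: ler_sum => j _; rewrite ler_wpM2l// ltW.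
Qed.

End Configurations.

(** * Type of the aligned critical points *)

Section ModelEnergy.
Context {R : realType}.

Lemma inv_dist_arg_gt0 (D D' t : R) : 0 < D -> 0 < D' ->
  0 < (D + D' - (D' - D) * cos t) / 2.
Proof.
move=> D0 D'0; have := cos_le1 t; have := cos_geN1 t; move: (cos t) => c c1 c2.
rewrite divr_gt0//.
have -> : D + D' - (D' - D) * c = D' * (1 - c) + D * (1 + c) by ring.
have [c0|c0] := leP 0 c.
  by rewrite ltr_wpDl ?mulr_ge0 ?mulr_gt0// ?(ltW D'0) ?subr_ge0//; lra.
by rewrite ltr_wpDr ?mulr_ge0 ?mulr_gt0// ?(ltW D0) ?subr_gt0//; lra.
Qed.

Lemma bsmooth_inv_dist (D D' : R) : 0 < D -> 0 < D' -> bsmooth setT (inv_dist D D').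
Proof.
move=> D0 D'0 n; have [_ bc] := @bsmooth_sincos R.
have b1 : bgn n setT (fun t : R => (D + D' - (D' - D) * cos t) / 2).
  do ![apply: bgnM|apply: bgnB|exact: bgn_cst]; exact: bc.
apply: bgnV => [x _|].
  by rewrite gt_eqF// sqrtr_gt0 inv_dist_arg_gt0.
apply: (@bgn_comp _ _ _ _ _ _ [set x : R | 0 < x] _ Num.sqrt) b1 (bgn_sqrt _).
by move=> x _; exact: inv_dist_arg_gt0.
Qed.

Lemma derive_comp_lin (V : normedModType R) (g : R -> R) (l : V -> R) x v :
  bsmooth setT g -> lincont l -> 'D_v (g \o l) x = l v * 'D_1 g (l x).
Proof.
move=> bg ll.
have sg y : smooth_near y g by apply: bsmooth_near bg => //; exact: openT.
have sgl : smooth_near x (g \o l).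
  by apply: (smooth_near_comp (f := l) (g := g)) => //; exact: smooth_near_lin.
have [<- <-] : dquot (g \o l) (x, v, 0) = 'D_v (g \o l) x /\
    dquot g (l x, 1, 0) = 'D_1 g (l x) by rewrite /dquot/= eqxx.
have -> : l v * dquot g (l x, 1, 0) = l v * dquot g (l x, 1, 0 * l v) by rewrite mul0r.
apply: (@cts_eq _ (fun t => dquot (g \o l) (x, v, t))
  (fun t => l v * dquot g (l x, 1, t * l v))).
- apply: smooth_near_cts.
  apply: (smooth_near_comp (f := fun t : R => (x, v, t))); first by smooth.
  exact: smooth_near_dquot.
- apply: smooth_near_cts; apply: smooth_nearM; first by smooth.
  apply: (smooth_near_comp (f := fun t : R => (l x, 1 : R, t * l v)) (g := dquot g)).
    by smooth.
  by rewrite mul0r; exact: smooth_near_dquot.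
near=> t => t0; apply: (mulfI t0).
rewrite -[LHS]/(t *: _) -dquotE mulrA -[RHS]/(_ *: _) -dquotE /=.
congr (g _ - _); rewrite addrC (ll.1 t v x) addrC.
by rewrite /GRing.scale/= mulr1.
Unshelve. all: by end_near. Qed.

Lemma derive_inv_dist (D D' t : R) : 0 < D -> 0 < D' ->
  'D_1 (inv_dist D D') t = - (D' - D) / 4 * (inv_dist D D' t ^+ 3 * sin t).
Proof.
move=> D0 D'0; pose m (t : R) := (D + D' - (D' - D) * cos t) / 2.
have m0 : 0 < m t by exact: inv_dist_arg_gt0.
have Dm : is_derive t 1 m ((D' - D) * sin t / 2).
  by apply: is_derive_eq; rewrite /GRing.scale/=; field.
have Ds := @is_derive1_comp _ Num.sqrt m t _ _ (is_derive1_sqrt m0) Dm.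
have s0 : Num.sqrt (m t) != 0 by rewrite gt_eqF// sqrtr_gt0.
have DV := @is_deriveV _ (Num.sqrt \o m) t _ _ s0 Ds.
case: DV => _ E; apply: (etrans E).
rewrite /inv_dist -/(m t) /= /GRing.scale/=; move: (Num.sqrt _) s0 => s s0.
by field.
Qed.

(** The first derivative is a multiple of the cubed inverse distance times sine, so at 0 only the
    derivative of the sine contributes. *)
Lemma derive2_inv_dist (D D' : R) : 0 < D -> 0 < D' ->
  'D_1 (fun t => 'D_1 (inv_dist D D') t) 0 = stiffness D D' / 2.
Proof.
move=> D0 D'0.
under eq_fun do rewrite derive_inv_dist//.
have Dg : is_derive (0 : R) 1 (inv_dist D D') 0.
  apply: DeriveDef; last by rewrite derive_inv_dist// sin0 !mulr0.
  by apply: (@bsmooth_derivable _ _ _ setT) => //; [exact: openT|exact: bsmooth_inv_dist].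
have Dh : is_derive (0 : R) 1 (fun t => - (D' - D) / 4 * (inv_dist D D' t ^+ 3 * sin t))
    (- (D' - D) / 4 * inv_dist D D' 0 ^+ 3).
  apply: is_derive_eq; rewrite /GRing.scale/= sin0 cos0; ring.
case: Dh => _ ->; have -> : inv_dist D D' 0 = (Num.sqrt D)^-1.
  by rewrite /inv_dist cos0; congr (Num.sqrt _)^-1; field.
have s0 : Num.sqrt D != 0 by rewrite gt_eqF// sqrtr_gt0.
rewrite /stiffness; have : Num.sqrt D ^+ 2 = D by rewrite sqr_sqrtr// ltW.
by move: (Num.sqrt D) s0 => s s0 <-; field.
Qed.

Section Energy.
Context (c D D' : 'I_3 -> R)
  (D0 : forall i, 0 < D i) (D'0 : forall i, 0 < D' i).

Definition model_energy (a : 'rV[R]_2) : R :=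
  c 0 * inv_dist (D 0) (D' 0) (a 0 0) + c 1 * inv_dist (D 1) (D' 1) (a 0 1)
  + c 2 * inv_dist (D 2) (D' 2) (a 0 0 + a 0 1).

Let h i := c i * stiffness (D i) (D' i).

Lemma lincont_coord n (i : 'I_n) : lincont (fun a : 'rV[R]_n => a 0 i).
Proof. by split=> [t x y|]; [rewrite !mxE|exact: coord_continuous]. Qed.

Lemma lincont_sum : lincont (fun a : 'rV[R]_2 => a 0 0 + a 0 1).
Proof.
split=> [t x y|x]; first by rewrite !mxE scalerDr addrACA.
apply: (@bgn_cts _ 0 _ _ setT (fun a : 'rV[R]_2 => a 0 0 + a 0 1)) => //.
by apply: bgnD; apply: bgn_lin; exact: lincont_coord.
Qed.

Lemma bsmooth_comp_lin (V : normedModType R) (g : R -> R) (l : V -> R) :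
  bsmooth setT g -> lincont l -> bsmooth setT (g \o l).
Proof. by move=> bg ll n; apply: bgn_comp (bg n) => //; exact: bgn_lin. Qed.

Lemma derive_sum3_lin (g0 g1 g2 : R -> R) (k0 k1 k2 : R) x v :
  bsmooth setT g0 -> bsmooth setT g1 -> bsmooth setT g2 ->
  'D_v (fun a : 'rV[R]_2 => k0 * g0 (a 0 0) + k1 * g1 (a 0 1) + k2 * g2 (a 0 0 + a 0 1)) x
  = k0 * (v 0 0 * 'D_1 g0 (x 0 0)) + k1 * (v 0 1 * 'D_1 g1 (x 0 1))
    + k2 * ((v 0 0 + v 0 1) * 'D_1 g2 (x 0 0 + x 0 1)).
Proof.
move=> b0 b1 b2.
have l0 := @lincont_coord _ (0 : 'I_2); have l1 := @lincont_coord _ (1 : 'I_2).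
have l2 := lincont_sum.
rewrite -(derive_comp_lin x v b0 l0) -(derive_comp_lin x v b1 l1).
rewrite -(derive_comp_lin x v b2 l2).
have d0 := @bsmooth_derivable _ _ _ _ _ x v openT (bsmooth_comp_lin b0 l0) I.
have d1 := @bsmooth_derivable _ _ _ _ _ x v openT (bsmooth_comp_lin b1 l1) I.
have d2 := @bsmooth_derivable _ _ _ _ _ x v openT (bsmooth_comp_lin b2 l2) I.
rewrite -!/(_ *: _) -!deriveZ//.
rewrite -deriveD; [|exact: derivableZ..].
by rewrite -deriveD//; [apply: derivableD|]; exact: derivableZ.
Qed.

Lemma model_derive v a : 'D_v model_energy a
  = c 0 * (v 0 0 * 'D_1 (inv_dist (D 0) (D' 0)) (a 0 0))
  + c 1 * (v 0 1 * 'D_1 (inv_dist (D 1) (D' 1)) (a 0 1))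
  + c 2 * ((v 0 0 + v 0 1) * 'D_1 (inv_dist (D 2) (D' 2)) (a 0 0 + a 0 1)).
Proof. by apply: derive_sum3_lin; exact: bsmooth_inv_dist. Qed.

Lemma derive_inv_dist0 i : 'D_1 (inv_dist (D i) (D' i)) 0 = 0.
Proof. by rewrite derive_inv_dist// sin0 !mulr0. Qed.

Lemma bsmooth_derive1 (g : R -> R) : bsmooth setT g -> bsmooth setT (fun t => 'D_1 g t).
Proof.
move=> bg n; have := bsmooth_dquot openT bg => /(_ n) bq.
have b2 : bgn n setT (fun t : R => dquot g (t, 1, 0)).
  apply: (@bgn_comp _ _ _ _ _ _ (quot_dom setT) (fun t : R => (t, 1 : R, 0 : R))) bq => //.
  by do ![apply: bgn_pair|exact: bgn_cst]; exact: bgn_id.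
by apply: bgn_ext b2; [exact: openT|move=> t _; rewrite /dquot/= eqxx].
Qed.

Lemma model_differentiable : differentiable model_energy (0 : 'rV[R]_2).
Proof.
have dg i t : differentiable (inv_dist (D i) (D' i)) t.
  apply/derivable1_diffP; apply: (@bsmooth_derivable _ _ _ setT) => //; first exact: openT.
  exact: bsmooth_inv_dist.
have d0 := @differentiable_coord R 1 2 0 0 0; have d1 := @differentiable_coord R 1 2 0 0 1.
apply: differentiableD; [apply: differentiableD|]; apply: differentiableM => //;
  apply: (differentiable_comp _ (dg _ _)) => //.
exact: differentiableD.
Qed.

Lemma model_derive0 v : 'D_v model_energy 0 = 0.
Proof. by rewrite model_derive !mxE addr0 !derive_inv_dist0 !mulr0 !addr0. Qed.

Lemma model_derive2 v w : 'D_w (fun a => 'D_v model_energy a) 0 =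
  (h 0 * (v 0 0 * w 0 0) + h 1 * (v 0 1 * w 0 1)
   + h 2 * ((v 0 0 + v 0 1) * (w 0 0 + w 0 1))) / 2.
Proof.
have -> : (fun a => 'D_v model_energy a) =
  (fun a => (c 0 * v 0 0) * 'D_1 (inv_dist (D 0) (D' 0)) (a 0 0)
  + (c 1 * v 0 1) * 'D_1 (inv_dist (D 1) (D' 1)) (a 0 1)
  + (c 2 * (v 0 0 + v 0 1)) * 'D_1 (inv_dist (D 2) (D' 2)) (a 0 0 + a 0 1)).
  by apply/funext => a; rewrite model_derive !mulrA.
rewrite (@derive_sum3_lin (fun t => 'D_1 (inv_dist (D 0) (D' 0)) t)
  (fun t => 'D_1 (inv_dist (D 1) (D' 1)) t) (fun t => 'D_1 (inv_dist (D 2) (D' 2)) t)); [|by apply: bsmooth_derive1; exact: bsmooth_inv_dist..].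
by rewrite !mxE addr0 !derive2_inv_dist// /h; field.
Qed.

(** Each summand is a constant plus t^2 times a smooth function whose value at 0 is [h i] up to a
    positive factor common to all i. Extremality can then be decided on quadratic forms with
    variable coefficients, without a Taylor remainder. *)
Lemma model_expansion : exists k : R -> R, exists G : 'I_3 -> R -> R,
  [/\ smooth_near 0 k /\ 0 < k 0, forall i, smooth_near 0 (G i),
     forall i, G i 0 = k 0 * h i &
     forall i, \forall t \near (0 : R),
       c i * inv_dist (D i) (D' i) t = c i * inv_dist (D i) (D' i) 0 + t ^+ 2 * G i t].
Proof.
have [k sk [k0 kE]] := @htan_quot R.
have F i := @root_quot_taylor R (D i) (D' i) (D0 i).
have [e eP] : exists e : 'I_3 -> R -> R, forall i, smooth_near 0 (e i) /\
    e i 0 = stiffness (D i) (D' i) /\ \forall u \near (0 : R),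
     root_quot (D i) (D' i) u = root_quot (D i) (D' i) 0 + u * e i u.
  have H i : exists ei : R -> R, smooth_near 0 ei /\
    ei 0 = stiffness (D i) (D' i) /\ \forall u \near (0 : R),
     root_quot (D i) (D' i) u = root_quot (D i) (D' i) 0 + u * ei u.
    by have [ei [di [[sei _ FE _] e0 _]]] := F i; exists ei.
  by have [e eP] := boolp.choice H; exists e.
have sth := @smooth_near_htan R.
have sth2 : smooth_near (0 : R) (fun t => htan t ^+ 2) by smooth.
exists (fun t => k t ^+ 2), (fun i t => c i * (k t ^+ 2 * e i (htan t ^+ 2))).
split=> [|i|i|i].
- by split; [smooth|rewrite exprn_gt0].
- have [se _] := eP i.
  have s1 : smooth_near (0 : R) (fun t => e i (htan t ^+ 2)).
    by apply: (smooth_near_comp sth2); rewrite htan0 expr0n.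
  by smooth.
- by have [_ [e0 _]] := eP i; rewrite htan0 expr0n/= e0 /h mulrCA.
- have [_ [_ FE]] := eP i.
  have := near_pull (P := fun u => root_quot (D i) (D' i) u = root_quot (D i) (D' i) 0 + u * e i u) sth2.
  rewrite htan0 expr0n/= => /(_ FE) n1.
  have sh : smooth_near (0 : R) (fun t : R => t / 2) by smooth.
  have sc := smooth_near_comp sh (smooth_near_trig _).2.
  have n2 : \forall t \near (0 : R), 0 < cos (t / 2).
    by apply: (cvgr_gt _ (smooth_near_cts sc)); rewrite mul0r cos0 ltr01.
  near=> t.
  have c0 : cos (t / 2) != 0 by rewrite gt_eqF//; near: t.
  rewrite !inv_dist_tan// -!/(htan _); last by rewrite mul0r cos0 oner_neq0.
  rewrite htan0 expr0n/=.
  have -> : root_quot (D i) (D' i) (htan t ^+ 2) = root_quot (D i) (D' i) 0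
      + htan t ^+ 2 * e i (htan t ^+ 2) by near: t.
  by rewrite {1}kE; ring.
Unshelve. all: by end_near. Qed.

Lemma quadratic_ge0 (x y g0 g1 g2 : R) : 0 < g0 + g2 ->
  0 < g0 * g1 + g0 * g2 + g1 * g2 ->
  0 <= x ^+ 2 * g0 + y ^+ 2 * g1 + (x + y) ^+ 2 * g2.
Proof.
move=> s0 d0; rewrite -(@pmulr_rge0 _ (g0 + g2))//.
have -> : (g0 + g2) * (x ^+ 2 * g0 + y ^+ 2 * g1 + (x + y) ^+ 2 * g2)
  = ((g0 + g2) * x + g2 * y) ^+ 2 + (g0 * g1 + g0 * g2 + g1 * g2) * y ^+ 2 by ring.
by rewrite addr_ge0 ?sqr_ge0// mulr_ge0 ?sqr_ge0// ltW.
Qed.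

(** The energy difference is a quadratic form in a whose coefficients depend on a; the two minor
    conditions hold at 0 and stay true nearby by continuity. *)
Lemma model_local_min : 0 < h 0 + h 2 ->
  0 < h 0 * h 1 + h 0 * h 2 + h 1 * h 2 ->
  \forall a \near (0 : 'rV[R]_2), model_energy 0 <= model_energy a.
Proof.
move=> s0 d0; have [k [G [[sk k0] sG G0 GE]]] := model_expansion.
have lc n (i : 'I_n) := smooth_near_lin (0 : 'rV[R]_n) (lincont_coord i).
have s00 := lc _ (0 : 'I_2); have s01 := lc _ (1 : 'I_2).
have s02 := smooth_near_lin (0 : 'rV[R]_2) lincont_sum.
have e0 : (0 : 'rV[R]_2) 0 0 = 0 by rewrite mxE.
have e1 : (0 : 'rV[R]_2) 0 1 = 0 by rewrite mxE.
have e2 : (0 : 'rV[R]_2) 0 0 + (0 : 'rV[R]_2) 0 1 = 0 by rewrite !mxE addr0.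
have t0 : smooth_near (0 : 'rV[R]_2) (fun a : 'rV[R]_2 => G 0 (a 0 0)).
  by apply: (smooth_near_comp s00); rewrite e0.
have t1 : smooth_near (0 : 'rV[R]_2) (fun a : 'rV[R]_2 => G 1 (a 0 1)).
  by apply: (smooth_near_comp s01); rewrite e1.
have t2 : smooth_near (0 : 'rV[R]_2) (fun a : 'rV[R]_2 => G 2 (a 0 0 + a 0 1)).
  by apply: (smooth_near_comp s02); rewrite e2.
pose q1 (a : 'rV[R]_2) := G 0 (a 0 0) + G 2 (a 0 0 + a 0 1).
pose q2 (a : 'rV[R]_2) := G 0 (a 0 0) * G 1 (a 0 1)
    + G 0 (a 0 0) * G 2 (a 0 0 + a 0 1) + G 1 (a 0 1) * G 2 (a 0 0 + a 0 1).
have p1 : \forall a \near (0 : 'rV[R]_2), 0 < q1 a.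
  have s : smooth_near (0 : 'rV[R]_2) q1 by rewrite /q1; smooth.
  apply: (cvgr_gt _ (smooth_near_cts s)); rewrite /q1 e2 e0 !G0 -mulrDr.
  by rewrite mulr_gt0.
have p2 : \forall a \near (0 : 'rV[R]_2), 0 < q2 a.
  have s : smooth_near (0 : 'rV[R]_2) q2 by rewrite /q2; smooth.
  apply: (cvgr_gt _ (smooth_near_cts s)); rewrite /q2 e2 e0 e1 !G0.
  have -> : k 0 * h 0 * (k 0 * h 1) + k 0 * h 0 * (k 0 * h 2) + k 0 * h 1 * (k 0 * h 2)
    = k 0 ^+ 2 * (h 0 * h 1 + h 0 * h 2 + h 1 * h 2) by ring.
  by rewrite mulr_gt0// exprn_gt0.
have n0 := near_pull (P := fun t => c 0 * inv_dist (D 0) (D' 0) t = c 0 * inv_dist (D 0) (D' 0) 0 + t ^+ 2 * G 0 t) s00.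
have n1 := near_pull (P := fun t => c 1 * inv_dist (D 1) (D' 1) t = c 1 * inv_dist (D 1) (D' 1) 0 + t ^+ 2 * G 1 t) s01.
have n2 := near_pull (P := fun t => c 2 * inv_dist (D 2) (D' 2) t = c 2 * inv_dist (D 2) (D' 2) 0 + t ^+ 2 * G 2 t) s02.
move: n0 n1 n2; rewrite e2 e0 e1 => /(_ (GE 0)) n0 /(_ (GE 1)) n1 /(_ (GE 2)) n2.
near=> a.
have E0 : c 0 * inv_dist (D 0) (D' 0) (a 0 0) = c 0 * inv_dist (D 0) (D' 0) 0 + a 0 0 ^+ 2 * G 0 (a 0 0) by near: a.
have E1 : c 1 * inv_dist (D 1) (D' 1) (a 0 1) = c 1 * inv_dist (D 1) (D' 1) 0 + a 0 1 ^+ 2 * G 1 (a 0 1) by near: a.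
have E2 : c 2 * inv_dist (D 2) (D' 2) (a 0 0 + a 0 1) = c 2 * inv_dist (D 2) (D' 2) 0 + (a 0 0 + a 0 1) ^+ 2 * G 2 (a 0 0 + a 0 1) by near: a.
rewrite /model_energy e2 e0 e1 E0 E1 E2.
have := @quadratic_ge0 (a 0 0) (a 0 1) (G 0 (a 0 0)) (G 1 (a 0 1)) (G 2 (a 0 0 + a 0 1)).
have Q1 : 0 < q1 a by near: a.
have Q2 : 0 < q2 a by near: a.
move=> /(_ Q1 Q2); move: (_ ^+ 2 * _) (_ ^+ 2 * _) (_ ^+ 2 * _) => A B C; lra.
Unshelve. all: by end_near. Qed.

(** On a line the sign of the energy difference near 0 is the sign of the quadratic form at [w],
    which is enough to refute extremality. *)
Lemma model_line (w : 'rV[R]_2) (S := w 0 0 ^+ 2 * h 0 + w 0 1 ^+ 2 * h 1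
     + (w 0 0 + w 0 1) ^+ 2 * h 2) : exists B : R -> R,
  [/\ {for 0, continuous B}, exists2 k, 0 < k & B 0 = k * S &
   \forall t \near (0 : R), model_energy (t *: w) = model_energy 0 + t ^+ 2 * B t].
Proof.
have [k [G [[sk k0] sG G0 GE]]] := model_expansion.
have l0 : smooth_near (0 : R) (fun t : R => t * w 0 0) by smooth.
have l1 : smooth_near (0 : R) (fun t : R => t * w 0 1) by smooth.
have l2 : smooth_near (0 : R) (fun t : R => t * (w 0 0 + w 0 1)) by smooth.
have s0 : smooth_near 0 (fun t : R => G 0 (t * w 0 0)).
  by apply: (smooth_near_comp l0); rewrite mul0r.
have s1 : smooth_near 0 (fun t : R => G 1 (t * w 0 1)).
  by apply: (smooth_near_comp l1); rewrite mul0r.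
have s2 : smooth_near 0 (fun t : R => G 2 (t * (w 0 0 + w 0 1))).
  by apply: (smooth_near_comp l2); rewrite mul0r.
exists (fun t => w 0 0 ^+ 2 * G 0 (t * w 0 0) + w 0 1 ^+ 2 * G 1 (t * w 0 1)
   + (w 0 0 + w 0 1) ^+ 2 * G 2 (t * (w 0 0 + w 0 1))); split.
- by apply: smooth_near_cts; smooth.
- by exists (k 0) => //; rewrite !mul0r !G0 /S; ring.
have n0 := near_pull (P := fun t => c 0 * inv_dist (D 0) (D' 0) t = c 0 * inv_dist (D 0) (D' 0) 0 + t ^+ 2 * G 0 t) l0.
have n1 := near_pull (P := fun t => c 1 * inv_dist (D 1) (D' 1) t = c 1 * inv_dist (D 1) (D' 1) 0 + t ^+ 2 * G 1 t) l1.
have n2 := near_pull (P := fun t => c 2 * inv_dist (D 2) (D' 2) t = c 2 * inv_dist (D 2) (D' 2) 0 + t ^+ 2 * G 2 t) l2.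
move: n0 n1 n2; rewrite !mul0r => /(_ (GE 0)) n0 /(_ (GE 1)) n1 /(_ (GE 2)) n2.
near=> t.
rewrite /model_energy !mxE addr0 -mulrDr.
have -> : c 0 * inv_dist (D 0) (D' 0) (t * w 0 0) = c 0 * inv_dist (D 0) (D' 0) 0 + (t * w 0 0) ^+ 2 * G 0 (t * w 0 0) by near: t.
have -> : c 1 * inv_dist (D 1) (D' 1) (t * w 0 1) = c 1 * inv_dist (D 1) (D' 1) 0 + (t * w 0 1) ^+ 2 * G 1 (t * w 0 1) by near: t.
have -> : c 2 * inv_dist (D 2) (D' 2) (t * (w 0 0 + w 0 1)) = c 2 * inv_dist (D 2) (D' 2) 0 + (t * (w 0 0 + w 0 1)) ^+ 2 * G 2 (t * (w 0 0 + w 0 1)) by near: t.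
by ring.
Unshelve. all: by end_near. Qed.

Let line_witness (w : 'rV[R]_2) (P : 'rV[R]_2 -> Prop) (Q : R -> Prop) :
  (\forall a \near (0 : 'rV[R]_2), P a) -> (\forall t \near (0 : R), Q t) ->
  exists t, [/\ t != 0, P (t *: w) & Q t].
Proof.
move=> nP nQ.
have lw : smooth_near (0 : R) (fun t : R => t *: w) by smooth.
have := near_pull (P := P) lw; rewrite scale0r => /(_ nP) nPt.
have : \forall t \near (0 : R)^', [/\ t != 0, P (t *: w) & Q t].
  near=> t; split; first by near: t; exact: nbhs_dnbhs_neq.
    by near: t; exact: nbhs_dnbhs nPt.
  by near: t; exact: nbhs_dnbhs nQ.
by move=> /filter_ex.
Unshelve. all: by end_near. Qed.

Lemma model_not_local_min (w : 'rV[R]_2) :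
  w 0 0 ^+ 2 * h 0 + w 0 1 ^+ 2 * h 1 + (w 0 0 + w 0 1) ^+ 2 * h 2 < 0 ->
  ~ \forall a \near (0 : 'rV[R]_2), model_energy 0 <= model_energy a.
Proof.
move=> S0 H; have [B [cB [k k0 B0] BE]] := model_line w.
have Bn : \forall t \near (0 : R), B t < 0.
  by apply: (cvgr_lt _ cB); rewrite B0 pmulr_rlt0.
have [t [t0 Ht [Et Bt]]] := line_witness w H (filterI BE Bn).
by move: Ht; rewrite Et lerDl leNgt pmulr_rlt0 ?Bt// exprn_even_gt0.
Qed.

Lemma model_not_local_max (w : 'rV[R]_2) :
  0 < w 0 0 ^+ 2 * h 0 + w 0 1 ^+ 2 * h 1 + (w 0 0 + w 0 1) ^+ 2 * h 2 ->
  ~ \forall a \near (0 : 'rV[R]_2), model_energy a <= model_energy 0.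
Proof.
move=> S0 H; have [B [cB [k k0 B0] BE]] := model_line w.
have Bn : \forall t \near (0 : R), 0 < B t.
  by apply: (cvgr_gt _ cB); rewrite B0 pmulr_rgt0.
have [t [t0 Ht [Et Bt]]] := line_witness w H (filterI BE Bn).
by move: Ht; rewrite Et gerDl leNgt pmulr_rgt0 ?Bt// exprn_even_gt0.
Qed.

End Energy.
End ModelEnergy.

(** * Linear changes of the angle coordinates *)

Section LinearCoordinates.
Context {R : realType}.
Implicit Types V W X : normedModType R.

Lemma lincontD V W (f g : V -> W) :
  lincont f -> lincont g -> lincont (fun x => f x + g x).
Proof.
move=> [lf cf] [lg cg]; split=> [t x y|x]; first by rewrite lf lg scalerDr addrACA.
by apply: cvgD; [exact: cf|exact: cg].
Qed.

Lemma lincontN V W (f : V -> W) : lincont f -> lincont (fun x => - f x).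
Proof.
move=> [lf cf]; split=> [t x y|x]; first by rewrite lf opprD scalerN.
by apply: cvgN; exact: cf.
Qed.

Lemma lincont_pair V W X (f : V -> W) (g : V -> X) :
  lincont f -> lincont g -> lincont (fun x => (f x, g x)).
Proof.
move=> [lf cf] [lg cg]; split=> [t x y|x]; first by rewrite lf lg.
by apply: cvg_pair; [exact: cf|exact: cg].
Qed.

Definition row2 (x y : R) : 'rV[R]_2 := x *: delta_mx 0 0 + y *: delta_mx 0 1.

Lemma row2E x y : row2 x y 0 0 = x /\ row2 x y 0 1 = y.
Proof. by rewrite !mxE/= !mulr0 !mulr1 addr0 add0r. Qed.

Lemma row2K (a : 'rV[R]_2) : row2 (a 0 0) (a 0 1) = a.
Proof. by have [h0 h1] := row2E (a 0 0) (a 0 1); apply: rv2P. Qed.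

Lemma lincont_row2 V (f g : V -> R) :
  lincont f -> lincont g -> lincont (fun x => row2 (f x) (g x)).
Proof.
have H (f' : V -> R) (e : 'rV[R]_2) : lincont f' -> lincont (fun x => f' x *: e).
  move=> [lf cf]; split=> [t x y|x]; first by rewrite lf scalerDl scalerA.
  by apply: cvgZ; [exact: cf|exact: cvg_cst].
by move=> lf lg; apply: lincontD; exact: H.
Qed.

(* f a lists the increments of the angles m + 1 and m + 2, the three increments
   summing to 0. *)
Lemma cyclic_coords (m : 'I_3) : exists (f : 'rV[R]_2 -> R * R) (g : R * R -> 'rV[R]_2),
  [/\ lincont f, lincont g, cancel f g, cancel g f &
   forall (F : 'I_3 -> R -> R) (a : 'rV[R]_2), (forall i t, F i (- t) = F i t) ->
     F 0 (a 0 0) + F 1 (a 0 1) + F 2 (a 0 0 + a 0 1) =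
     F (m + 1) (f a).1 + F (m + 2) (f a).2 + F m ((f a).1 + (f a).2)].
Proof.
have l0 := @lincont_coord R _ (0 : 'I_2); have l1 := @lincont_coord R _ (1 : 'I_2).
have lf := @lincont_fst R R R; have ls := @lincont_snd R R R.
have l2 := lincontN (lincontD l0 l1); have lfs := lincontN (lincontD lf ls).
have [[E1 E2 E3] [E4 E5 E6]] := ord3E.
move: m; apply: ord3P; rewrite ?E1 ?E2 ?E3 ?E4 ?E5 ?E6.
- exists (fun a => (a 0 1, - (a 0 0 + a 0 1))), (fun p => row2 (- (p.1 + p.2)) p.1).
  split=> [||a|[x y]|F a FN] /=.
  + exact: lincont_pair.
  + exact: lincont_row2.
  + by rewrite opprD opprK addrC addrK row2K.
  + by have [-> ->] := row2E (- (x + y)) x; congr pair; ring.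
  + rewrite FN; have -> : a 0 1 - (a 0 0 + a 0 1) = - a 0 0 by ring.
    by rewrite FN; ring.
- exists (fun a => (- (a 0 0 + a 0 1), a 0 0)), (fun p => row2 p.2 (- (p.1 + p.2))).
  split=> [||a|[x y]|F a FN] /=.
  + exact: lincont_pair.
  + exact: lincont_row2.
  + by rewrite opprD opprK addrAC subrr add0r row2K.
  + by have [-> ->] := row2E y (- (x + y)); congr pair; ring.
  + rewrite FN; have -> : - (a 0 0 + a 0 1) + a 0 0 = - a 0 1 by ring.
    by rewrite FN; ring.
- exists (fun a => (a 0 0, a 0 1)), (fun p => row2 p.1 p.2).
  split=> [||a|[x y]|F a FN] //=.
  + exact: lincont_pair.
  + exact: lincont_row2.
  + exact: row2K.
  + by have [-> ->] := row2E x y.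
Qed.

End LinearCoordinates.

(** * Hessian, type and bifurcation at an aligned configuration *)

Section Aligned.
Context {R : realType} (r : 'I_3 -> R) (r_gt0 : forall i, 0 < r i)
  (r_inj : injective r).

Definition pair_charge (i : 'I_3) (q : 'rV[R]_3) : R := q 0 (i + 1) * q 0 (i + 2).

Definition angle_of (al : R * R * R) (i : 'I_3) : R :=
  tnth [tuple al.1.1; al.1.2; al.2] i.

Context (P : confspace r) (al : R * R * R) (P_al : has_angles P al).
Context (s : 'I_3 -> bool).
Context (sin_al : forall i, sin (angle_of al i) = 0)
  (cos_al : forall i, cos (angle_of al i) = if s i then -1 else 1).

Let sg i : R := if s i then -1 else 1.
Let D i := collinear_sq r (sg i) i.
Let D' i := collinear_sq r (- sg i) i.
Let k i := stiffness (D i) (D' i).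

Lemma r_next_neq i : r (i + 1) != r (i + 2).
Proof.
apply/eqP => /r_inj; move: i.
by have [[E1 E2 E3] [E4 E5 E6]] := ord3E; apply: ord3P; rewrite ?E1 ?E2 ?E3 ?E4 ?E5 ?E6.
Qed.

Lemma collinear_sq_gt0 i (b : bool) : 0 < collinear_sq r (if b then -1 else 1) i.
Proof.
rewrite /collinear_sq exprn_even_gt0//=; case: b.
  by rewrite mulN1r opprK gt_eqF// addr_gt0.
by rewrite mul1r subr_eq0 r_next_neq.
Qed.

Let D_gt0 i : 0 < D i. Proof. exact: collinear_sq_gt0. Qed.

Let D'_gt0 i : 0 < D' i.
Proof.
by rewrite /D' /sg; case: (s i); [rewrite opprK; exact: (collinear_sq_gt0 _ false)|
  exact: (collinear_sq_gt0 _ true)].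
Qed.

Lemma collinear_sq_lt i : collinear_sq r 1 i < collinear_sq r (-1) i.
Proof.
rewrite /collinear_sq -subr_gt0.
have -> : (r (i + 1) - -1 * r (i + 2)) ^+ 2 - (r (i + 1) - 1 * r (i + 2)) ^+ 2
  = 4 * (r (i + 1) * r (i + 2)) by ring.
by rewrite mulr_gt0// mulr_gt0.
Qed.

Let D_lt i : if s i then D' i < D i else D i < D' i.
Proof. by have := collinear_sq_lt i; rewrite /D /D' /sg; case: (s i); rewrite ?opprK. Qed.

(** On opposite rays the distance is maximal, so its inverse increases when the angle moves; on one
    ray it is minimal and the inverse decreases. *)
Let k_sign i : if s i then 0 < k i else k i < 0.
Proof.
have den : 0 < 2 * D i * Num.sqrt (D i) by apply: mulr_gt0; [apply: mulr_gt0|rewrite sqrtr_gt0]; rewrite // D_gt0.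
have := D_lt i; rewrite /k /stiffness; case: (s i) => DD.
  by rewrite divr_gt0// subr_gt0.
by rewrite pmulr_llt0 ?invr_gt0// subr_lt0.
Qed.

Lemma energy_chart_model q :
  energy q \o chart P = model_energy (pair_charge^~ q) D D'.
Proof.
apply/funext => a; rewrite /= (energy_chart r_gt0 q a P_al sin_al cos_al).
rewrite /model_energy /pair_charge.
by have [[-> -> ->] [-> -> ->]] := ord3E.
Qed.

Lemma aligned_critical q : critical (energy q) P.
Proof.
rewrite /critical energy_chart_model.
have df := @model_differentiable R (pair_charge^~ q) D D' D_gt0 D'_gt0.
by split=> // v; rewrite -deriveE// model_derive0.
Qed.

Let l (q : 'rV[R]_3) := q 0 0 * (k 1 * k 2) + q 0 1 * (k 0 * k 2) + q 0 2 * (k 0 * k 1).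

Let h q i := pair_charge i q * k i.

(** The product of two pair charges is the product of all three charges times the charge that they
    share; this is why a quadratic expression in the [h]s reduces to a linear form. *)
Let hh q : h q 0 * h q 1 + h q 0 * h q 2 + h q 1 * h q 2 =
  q 0 0 * q 0 1 * q 0 2 * l q.
Proof.
rewrite /h /pair_charge /l; have [[-> -> ->] [-> -> ->]] := ord3E; ring.
Qed.

Lemma det_hessian q : \det (hessian (energy q) P) = q 0 0 * q 0 1 * q 0 2 * l q / 4.
Proof.
by rewrite det2E !mxE energy_chart_model !model_derive2// !mxE/= -hh /h /k; field.
Qed.

Lemma degenerate_chargesE q :
  degenerate_charges P q <-> positive_charges q /\ l q = 0.
Proof.
rewrite /degenerate_charges /degenerate_critical /= det_hessian; split=> -[q0]; last first.
  by move=> l0; split=> //; split; [exact: aligned_critical|rewrite l0 mulr0 mul0r].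
move=> [_ /eqP]; rewrite !mulf_eq0 invr_eq0 pnatr_eq0 !(gt_eqF (q0 _)) /= orbF.
by move=> /eqP.
Qed.

Lemma nondegenerate q : positive_charges q -> l q != 0 ->
  nondegenerate_critical (energy q) P.
Proof.
move=> q0 l0; split; first exact: aligned_critical.
by rewrite det_hessian !mulf_neq0// ?invr_eq0 ?pnatr_eq0// gt_eqF.
Qed.

Lemma collinear_nondegenerate q : (forall i, s i = false) -> positive_charges q ->
  nondegenerate_critical (energy q) P.
Proof.
move=> s0 q0; apply: nondegenerate => //.
have kn i : k i < 0 by have := k_sign i; rewrite s0.
by rewrite gt_eqF// /l !addr_gt0// mulr_gt0// nmulr_lgt0.
Qed.

Lemma energy_chartE q a :
  energy q (chart P a) = model_energy (pair_charge^~ q) D D' a.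
Proof. by rewrite -energy_chart_model. Qed.

Lemma energyP q : energy q P = model_energy (pair_charge^~ q) D D' 0.
Proof. by rewrite -energy_chart_model /= chart0. Qed.

(* m is the index of the angle equal to 0. *)
Section Opposite.
Context (m : 'I_3) (s_m : s m = false) (s_m1 : s (m + 1)) (s_m2 : s (m + 2)).

Let km : k m < 0. Proof. by have := k_sign m; rewrite s_m. Qed.
Let km1 : 0 < k (m + 1). Proof. by have := k_sign (m + 1); rewrite s_m1. Qed.
Let km2 : 0 < k (m + 2). Proof. by have := k_sign (m + 2); rewrite s_m2. Qed.

Let lE q : l q = q 0 m * (k (m + 1) * k (m + 2))
  + k m * (q 0 (m + 1) * k (m + 2) + q 0 (m + 2) * k (m + 1)).
Proof.
move: (m); rewrite /l; have [[E1 E2 E3] [E4 E5 E6]] := ord3E.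
by apply: ord3P; rewrite ?E1 ?E2 ?E3 ?E4 ?E5 ?E6; ring.
Qed.

Let pq q i : positive_charges q -> 0 < pair_charge i q.
Proof. by move=> q0; rewrite mulr_gt0. Qed.

Let hm q : positive_charges q -> h q m < 0.
Proof. by move=> q0; rewrite pmulr_rlt0 ?pq. Qed.

Let hm1 q : positive_charges q -> 0 < h q (m + 1).
Proof. by move=> q0; rewrite mulr_gt0 ?pq. Qed.

Let hm2 q : positive_charges q -> 0 < h q (m + 2).
Proof. by move=> q0; rewrite mulr_gt0 ?pq. Qed.

Lemma opposite_min q : positive_charges q -> 0 < l q -> nondegenerate_min (energy q) P.
Proof.
move=> q0 l0; split; first by apply: nondegenerate => //; rewrite gt_eqF.
rewrite /local_min energyP.
have d0 : 0 < h q 0 * h q 1 + h q 0 * h q 2 + h q 1 * h q 2.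
  by rewrite hh !mulr_gt0.
have s0 : 0 < h q 0 + h q 2.
  have p := hm q0; have p1 := hm1 q0; have p2 := hm2 q0.
  have [[E1 E2 E3] [E4 E5 E6]] := ord3E.
  (* The determinant is y (x + z) + x z, so if x z is negative the remaining part must be
     positive. *)
  have cross (x y z : R) : 0 < x * y + x * z + y * z -> 0 < y -> x * z < 0 -> 0 < x + z.
    by move=> d y0 xz; rewrite -(pmulr_lgt0 _ y0); nra.
  move: p p1 p2; move: (m); apply: ord3P; rewrite ?E1 ?E2 ?E3 ?E4 ?E5 ?E6 => p0 p1 p2.
  - by apply: cross d0 p1 _; rewrite nmulr_rlt0.
  - exact: addr_gt0.
  - by apply: cross d0 p2 _; rewrite pmulr_rlt0.
have := @model_local_min R (pair_charge^~ q) D D' D_gt0 D'_gt0 s0 d0.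
by apply: filterS => a; rewrite energy_chartE.
Qed.

Lemma opposite_saddle q : positive_charges q -> l q < 0 -> nondegenerate_saddle (energy q) P.
Proof.
move=> q0 l0; split; first by apply: nondegenerate => //; rewrite lt_eqF.
(* The increments of the angles m + 1 and m + 2 are [h q (m + 2)] and [h q (m + 1)], the ratio
   minimizing the form for a given increment of the angle m. The value there is exactly [neg]. *)
- have [w hw] : exists w : 'rV[R]_2, w 0 0 ^+ 2 * h q 0 + w 0 1 ^+ 2 * h q 1
      + (w 0 0 + w 0 1) ^+ 2 * h q 2 < 0.
    have neg : (h q (m + 1) + h q (m + 2)) * (h q 0 * h q 1 + h q 0 * h q 2 + h q 1 * h q 2) < 0.
      rewrite pmulr_rlt0; last by rewrite addr_gt0 ?hm1 ?hm2.
      by rewrite hh pmulr_rlt0// !mulr_gt0.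
    move: neg; move: (m); have [[E1 E2 E3] [E4 E5 E6]] := ord3E.
    apply: ord3P; rewrite ?E1 ?E2 ?E3 ?E4 ?E5 ?E6 => neg.
    + exists (row2 (- (h q 1 + h q 2)) (h q 2)); have [-> ->] := row2E (- (h q 1 + h q 2)) (h q 2).
      by apply: le_lt_trans neg; rewrite le_eqVlt; apply/orP; left; apply/eqP; ring.
    + exists (row2 (h q 2) (- (h q 2 + h q 0))); have [-> ->] := row2E (h q 2) (- (h q 2 + h q 0)).
      by apply: le_lt_trans neg; rewrite le_eqVlt; apply/orP; left; apply/eqP; ring.
    + exists (row2 (h q 1) (h q 0)); have [-> ->] := row2E (h q 1) (h q 0).
      by apply: le_lt_trans neg; rewrite le_eqVlt; apply/orP; left; apply/eqP; ring.
  move=> H; apply: (@model_not_local_min R (pair_charge^~ q) D D' D_gt0 D'_gt0 w hw).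
  by apply: filterS H => a; rewrite energyP energy_chartE.
(* Keeping the angle m fixed removes its negative term from the form. *)
- have [w hw] : exists w : 'rV[R]_2, 0 < w 0 0 ^+ 2 * h q 0 + w 0 1 ^+ 2 * h q 1
      + (w 0 0 + w 0 1) ^+ 2 * h q 2.
    have pos : 0 < h q (m + 1) + h q (m + 2) by rewrite addr_gt0 ?hm1 ?hm2.
    move: pos; move: (m); have [[E1 E2 E3] [E4 E5 E6]] := ord3E.
    apply: ord3P; rewrite ?E1 ?E2 ?E3 ?E4 ?E5 ?E6 => pos.
    + by exists (row2 0 1); have [-> ->] := row2E (0 : R) 1; move: pos; nra.
    + by exists (row2 1 0); have [-> ->] := row2E (1 : R) 0; move: pos; nra.
    + by exists (row2 1 (-1)); have [-> ->] := row2E (1 : R) (-1); move: pos; nra.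
  move=> H; apply: (@model_not_local_max R (pair_charge^~ q) D D' D_gt0 D'_gt0 w hw).
  by apply: filterS H => a; rewrite energyP energy_chartE.
Qed.

Let shift3 (i : 'I_3) : [/\ i + 1 + 1 = i + 2, i + 1 + 2 = i, i + 2 + 1 = i & i + 2 + 2 = i + 1].
Proof. by move: i; apply: ord3P; split; exact/val_inj. Qed.

Let shift3_neq : (m + 1 == m) = false /\ (m + 2 == m) = false.
Proof. by move: (m); apply: ord3P. Qed.

Let pair_chargeE (q : 'rV[R]_3) : [/\ pair_charge (m + 1) q = q 0 (m + 2) * q 0 m,
  pair_charge (m + 2) q = q 0 m * q 0 (m + 1) &
  pair_charge m q = q 0 (m + 1) * q 0 (m + 2)].
Proof. by rewrite /pair_charge; have [-> -> -> ->] := shift3 m. Qed.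

Let smooth_pair_charge (q : 'rV[R]_3) i : smooth_near q (pair_charge i).
Proof. by apply: smooth_nearM; apply: smooth_near_lin; exact: lincont_coord. Qed.

Lemma opposite_pitchfork q0 : positive_charges q0 -> l q0 = 0 ->
  pitchfork (@energy R r) P q0.
Proof.
(* Varying only the charge with index m multiplies the pair charges m + 1 and m + 2 by 1 + t / q_m
   and leaves pair charge m unchanged, as the model requires. *)
move=> q0P l0; pose v : 'rV[R]_3 := delta_mx 0 m.
have qm : q0 0 m != 0 by rewrite gt_eqF.
have Dm1 : 0 < D' (m + 1) < D (m + 1) by rewrite D'_gt0; have := D_lt (m + 1); rewrite s_m1.
have Dm2 : 0 < D' (m + 2) < D (m + 2) by rewrite D'_gt0; have := D_lt (m + 2); rewrite s_m2.
have Dm : 0 < D m < D' m by rewrite D_gt0; have := D_lt m; rewrite s_m.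
have HH : h q0 (m + 1) * h q0 (m + 2) + h q0 m * (h q0 (m + 1) + h q0 (m + 2)) = 0.
  have := hh q0; rewrite l0 mulr0; move: (m); have [[E1 E2 E3] [E4 E5 E6]] := ord3E.
  by apply: ord3P; rewrite ?E1 ?E2 ?E3 ?E4 ?E5 ?E6 => <-; ring.
have cv : \forall t \near (0 : R),
   [/\ pair_charge (m + 1) (q0 + t *: v) = (1 + (q0 0 m)^-1 * t) * pair_charge (m + 1) q0,
     pair_charge (m + 2) (q0 + t *: v) = (1 + (q0 0 m)^-1 * t) * pair_charge (m + 2) q0 &
     pair_charge m (q0 + t *: v) = pair_charge m q0].
  near=> t; have [-> -> ->] := pair_chargeE (q0 + t *: v).
  have [-> -> ->] := pair_chargeE q0; rewrite !mxE eqxx !eqxx/=.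
  by have [-> ->] := shift3_neq; split; rewrite /= ?mulr0 ?addr0 ?mulr1//; field.
have [c [lam [phi [sc slam [lam0 dlam] Dphi main]]]] :=
  @pitchfork_model R _ q0 v (q0 0 m)^-1 _ _ _ _ _ _ _ _ _ Dm1 Dm2 Dm
    (smooth_pair_charge q0 (m + 1)) (smooth_pair_charge q0 (m + 2))
    (smooth_pair_charge q0 m) (pq (m + 1) q0P) (pq (m + 2) q0P) HH (invr_neq0 qm) cv.
have [f [g [lf lg fK gK fE]]] := @cyclic_coords R m.
have lto : lincont (fun p : R * R => row2 p.1 p.2).
  by apply: lincont_row2; [exact: lincont_fst|exact: lincont_snd].
have lfrom : lincont (fun a : 'rV[R]_2 => (a 0 0, a 0 1)).
  by apply: lincont_pair; exact: lincont_coord.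
have Dlin := @diffeo_family_lin R 'rV[R]_3 _ _ q0 f g lf lg fK gK.
have Dto : diffeo_family q0 (fun p : 'rV[R]_3 * (R * R) => row2 p.2.1 p.2.2).
  apply: (diffeo_family_lin q0 lto lfrom) => [[x y]|a] /=; last exact: row2K.
  by have [-> ->] := row2E x y.
have [A [N [oA oN bPhi PhiP]]] := diffeo_family_comp (diffeo_family_comp Dlin Dphi) Dto.
have sf : smooth_near (q0, 0 : 'rV[R]_2) (fun p : 'rV[R]_3 * 'rV[R]_2 => (p.1, f p.2)).
  apply: smooth_near_pair; first by smooth.
  by apply: smooth_near_lin; exact: lincont_comp (lincont_snd _ _) lf.
have f0 : f 0 = 0 by have := lf.1 (-1) 0 0; rewrite scaler0 add0r scaleN1r addNr.
have := near_pull (P := fun p => pair_charge (m + 1) p.1 * inv_dist (D (m + 1)) (D' (m + 1)) p.2.1 +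
   pair_charge (m + 2) p.1 * inv_dist (D (m + 2)) (D' (m + 2)) p.2.2 +
   pair_charge m p.1 * inv_dist (D m) (D' m) (p.2.1 + p.2.2) =
   c p.1 + (phi p).1 ^+ 4 / 4 - lam p.1 * ((phi p).1 ^+ 2 / 2) + (phi p).2 ^+ 2) sf.
rewrite /= f0 => /(_ main) /box_near[A' [N' [oA' oN' AN']]].
case: sc => Uc [oUc bc]; case: slam => Ul [oUl bl].
pose Phi (p : 'rV[R]_3 * 'rV[R]_2) := row2 (phi (p.1, f p.2)).1 (phi (p.1, f p.2)).2.
exists (A `&` A' `&` Uc `&` Ul), (N `&` N'), c, lam, Phi.
have oW : open_nbhs q0 (A `&` A' `&` Uc `&` Ul) by do 3 apply: open_nbhsI => //.
have oN2 : open_nbhs (0 : 'rV[R]_2) (N `&` N') by exact: open_nbhsI.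
split.
- by [].
- by apply: bsmooth_smooth; [exact: oW.1|move=> n; apply: bgn_sub (bc n) => q [[]]].
- split=> //; last by exists v.
  by apply: bsmooth_smooth; [exact: oW.1|move=> n; apply: bgn_sub (bl n) => q []].
- apply: bsmooth_smooth; first by apply: open_setX; [exact: oW.1|exact: oN2.1].
  by move=> n; apply: bgn_sub (bPhi n) => -[q a] [/= [[[? _] _] _] [? _]].
move=> q [[[Aq A'q] _] _]; have [Phi0 dPhi] := PhiP q Aq.
split=> //.
  apply: bdiffeo_diffeo; apply: bdiffeo_sub dPhi; first exact: oN2.1.
  by move=> a [].
move=> a [_ N'a]; have := AN' q a A'q N'a; rewrite /= => E.
rewrite energy_chartE /model_energy.
have := fE (fun i t => pair_charge i q * inv_dist (D i) (D' i) t) a.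
rewrite /= => -> ; last by move=> i t; rewrite /inv_dist cosN.
by rewrite E /Phi /=; have [-> ->] := row2E (phi (q, f a)).1 (phi (q, f a)).2.
Unshelve. all: by end_near. Qed.

Let lincont_l : lincont l.
Proof.
have H i c : lincont (fun q : 'rV[R]_3 => q 0 i * c).
  have [lc _] := @lincont_coord R _ i; split=> [t x y|x].
    by rewrite lc mulrDl -scalerAl.
  apply: (@bgn_cts _ 0 _ _ setT (fun q : 'rV[R]_3 => q 0 i * c)) => //.
  by apply: bgnM; [apply: bgn_lin; exact: lincont_coord|exact: bgn_cst].
by apply: lincontD; [apply: lincontD|]; exact: H.
Qed.

Let derive_l q : 'D_(delta_mx 0 m) l q = k (m + 1) * k (m + 2).
Proof.
have bid : bsmooth setT (fun t : R => t) by move=> n; exact: bgn_id.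
have := derive_comp_lin q (delta_mx 0 m) bid lincont_l.
rewrite [X in _ = _ * X]derive_id mulr1 => E; apply: (etrans E).
by rewrite lE !mxE !eqxx /=; have [-> ->] := shift3_neq; rewrite mul1r !mul0r addr0 mulr0 addr0.
Qed.

Lemma open_positive_charges : open (@positive_charges R).
Proof.
rewrite openE => q q0.
have H (i : 'I_3) : nbhs q (fun q' : 'rV[R]_3 => 0 < q' 0 i).
  by have /cvgr_gt := smooth_near_cts (smooth_near_lin q (@lincont_coord R _ i)); apply; exact: q0.
have H0 := H 0; have H1 := H 1; have H2 := H 2.
suff : \forall q' \near q, positive_charges q' by [].
by near=> q'; apply: ord3P; near: q'.
Unshelve. all: by end_near. Qed.

(** The derivative of [l] along the charge with index m is [k (m + 1) * k (m + 2)], positive at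
    every q, so the zero set of [l] is regular. *)
Lemma opposite_hypersurface : hypersurface (degenerate_charges P).
Proof.
move=> q0 /degenerate_chargesE[q0P _]; exists (@positive_charges R), l; split.
- by split=> //; exact: open_positive_charges.
- apply: bsmooth_smooth; first exact: open_positive_charges.
  by move=> n; apply: bgn_lin; exact: lincont_l.
- by move=> q qP; rewrite degenerate_chargesE; split=> [[]|].
- by move=> q qP _; exists (delta_mx 0 m); rewrite derive_l mulf_neq0// gt_eqF.
Qed.

Let charge_with (x : R) : 'rV[R]_3 := \row_j (if j == m then x else 1).

Let charge_with_pos x : 0 < x -> positive_charges (charge_with x).
Proof. by move=> x0 i; rewrite mxE; case: ifP. Qed.

Let l_charge_with x : l (charge_with x) =
  x * (k (m + 1) * k (m + 2)) + k m * (k (m + 1) + k (m + 2)).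
Proof. by rewrite lE !mxE eqxx; have [-> ->] := shift3_neq; ring. Qed.

Let l_slope_lt0 : k m * (k (m + 1) + k (m + 2)) < 0.
Proof. by rewrite nmulr_rlt0// addr_gt0. Qed.

Let critical_charge := - (k m * (k (m + 1) + k (m + 2))) / (k (m + 1) * k (m + 2)).

Let critical_charge_gt0 : 0 < critical_charge.
Proof.
by apply: divr_gt0; [rewrite oppr_gt0; exact: l_slope_lt0|exact: mulr_gt0].
Qed.

(** All charges are 1 except the one with index m. As the second factor is negative, t = 1, 2 and
    1/2 give witnesses for the degenerate set, the minima and the saddles. *)
Let l_critical t : l (charge_with (t * critical_charge)) =
  (1 - t) * (k m * (k (m + 1) + k (m + 2))).
Proof.
rewrite l_charge_with /critical_charge -[t * _ * _]mulrA divfK; first by ring.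
by rewrite mulf_neq0// gt_eqF.
Qed.

Lemma opposite_bifurcation :
  [/\ degenerate_charges P !=set0, hypersurface (degenerate_charges P),
      exists U V : set 'rV[R]_3,
        [/\ [/\ open U, open V, U !=set0 & V !=set0],
            U `&` V = set0, @positive_charges R `\` degenerate_charges P = U `|` V,
            (forall q, U q -> nondegenerate_min (energy q) P) &
            (forall q, V q -> nondegenerate_saddle (energy q) P)] &
      forall q0, degenerate_charges P q0 -> pitchfork (@energy R r) P q0].
Proof.
have cl : continuous l by exact: lincont_l.2.
split.
- exists (charge_with (1 * critical_charge)); apply/degenerate_chargesE; split.
    by apply: charge_with_pos; rewrite mul1r.
  by rewrite l_critical subrr mul0r.
- exact: opposite_hypersurface.
- exists (@positive_charges R `&` [set q | 0 < l q]), (@positive_charges R `&` [set q | l q < 0]).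
  split.
  + split.
    * apply: openI; first exact: open_positive_charges.
      by apply: (@open_comp _ _ l [set x | 0 < x]); [move=> q _; exact: cl|exact: open_gt].
    * apply: openI; first exact: open_positive_charges.
      by apply: (@open_comp _ _ l [set x | x < 0]); [move=> q _; exact: cl|exact: open_lt].
    * exists (charge_with (2 * critical_charge)); split.
        by apply: charge_with_pos; rewrite mulr_gt0.
      by rewrite /= l_critical; move: l_slope_lt0; move: (k m * _) => z z0; lra.
    * exists (charge_with (2^-1 * critical_charge)); split.
        by apply: charge_with_pos; rewrite mulr_gt0.
      by rewrite /= l_critical; move: l_slope_lt0; move: (k m * _) => z z0; lra.
  + by apply/seteqP; split=> q //= [[_ a] [_ b]]; move: (lt_trans a b); rewrite ltxx.
  + apply/seteqP; split=> q.
      move=> [q0 /degenerate_chargesE nB].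
      have : l q != 0 by apply/eqP => lq; apply: nB.
      by rewrite neq_lt => /orP[lq|lq]; [right|left].
    by move=> [[q0 lq]|[q0 lq]]; split=> // /degenerate_chargesE[_ l0]; move: lq;
      rewrite /= l0 ltxx.
  + by move=> q [q0 lq]; exact: opposite_min.
  + by move=> q [q0 lq]; exact: opposite_saddle.
- by move=> q0 /degenerate_chargesE[q0P l0]; exact: opposite_pitchfork.
Qed.

End Opposite.
End Aligned.

(** * The four aligned angle triples *)

Section AlignedAngles.
Context {R : realType}.

Definition opposite_angles : seq (R * R * R) := [:: (pi, pi, 0); (0, pi, pi); (pi, 0, pi)].

Definition is_pi (al : R * R * R) (i : 'I_3) : bool := angle_of al i != 0.

Lemma angle_of_pi al i : al \in (0, 0, 0) :: opposite_angles ->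
  angle_of al i = if is_pi al i then pi else 0.
Proof.
rewrite /is_pi !inE => al_in; case: eqVneq => //=.
have pi0 : pi != 0 :> R by rewrite gt_eqF ?pi_gt0.
by case/or4P: al_in => /eqP ->; move: i; apply: ord3P; rewrite /angle_of (tnth_nth 0)/= ?eqxx.
Qed.

Lemma sin_angle_of al i : al \in (0, 0, 0) :: opposite_angles -> sin (angle_of al i) = 0.
Proof. by move=> /angle_of_pi ->; case: ifP; rewrite ?sinpi ?sin0. Qed.

Lemma cos_angle_of al i : al \in (0, 0, 0) :: opposite_angles ->
  cos (angle_of al i) = if is_pi al i then -1 else 1.
Proof. by move=> /angle_of_pi ->; case: (is_pi al i); rewrite ?cospi ?cos0. Qed.

Lemma opposite_index al : al \in opposite_angles ->
  exists m, [/\ is_pi al m = false, is_pi al (m + 1) & is_pi al (m + 2)].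
Proof.
have pi0 : pi != 0 :> R by rewrite gt_eqF ?pi_gt0.
have [[E1 E2 E3] [E4 E5 E6]] := ord3E.
rewrite !inE => /or3P[] /eqP ->; [exists 2|exists 0|exists 1];
  by rewrite ?E1 ?E2 ?E3 ?E4 ?E5 ?E6 /is_pi /angle_of !(tnth_nth 0)/= eqxx pi0.
Qed.

Lemma rot_angles (u : 'rV[R]_2) (al : R * R * R) : al \in (0, 0, 0) :: opposite_angles ->
  u *m Defs.rot (- al.1.1) = u *m Defs.rot (al.1.2 + al.2).
Proof.
rewrite !inE => /or4P[] /eqP -> /=; apply: rv2P;
  by rewrite !mul_rotE cosN sinN cosD sinD ?cospi ?sinpi ?cos0 ?sin0; ring.
Qed.

End AlignedAngles.

Theorem theorem4 (R : realType) (r : 'I_3 -> R)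
    (r_gt0 : forall i, 0 < r i) (r_inj : injective r) :
  let other_angles : seq (R * R * R) :=
    [:: (pi, pi, 0); (0, pi, pi); (pi, 0, pi)] in
  let all_angles : seq (R * R * R) := (0, 0, 0) :: other_angles in
  (forall a : R * R * R, a \in all_angles -> exists! P : confspace r, has_angles P a) /\
  (forall P : confspace r,
     aligned P <-> exists2 a : R * R * R, a \in all_angles & has_angles P a) /\
  (forall q : 'rV[R]_3, positive_charges q ->
     forall P : confspace r, aligned P -> critical (energy q) P) /\
  (forall P : confspace r, has_angles P (0, 0, 0) ->
     forall q : 'rV[R]_3, positive_charges q ->
       nondegenerate_max (energy q) P /\
       (forall P' : confspace r, P' <> P -> energy q P' < energy q P)) /\
  (forall (P : confspace r) (a : R * R * R), a \in other_angles -> has_angles P a ->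
     let B := degenerate_charges P in
     [/\ B !=set0, hypersurface B,
         exists U V : set 'rV[R]_3,
           [/\ [/\ open U, open V, U !=set0 & V !=set0],
               U `&` V = set0, positive_charges `\` B = U `|` V,
               (forall q, U q -> nondegenerate_min (energy q) P) &
               (forall q, V q -> nondegenerate_saddle (energy q) P)] &
         forall q0, B q0 -> pitchfork (@energy R r) P q0]).
Proof.
move=> other_angles all_angles.
have sin0 a : a \in all_angles -> forall i, sin (angle_of a i) = 0.
  by move=> ain i; exact: sin_angle_of.
have cosE a : a \in all_angles -> forall i, cos (angle_of a i) = if is_pi a i then -1 else 1.
  by move=> ain i; exact: cos_angle_of.
have alignedP (P : confspace r) :
    aligned P <-> exists2 a : R * R * R, a \in all_angles & has_angles P a.
  split=> [/(aligned_angles r_gt0)[s hs]|[a ain ha]].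
    (* The eight sign patterns give only four triples, because flipping all three bits leaves every
       angle unchanged. *)
    by move: hs; case: (s 0) (s 1) (s 2) => -[] [] /= hs; eexists; try exact: hs;
      rewrite !inE !eqxx ?orbT.
  by apply: (has_angles_aligned r_gt0 _ ha); exact: sin0.
split.
  move=> a ain; have [P hP] := has_angles_exists r_gt0 (fun u => rot_angles u ain).
  by exists P; split=> // P' hP'; exact: (has_angles_inj r_gt0 hP hP').
split=> //; split.
  move=> q _ P /alignedP[a ain ha].
  exact: (aligned_critical r_gt0 r_inj ha (sin0 _ ain) (cosE _ ain)).
split.
  move=> P hP q q0.
  have max P' : P' <> P -> energy q P' < energy q P.
    by move=> PP'; exact: (collinear_energy_max r_gt0 r_inj hP q0).
  split=> //; split.
    have zin : (0, 0, 0) \in all_angles by rewrite !inE eqxx.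
    apply: (collinear_nondegenerate r_gt0 r_inj hP (sin0 _ zin) (cosE _ zin)) q0.
    by move=> i; apply/eqP; move: i; apply: ord3P; rewrite /angle_of (tnth_nth 0).
  near=> a; have [->//|/eqP PP] := eqVneq (chart P a) P.
  exact/ltW/max.
move=> P a aother ha B.
have ain : a \in all_angles by rewrite inE aother orbT.
have [m [m0 m1 m2]] := opposite_index aother.
exact: (opposite_bifurcation r_gt0 r_inj ha (sin0 _ ain) (cosE _ ain) m0 m1 m2).
Unshelve. all: by end_near. Qed.
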